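(* Let $C$ be a hyperelliptic curve of genus $\pi\geq 2$ with canonical (hyperelliptic) involution $\delta:C\to C$. Let $\sigma:C\to C$ be an involution of genus $g$. Then $\delta\sigma$ is an involution of $C$ of genus $\pi-g$.
   Context: Curves are smooth, irreducible and projective. A hyperelliptic curve is a curve of genus at least $2$ admitting a $2:1$ morphism to $\mathbf{P}^1$; its canonical involution is $\delta(P)=\pi_2^1-P$, where $\pi_2^1$ is the unique linear series of degree $2$ and dimension $1$ on $C$ (so $P+\delta(P)\in\pi_2^1$ for every $P$). An involution of genus $g$ of $C$ is an automorphism $\sigma$ of order $2$ such that the quotient $C/\sigma$ is a smooth curve of genus $g$.
   Formalization: For σ = δ the composite δσ is the identity, which does not have order 2; so ''δσ is an involution of genus π − g'' is asserted for σ ≠ δ, while ''the quotient C/(δσ) has genus π − g'' is asserted in all cases. *)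

(* Defs.v *)
From HB Require Import structures.
From mathcomp Require Import all_boot all_order all_algebra.
From mathcomp Require Import boolp.
From mathcomp.multinomials Require Import freeg.

Set Implicit Arguments.
Unset Strict Implicit.
Unset Printing Implicit Defensive.

Import Order.TTheory GRing.Theory Num.Theory.

Local Open Scope ring_scope.

(* [V] is a linear subspace of dimension [n] of [K], regarded as a vector
   space over [F] through [phi]. *)
Definition has_dim (F K : fieldType) (phi : {rmorphism F -> K})
    (V : K -> Prop) (n : nat) : Prop :=
  exists e : 'I_n -> K,
    (forall c : 'I_n -> F, \sum_(i < n) phi (c i) * e i = 0 -> forall i, c i = 0)
    /\ (forall f : K, V f <-> exists c : 'I_n -> F, f = \sum_(i < n) phi (c i) * e i).

(* A smooth irreducible projective curve over the algebraically closed field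
   [k] is presented as the abstract nonsingular curve of its function field
   (Hartshorne, I.6): the field is a finite extension of k(X), the closed
   points are its discrete valuations over [k], and a rational function is
   regular at a point when its valuation there is nonnegative. *)
Record curve (k : closedFieldType) := Curve {
  funfield : fieldType;
  cst : {rmorphism k -> funfield};
  curveP : exists2 iota : {rmorphism {fraction {poly k}} -> funfield},
    (forall c : k, iota (FracField.tofrac c%:P) = cst c)
    & exists n : nat, has_dim iota (fun _ => True) n
}.

(* [ord P f] is the order of vanishing of [f] at [P].  The value [ord P 0 = 0]
   is a convention which makes a point determined by its order function. *)
Record point (k : closedFieldType) (C : curve k) := Point {
  ord : funfield C -> int;
  ord0 : ord 0 = 0;
  ordM : forall f h : funfield C,
    f != 0 -> h != 0 -> ord (f * h) = ord f + ord h;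
  ordD : forall f h : funfield C,
    f != 0 -> h != 0 -> f + h != 0 -> Num.min (ord f) (ord h) <= ord (f + h);
  ord_cst : forall c : k, ord (cst C c) = 0;
  ord_onto : exists t : funfield C, ord t = 1
}.

HB.instance Definition _ (k : closedFieldType) (C : curve k) :=
  gen_eqMixin (point C).
HB.instance Definition _ (k : closedFieldType) (C : curve k) :=
  gen_choiceMixin (point C).

Definition regular_at (k : closedFieldType) (C : curve k)
  (f : funfield C) (P : point C) : Prop := 0 <= ord P f.

(* The nonconstant morphisms of curves: a map on points together with the
   induced embedding of function fields. *)
Record morphism (k : closedFieldType) (C D : curve k) := Morphism {
  on_points :> point C -> point D;
  pullback : {rmorphism funfield D -> funfield C};
  pullback_cst : forall c : k, pullback (cst D c) = cst C c;
  pullback_regular : forall (P : point C) (f : funfield D),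
    regular_at f (on_points P) -> regular_at (pullback f) P
}.

Section Composition.
Variables (k : closedFieldType) (C D E : curve k).
Variables (psi : morphism D E) (phi : morphism C D).

Lemma comp_pullback_cst (c : k) :
  (pullback phi \o pullback psi) (cst E c) = cst C c.
Proof. by rewrite /= !pullback_cst. Qed.

Lemma comp_pullback_regular (P : point C) (f : funfield E) :
  regular_at f (psi (phi P)) ->
  regular_at ((pullback phi \o pullback psi) f) P.
Proof. by move=> fP; do 2 apply: pullback_regular. Qed.

Definition comp_morphism : morphism C E :=
  @Morphism k C E (fun P => psi (phi P)) (pullback phi \o pullback psi)
    comp_pullback_cst comp_pullback_regular.

End Composition.

Definition has_degree (k : closedFieldType) (C D : curve k)
    (phi : morphism C D) (n : nat) : Prop :=
  has_dim (pullback phi) (fun _ => True) n.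

Section ProjectiveLine.
Variable k : closedFieldType.

Definition P1_cst : {rmorphism k -> {fraction {poly k}}} :=
  @FracField.tofrac {poly k} \o @polyC k.

Lemma P1_curveP :
  exists2 iota : {rmorphism {fraction {poly k}} -> {fraction {poly k}}},
    (forall c : k, iota (FracField.tofrac c%:P) = P1_cst c)
    & exists n : nat, has_dim iota (fun _ => True) n.
Proof.
exists idfun; first by [].
exists 1, (fun _ => 1); split=> [c|f].
  by rewrite big_ord1 mulr1 => c0 i; rewrite ord1.
by split=> // _; exists (fun _ => f); rewrite big_ord1 mulr1.
Qed.

Definition P1 : curve k := Curve P1_curveP.

End ProjectiveLine.

Definition divisor (k : closedFieldType) (C : curve k) := {freeg (point C)}.

(* The space L(D). *)
Definition riemann_roch_space (k : closedFieldType) (C : curve k)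
    (D : divisor C) (f : funfield C) : Prop :=
  f = 0 \/ forall P : point C, 0 <= ord P f + coeff P D.

(* The genus is the maximum of deg D + 1 - dim L(D) over all divisors D. *)
Definition has_genus (k : closedFieldType) (C : curve k) (g : int) : Prop :=
  (forall (D : divisor C) (l : nat),
      has_dim (cst C) (riemann_roch_space D) l -> deg D + 1 - l%:Z <= g)
  /\ (exists (D : divisor C) (l : nat),
      has_dim (cst C) (riemann_roch_space D) l /\ deg D + 1 - l%:Z = g).

(* A linear series of degree [d] and (projective) dimension [r], as the set of
   effective divisors D + div(f) for nonzero f in an (r+1)-dimensional subspace
   of L(D). *)
Definition is_linear_series (k : closedFieldType) (C : curve k)
    (d : int) (r : nat) (S : divisor C -> Prop) : Prop :=
  exists (D : divisor C) (V : funfield C -> Prop),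
    [/\ deg D = d,
        has_dim (cst C) V r.+1,
        forall f : funfield C, V f -> riemann_roch_space D f
      & forall E : divisor C, S E <->
          exists f : funfield C, [/\ V f, f != 0 &
            forall P : point C, coeff P E = coeff P D + ord P f]].

Definition hyperelliptic (k : closedFieldType) (C : curve k) : Prop :=
  (exists2 pi : int, 2 <= pi & has_genus C pi)
  /\ (exists phi : morphism C (P1 k), has_degree phi 2).

(* A morphism with this property is an automorphism, being its own inverse. *)
Definition order_two (k : closedFieldType) (C : curve k)
    (sigma : morphism C C) : Prop :=
  (forall P : point C, sigma (sigma P) = P) /\ ~ (sigma =1 id).

(* On a curve of genus at least 2 there is at most one linear series of degree
   2 and dimension 1, so that the existential quantifier is harmless. *)
Definition canonical_involution (k : closedFieldType) (C : curve k)
    (delta : morphism C C) : Prop :=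
  order_two delta /\
  exists2 S : divisor C -> Prop, is_linear_series 2 1 S
    & forall P : point C, S (<< P >> + << delta P >>).

(* [D], with the projection [q], is the quotient of [C] by the group generated
   by the automorphism [sigma] of finite order: its points are the orbits and
   its rational functions are the invariant ones. *)
Definition is_quotient (k : closedFieldType) (C D : curve k)
    (sigma : morphism C C) (q : morphism C D) : Prop :=
  [/\ forall R : point D, exists P : point C, q P = R,
      forall P Q : point C, q P = q Q <-> exists n : nat, Q = iter n sigma P
    & forall f : funfield C, pullback sigma f = f <->
        exists h : funfield D, f = pullback q h].

Definition quotient_has_genus (k : closedFieldType) (C : curve k)
    (sigma : morphism C C) (g : int) : Prop :=
  exists (D : curve k) (q : morphism C D), is_quotient sigma q /\ has_genus D g.

Definition involution_of_genus (k : closedFieldType) (C : curve k)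
    (sigma : morphism C C) (g : int) : Prop :=
  order_two sigma /\ quotient_has_genus sigma g.

(* Main.v *)
Require Import Defs.
From HB Require Import structures.
From mathcomp Require Import all_boot all_order all_algebra.
From mathcomp Require Import boolp zify ring.
From mathcomp.multinomials Require Import freeg.

(* The hyperelliptic involution delta of C is the Galois involution of
   K = k(C) over some k(x), and since C has genus at least 2 every function
   with at most two poles lies in k(x).  Hence sigma preserves k(x), commutes
   with delta, and after a change of x satisfies sigma(x) = 1 - x (one normal
   form for all characteristics).  Then C, C/sigma and C/(delta sigma) are
   double covers of the lines with coordinates x, z = x(1 - x) and z.

   The genus of a double cover is read off from its gap: if X is the pole
   divisor of x and M is least such that L(MX) is not contained in k(x), then
   L(nX) = k[x]_{<= n} + k[x]_{<= n - M} y, so the genus is M - 1.  The space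
   L(nZ) of C/sigma consists of the sigma-invariants of L(2nX), so everything
   reduces to comparing the actions of sigma and delta sigma on
   L(MX) = k[x]_{<= M} + k y: the gaps a and b of the two quotients satisfy
   a + b = M + 1, which is the assertion. *)

Set Implicit Arguments.
Unset Strict Implicit.
Unset Printing Implicit Defensive.

Import Order.TTheory GRing.Theory Num.Theory.

Local Open Scope ring_scope.

(** * Valuations *)

(** Points are bare valuations, so the geometry is extracted from fields: every value of x is taken,
    a fibre is one orbit, residue fields are k. What carries the comparison is the trace and norm
    criterion [Lsp_tr_nm]: membership in L(nX) becomes a degree bound on two polynomials, without
    points, and so passes between C and its quotients.

    The obstacle is characteristic 2, where sigma need not be diagonalizable on L(MX). A trace
    argument valid in all characteristics gives M <= 2a <= M + 2, and the same for b. For odd M both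
    gaps are then (M + 1)/2. For M = 2m each is m or m + 1, and it must be shown that exactly one of
    sigma, delta sigma has an invariant in L(MX) outside k(x). If 2 is invertible this is a matter
    of signs: sigma acts on y modulo polynomials by 1 or -1, and delta by -1. In characteristic 2
    the signs coincide, and the decision comes from the top coefficients of traces and norms, which
    x -> 1 - x preserves because the degrees are even. *)

Lemma int_factor1 (a b : int) : 0 <= a -> 1 = a * b -> a = 1.
Proof.
move=> a0 e; have : (a %| 1)%Z by apply/dvdzP; exists b; rewrite mulrC.
by rewrite dvdz1; lia.
Qed.

Section Valuations.
Variables (k : closedFieldType) (C : curve k).
Implicit Types (P Q : point C) (f h : funfield C) (n m : int).

Lemma point_eq P Q : ord P =1 ord Q -> P = Q.
Proof.
case: P => o o0 oM oD oc ot; case: Q => o' o0' oM' oD' oc' ot' /= e.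
have {}e : o = o' by apply: funext.
case: _ / e in o0' oM' oD' oc' ot' *.
by congr Point; apply: Prop_irrelevance.
Qed.

Lemma ord_1 P : ord P 1 = 0.
Proof. by rewrite -(rmorph1 (cst C)) ord_cst. Qed.

Lemma ord_N P f : ord P (- f) = ord P f.
Proof.
have [->|f0] := eqVneq f 0; first by rewrite oppr0.
rewrite -mulN1r ordM ?oppr_eq0 ?oner_eq0 //.
by rewrite -(rmorph1 (cst C)) -rmorphN ord_cst add0r.
Qed.

Lemma ord_V P f : ord P f^-1 = - ord P f.
Proof.
have [->|f0] := eqVneq f 0; first by rewrite invr0 Defs.ord0.
have := ordM P f0 (invr_neq0 f0); rewrite divff // ord_1; lia.
Qed.

Lemma ord_div P f h : f != 0 -> h != 0 -> ord P (f / h) = ord P f - ord P h.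
Proof. by move=> f0 h0; rewrite ordM ?invr_eq0 // ord_V. Qed.

Lemma ord_X P f (n : nat) : ord P (f ^+ n) = ord P f * n%:Z.
Proof.
have [->|f0] := eqVneq f 0.
  by rewrite Defs.ord0 mul0r expr0n; case: n => [|n]; rewrite ?ord_1 ?Defs.ord0.
elim: n => [|n IHn]; first by rewrite expr0 ord_1 mulr0.
by rewrite exprS ordM ?expf_neq0 // IHn; lia.
Qed.

Lemma ord_Xz P f n : f != 0 -> ord P (f ^ n) = ord P f * n.
Proof.
move=> f0; case: n => n; first by rewrite -exprnP ord_X.
by rewrite NegzE -exprnN ord_V ord_X mulrN.
Qed.

(* The convention [ord P 0 = 0] makes membership of [0] a separate case. *)
Definition vge P n f : bool := (f == 0) || (n <= ord P f).

Lemma vgeE P n f : f != 0 -> vge P n f = (n <= ord P f).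
Proof. by rewrite /vge => /negPf->. Qed.

Lemma vge_0 P n : vge P n 0.
Proof. by rewrite /vge eqxx. Qed.

Lemma vge_ord P n f : n <= ord P f -> vge P n f.
Proof. by rewrite /vge => ->; rewrite orbT. Qed.

Lemma vge_le P n m f : m <= n -> vge P n f -> vge P m f.
Proof.
move=> le_mn /orP[/eqP->|nf]; first exact: vge_0.
by apply: vge_ord; apply: le_trans le_mn nf.
Qed.

Lemma vgeD P n f h : vge P n f -> vge P n h -> vge P n (f + h).
Proof.
have [->|f0] := eqVneq f 0; first by rewrite add0r.
have [->|h0] := eqVneq h 0; first by rewrite addr0.
have [->|fh0] := eqVneq (f + h) 0; first by rewrite vge_0.
rewrite !vgeE // => nf nh; apply: le_trans (ordD P f0 h0 fh0).
by rewrite le_min nf nh.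
Qed.

Lemma vgeN P n f : vge P n (- f) = vge P n f.
Proof. by rewrite /vge oppr_eq0 ord_N. Qed.

Lemma vgeB P n f h : vge P n f -> vge P n h -> vge P n (f - h).
Proof. by move=> nf nh; apply: vgeD; rewrite ?vgeN. Qed.

Lemma vgeM P n m f h : vge P n f -> vge P m h -> vge P (n + m) (f * h).
Proof.
have [->|f0] := eqVneq f 0; first by rewrite mul0r => _ _; apply: vge_0.
have [->|h0] := eqVneq h 0; first by rewrite mulr0 => _ _; apply: vge_0.
by rewrite !vgeE ?mulf_neq0 // ordM //; lia.
Qed.

Lemma vgeMl P n f h : vge P 0 f -> vge P n h -> vge P n (f * h).
Proof. by move=> f0 /(vgeM f0); rewrite add0r. Qed.

Lemma vgeM0 P f h : vge P 0 f -> vge P 0 h -> vge P 0 (f * h).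
Proof. exact: vgeMl. Qed.

Lemma vge_cst P c : vge P 0 (cst C c).
Proof. by apply: vge_ord; rewrite ord_cst. Qed.

Lemma vge_1 P : vge P 0 1.
Proof. by apply: vge_ord; rewrite ord_1. Qed.

Lemma vgeX P f (i : nat) : vge P 0 f -> vge P 0 (f ^+ i).
Proof.
by move=> f0; elim: i => [|i IHi]; rewrite ?expr0 ?vge_1 // exprS vgeM0.
Qed.

Lemma dominant P n f h : f != 0 -> ord P f < n -> vge P n h ->
  f + h != 0 /\ ord P (f + h) = ord P f.
Proof.
move=> f0 fn nh.
have fh0 : f + h != 0.
  apply/eqP => /eqP; rewrite addr_eq0 => /eqP fE; move: nh fn.
  by rewrite -vgeN -fE vgeE //; lia.
split=> //; apply/eqP; rewrite eq_le.
have le1 : ord P f <= ord P (f + h).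
  rewrite -vgeE //; apply: vgeD; first exact: vge_ord.
  by apply: vge_le nh; lia.
rewrite le1 andbT leNgt; apply/negP => lt1.
have : vge P (Num.min n (ord P (f + h))) (f + h - h).
  apply: vgeB; first by apply: vge_ord; rewrite ge_min lexx orbT.
  by apply: vge_le nh; rewrite ge_min lexx.
by rewrite addrK vgeE //; lia.
Qed.

(** Valuation rings are integrally closed: at a pole, f * f has a pole twice as deep as f, while the
    right side has one no deeper than f. In most uses T and N are the trace and norm of f. *)
Lemma integral P f T N : vge P 0 T -> vge P 0 N ->
  f * f = T * f - N -> vge P 0 f.
Proof.
move=> T0 N0 fE; apply/negPn/negP; rewrite /vge negb_or -ltNge => /andP[f0 lt0].
have ff0 : f * f != 0 by rewrite mulf_neq0.
have : vge P (ord P f) (f * f).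
  rewrite fE; apply: vgeB; first by apply: vgeMl => //; apply: vge_ord.
  by apply: vge_le N0; lia.
by rewrite vgeE // ordM //; lia.
Qed.

(* Valuation rings of rank one are maximal subrings. *)
Lemma ring_eq P Q : (forall f, vge P 0 f -> vge Q 0 f) -> P = Q.
Proof.
move=> sub.
have unit f : f != 0 -> ord P f = 0 -> ord Q f = 0.
  move=> f0 Pf.
  have : vge Q 0 f by apply: sub; apply: vge_ord; rewrite Pf.
  have : vge Q 0 f^-1 by apply: sub; apply: vge_ord; rewrite ord_V Pf.
  by rewrite !vgeE ?invr_eq0 // ord_V; lia.
have [t tP] := ord_onto P.
have t0 : t != 0 by apply/eqP => t0; move: tP; rewrite t0 Defs.ord0.
(* Units at P are units at Q, so [ord Q] is a multiple of [ord P]. The factor is nonnegative because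
   t is regular at Q, and it divides 1 because [ord Q] is onto. *)
have QE f : f != 0 -> ord Q f = ord Q t * ord P f.
  move=> f0; have u0 : f / t ^ ord P f != 0.
    by rewrite mulf_neq0 // invr_eq0 expfz_neq0.
  have : ord Q (f / t ^ ord P f) = 0.
    by apply: unit => //; rewrite ord_div ?expfz_neq0 // ord_Xz // tP; lia.
  by rewrite ord_div ?expfz_neq0 // ord_Xz // => /eqP; rewrite subr_eq0 => /eqP.
have Qt : ord Q t = 1.
  have : vge Q 0 t by apply: sub; apply: vge_ord; rewrite tP.
  rewrite vgeE // => Qt; have [w wQ] := ord_onto Q.
  have w0 : w != 0 by apply/eqP => w0; move: wQ; rewrite w0 Defs.ord0.
  exact: int_factor1 Qt (etrans (esym wQ) (QE _ w0)).
apply: point_eq => f; have [->|f0] := eqVneq f 0; first by rewrite !Defs.ord0.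
by rewrite QE // Qt mul1r.
Qed.

(** By maximality neither valuation ring contains the other. A function regular at Q but not at P,
    divided by one regular at P but not at Q, does both things. *)
Lemma separate P Q : P <> Q ->
  exists f, [/\ f != 0, ord P f < 0 & 0 < ord Q f].
Proof.
move=> PQ.
have nsub P' Q' : P' <> Q' -> exists f, vge P' 0 f /\ ~~ vge Q' 0 f.
  move=> PQ'; apply: contrapT => nex; apply: PQ'; apply: ring_eq => f Pf.
  by apply/negPn/negP => Qf; apply: nex; exists f.
have [u [Pu Qu]] := nsub _ _ PQ.
have [w [Qw Pw]] := nsub _ _ (fun e => PQ (esym e)).
have u0 : u != 0 by apply: contra Qu => /eqP->; apply: vge_0.
have w0 : w != 0 by apply: contra Pw => /eqP->; apply: vge_0.
rewrite !vgeE // in Pu Qu Pw Qw.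
by exists (w / u); rewrite mulf_neq0 ?invr_eq0 // !ord_div //; split=> //; lia.
Qed.

Lemma expfz_split (t : funfield C) n m : t != 0 -> t ^ n = t ^ m * t ^ (n - m).
Proof. by move=> t0; rewrite -expfzDr // addrC subrK. Qed.

(** The hypotheses say that O is a discrete valuation ring with uniformizer t; its valuation is the
    exponent of t. Points of the line and of double covers are built from their local rings in this
    way. *)
Lemma point_of_ring (O : funfield C -> Prop) (t : funfield C) :
  (forall c, O (cst C c)) ->
  (forall f h, O f -> O h -> O (f + h)) ->
  (forall f h, O f -> O h -> O (f * h)) ->
  O t -> ~ O t^-1 ->
  (forall f, f != 0 -> exists (n : int) u,
     [/\ u != 0, O u, O u^-1 & f = t ^ n * u]) ->
  exists P, (forall f, O f <-> vge P 0 f) /\ ord P t = 1.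
Proof.
move=> Oc OD OM Ot Ot' dec.
have t0 : t != 0.
  apply/eqP => t0; apply: Ot'; rewrite t0 invr0 -(rmorph0 (cst C)); exact: Oc.
have O1 : O 1 by rewrite -(rmorph1 (cst C)).
have OX u (i : nat) : O u -> O (u ^+ i).
  by move=> Ou; elim: i => [|i IHi]; rewrite ?expr0 // exprS; apply: OM.
(* For n < 0 the element t^-1 = t^(-1-n) * t^n would lie in O. *)
have Oneg n u : O (t ^ n * u) -> O u^-1 -> u != 0 -> 0 <= n.
  move=> Of Ou u0; rewrite leNgt; apply/negP => n0; apply: Ot'.
  have -> : t^-1 = t ^+ absz (n + 1) * ((t ^ n * u) * u^-1).
    rewrite mulfK // exprnP (_ : (absz (n + 1))%:Z = - 1 - n); last by lia.
    by rewrite -expfzDr // subrK.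
  by apply: (OM); [exact: OX|exact: OM].
pose ordP f (n : int) := (f = 0 /\ n = 0) \/
  (f != 0 /\ exists u, [/\ u != 0, O u, O u^-1 & f = t ^ n * u]).
have ex f : exists n, ordP f n.
  have [->|f0] := eqVneq f 0; first by exists 0; left.
  by have [n [u [? ? ? ?]]] := dec f f0; exists n; right; split=> //; exists u.
have [v vdef] := choice ex.
have vP f : f != 0 -> exists u, [/\ u != 0, O u, O u^-1 & f = t ^ v f * u].
  by have [[-> _]|[_ e]] := vdef f; rewrite ?eqxx.
have vlt n u : u != 0 -> O u -> O u^-1 -> v (t ^ n * u) = n.
  move=> u0 Ou Ou'.
  have f0 : t ^ n * u != 0 by rewrite mulf_neq0 ?expfz_neq0.
  have [w [w0 Ow Ow' e]] := vP _ f0; set m := v _ in e *.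
  have le a b (y z : funfield C) : y != 0 -> z != 0 -> O z -> O y^-1 ->
      t ^ a * y = t ^ b * z -> b <= a.
    move=> y0 z0 Oz Oy; rewrite (expfz_split a b t0) -mulrA.
    move/(mulfI (expfz_neq0 b t0)) => e'.
    by have := @Oneg (a - b) y; rewrite e' => /(_ Oz Oy y0); lia.
  by apply/eqP; rewrite eq_le (le n m u w) // (le m n w u).
have v1 c : c != 0 -> v (cst C c) = 0.
  move=> c0; rewrite -[cst C c]mul1r -[X in X * _](expr0z t) vlt //.
    by rewrite fmorph_eq0.
  by rewrite -fmorphV.
have v_0 : v 0 = 0 by have [[_ ->]|[]] := vdef 0; rewrite ?eqxx.
have OE f : f != 0 -> O f <-> 0 <= v f.
  move=> f0; have [u [u0 Ou Ou' fE]] := vP f f0.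
  split=> [|le0]; first by rewrite {1}fE => /Oneg; apply.
  by rewrite fE; apply: OM => //; rewrite -(gez0_abs le0) -exprnP; apply: OX.
have vM f h : f != 0 -> h != 0 -> v (f * h) = v f + v h.
  move=> f0 h0; have [u [u0 Ou Ou' fE]] := vP f f0.
  have [w [w0 Ow Ow' hE]] := vP h h0.
  rewrite {1}fE {1}hE mulrACA -expfzDr // vlt ?mulf_neq0 //; first exact: OM.
  by rewrite invfM; apply: OM.
have vV f : f != 0 -> v f^-1 = - v f.
  move=> f0; have := vM _ _ f0 (invr_neq0 f0).
  by rewrite divff // -(rmorph1 (cst C)) v1 ?oner_eq0 //; lia.
have vD f h : f != 0 -> h != 0 -> f + h != 0 -> Num.min (v f) (v h) <= v (f + h).
  wlog le : f h / v f <= v h => [hw|] f0 h0 fh0.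
    have [le|/ltW le] := leP (v f) (v h).
      by have := hw _ _ le f0 h0 fh0; rewrite minEle le.
    by have := hw _ _ le h0 f0; rewrite addrC => /(_ fh0); rewrite minEle le.
  rewrite minEle le; have fhE : f + h = f * (1 + h / f) by rewrite mulrDr mulr1 mulrC divfK.
  have i0 : 1 + h / f != 0 by apply: contra fh0; rewrite fhE => /eqP->; rewrite mulr0.
  rewrite fhE vM // -subr_ge0 addrAC subrr add0r; apply/OE => //; apply: (OD) => //.
  have hf0 : h / f != 0 by rewrite mulf_neq0 ?invr_eq0.
  by apply/OE => //; rewrite vM ?invr_eq0 // vV //; lia.
have vc c : v (cst C c) = 0.
  by have [->|] := eqVneq c 0; [rewrite rmorph0|apply: v1].
have vt : v t = 1.
  by rewrite -[t]mulr1 -[X in X * _](expr1z t) vlt ?oner_eq0 ?invr1.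
exists (Point v_0 vM vD vc (ex_intro _ t vt)); split=> //= f.
have [->|f0] := eqVneq f 0; last by rewrite vgeE //=; apply: OE.
by rewrite vge_0; split=> // _; rewrite -(rmorph0 (cst C)).
Qed.

(** The value group is a nonzero subgroup of the integers, generated by its least positive element
    e, and v / e is normalized. When a point is restricted to a subfield, e is the ramification
    index. *)
Lemma point_of_valuation (v : funfield C -> int) :
  v 0 = 0 ->
  (forall f h, f != 0 -> h != 0 -> v (f * h) = v f + v h) ->
  (forall f h, f != 0 -> h != 0 -> f + h != 0 ->
     Num.min (v f) (v h) <= v (f + h)) ->
  (forall c, v (cst C c) = 0) -> (exists f, v f != 0) ->
  exists P (e : int), 0 < e /\ forall f, v f = e * ord P f.
Proof.
move=> v0 vM vD vc [f0 vf0].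
have nz f : v f != 0 -> f != 0 by apply: contra => /eqP->; rewrite v0.
have v1 : v 1 = 0 by rewrite -(rmorph1 (cst C)).
have vV f : v f^-1 = - v f.
  have [->|fn] := eqVneq f 0; first by rewrite invr0 v0.
  by have := vM _ _ fn (invr_neq0 fn); rewrite divff // v1; lia.
have vXz f n : f != 0 -> v (f ^ n) = v f * n.
  move=> fn; have vX (i : nat) : v (f ^+ i) = v f * i%:Z.
    elim: i => [|i IHi]; first by rewrite expr0 v1 mulr0.
    by rewrite exprS vM ?expf_neq0 // IHi; lia.
  by case: n => n; rewrite ?NegzE -?exprnP -?exprnN ?vV vX ?mulrN.
pose p (n : nat) := `[< (0 < n)%N /\ exists f, v f = n%:Z >].
have exp : exists n : nat, p n.
  exists `|v f0|%N; apply/asboolP; split; first by lia.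
  have [le|lt] := leP 0 (v f0); first by exists f0; lia.
  by exists f0^-1; rewrite vV; lia.
case: (ex_minnP exp) => e /asboolP[e0 [t te]] mine.
have t0 : t != 0 by apply: nz; rewrite te; lia.
have dv f : (v f = e%:Z * (v f %/ e)%Z).
  have [->|fn] := eqVneq f 0; first by rewrite v0 div0z mulr0.
  set r := (v f %% e)%Z.
  have : v (f / t ^ (v f %/ e)%Z) = r.
    rewrite vM ?invr_eq0 ?expfz_neq0 // vV vXz // te /r.
    by rewrite {1}(divz_eq (v f) e); lia.
  have r0 : 0 <= r by rewrite modz_ge0; lia.
  have re : r < e by rewrite ltz_pmod; lia.
  have [r_0 _|rn hr] := eqVneq r 0.
    by rewrite {1}(divz_eq (v f) e) -/r r_0 addr0 mulrC.
  suff /mine : p `|r|%N by lia.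
  by apply/asboolP; split; [lia|exists (f / t ^ (v f %/ e)%Z); lia].
pose w f := (v f %/ e)%Z.
have en : (e%:Z : int) != 0 by lia.
have w_0 : w 0 = 0 by rewrite /w v0 div0z.
have wM f h : f != 0 -> h != 0 -> w (f * h) = w f + w h.
  move=> fn hn; have := vM _ _ fn hn; rewrite dv (dv f) (dv h) -mulrDr.
  exact: (mulfI en).
have wD f h : f != 0 -> h != 0 -> f + h != 0 -> Num.min (w f) (w h) <= w (f + h).
  move=> fn hn fhn; have := vD _ _ fn hn fhn.
  rewrite (dv f) (dv h) (dv (f + h)) -minr_pMr; last by lia.
  by rewrite ler_pM2l //; lia.
have wc c : w (cst C c) = 0 by rewrite /w vc div0z.
have wt : w t = 1 by rewrite /w te divzz; lia.
exists (Point w_0 wM wD wc (ex_intro _ t wt)), e%:Z; split; first by lia.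
by move=> f /=; rewrite -dv.
Qed.

End Valuations.

(** * Rational functions of one element *)

Lemma frac_decomp (R : idomainType) (f : {fraction R}) :
  exists n d : R, d != 0 /\ f = tofrac n / tofrac d.
Proof.
elim/quotW: f => a; exists (frac a).1, (frac a).2.
have d0 := denom_ratioP a; split=> //.
have t0 : tofrac (frac a).2 != 0 by rewrite tofrac_eq0.
apply: (canRL (mulfK t0)); rewrite !piE; apply/eqP; rewrite FracField.equivf_def.
by rewrite /FracField.mulf !numden_Ratio ?mulf_neq0 ?oner_eq0 // !mulr1 mulrC.
Qed.

Lemma frac_lift (R : idomainType) (F : fieldType) (j : {rmorphism R -> F}) :
  injective j ->
  exists iota : {rmorphism {fraction R} -> F}, forall r, iota (tofrac r) = j r.
Proof.
move=> injj; have j0 r : (j r == 0) = (r == 0).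
  by rewrite -(inj_eq injj) rmorph0.
(* Asking for the same value from every representation as a quotient makes the function obtained by
   choice well defined. *)
pose rel (f : {fraction R}) (v : F) := forall n d : R,
  d != 0 -> f = tofrac n / tofrac d -> v = j n / j d.
have ex f : exists v, rel f v.
  have [n [d [d0 fE]]] := frac_decomp f; exists (j n / j d) => n' d' d'0.
  rewrite fE => /eqP; rewrite eqr_div ?tofrac_eq0 // -!rmorphM /= tofrac_eq.
  by move=> /eqP e; apply/eqP; rewrite eqr_div ?j0 // -!rmorphM e.
have [i iP] := choice ex.
have iE n d : d != 0 -> i (tofrac n / tofrac d) = j n / j d.
  by move=> d0; apply: iP.
have iT r : i (tofrac r) = j r.
  by have := iE r 1 (oner_neq0 _); rewrite !rmorph1 !divr1.
have iB : zmod_morphism i.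
  move=> f h; have [n [d [d0 ->]]] := frac_decomp f.
  have [n' [d' [d'0 ->]]] := frac_decomp h.
  rewrite -mulNr -rmorphN addf_div ?tofrac_eq0 // -!rmorphM -rmorphD.
  rewrite !iE ?mulf_neq0 // -mulNr addf_div ?j0 //.
  by rewrite !(rmorphD, rmorphM, rmorphN).
have iM : monoid_morphism i.
  split=> [|f h]; first by rewrite -(rmorph1 (@tofrac R)) iT rmorph1.
  have [n [d [d0 ->]]] := frac_decomp f.
  have [n' [d' [d'0 ->]]] := frac_decomp h.
  by rewrite mulf_div -!rmorphM !iE ?mulf_neq0 // mulf_div !rmorphM.
pose mi := GRing.isZmodMorphism.Build _ _ i iB.
pose mm := GRing.isMonoidMorphism.Build _ _ i iM.
pose iR : {rmorphism {fraction R} -> F} :=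
  HB.pack i mi mm.
by exists iR.
Qed.

Section Evaluation.
Variables (k : closedFieldType) (C : curve k).
Implicit Types (P Q : point C) (x y f h : funfield C) (p q : {poly k}).

Definition ev x : {poly k} -> funfield C := horner_eval x \o map_poly (cst C).

HB.instance Definition _ x :=
  GRing.RMorphism.copy (ev x) (horner_eval x \o map_poly (cst C)).

Arguments ev : simpl never.

Lemma evC x c : ev x c%:P = cst C c.
Proof. by rewrite /ev /= map_polyC horner_evalE hornerC. Qed.

Lemma evX x : ev x 'X = x.
Proof. by rewrite /ev /= map_polyX horner_evalE hornerX. Qed.

Lemma evZ x c p : ev x (c *: p) = cst C c * ev x p.
Proof. by rewrite -mul_polyC rmorphM /= evC. Qed.

Lemma evXsubC x c : ev x ('X - c%:P) = x - cst C c.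
Proof. by rewrite rmorphB /= evC evX. Qed.

Definition transc x := forall p, ev x p = 0 -> p = 0.

Lemma transc_eq0 x p : transc x -> (ev x p == 0) = (p == 0).
Proof.
by move=> tx; apply/eqP/eqP => [/tx|->]; rewrite ?rmorph0.
Qed.

Lemma transc_inj x : transc x -> injective (ev x).
Proof.
move=> tx p q /eqP; rewrite -subr_eq0 -rmorphB transc_eq0 // subr_eq0.
exact: eqP.
Qed.

Lemma poly_split p : p != 0 ->
  exists s : seq k, p = lead_coef p *: \prod_(z <- s) ('X - z%:P).
Proof. by move=> _; have [s] := closed_field_poly_normal p; exists s. Qed.

(** Over an algebraically closed field p splits, and one of its linear factors must kill x. Hence
    transcendental means nonconstant. *)
Lemma algebraic_cst x p : p != 0 -> ev x p = 0 -> exists a, x = cst C a.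
Proof.
move=> p0; have [s ->] := poly_split p0; rewrite evZ rmorph_prod /= => /eqP.
rewrite mulf_eq0 fmorph_eq0 lead_coef_eq0 (negPf p0) /=.
elim: s => [|a s IHs]; first by rewrite big_nil oner_eq0.
rewrite big_cons mulf_eq0 => /orP[|/IHs//].
by rewrite evXsubC subr_eq0 => /eqP; exists a.
Qed.

Lemma not_cst_transc x : (forall a, x <> cst C a) -> transc x.
Proof.
move=> xa p xp; apply/eqP/negPn/negP => p0.
by have [a /xa] := algebraic_cst p0 xp.
Qed.

Lemma transc_not_cst x a : transc x -> x <> cst C a.
Proof.
move=> tx xa; have := tx ('X - a%:P); rewrite evXsubC xa subrr => /(_ erefl).
by move/eqP; rewrite polyXsubC_eq0.
Qed.

(** The subfield k(x), kept as a predicate on the function field: k(x), k(1/x) and k(x(1 - x)) are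
    compared inside one field, with no transport of elements. *)
Definition gen x f := exists p q, ev x q != 0 /\ f = ev x p / ev x q.

Lemma gen_ev x p : gen x (ev x p).
Proof. by exists p, 1; rewrite rmorph1 oner_eq0 divr1. Qed.

Lemma gen_cst x c : gen x (cst C c).
Proof. by rewrite -(evC x); apply: gen_ev. Qed.

Lemma gen_x x : gen x x.
Proof. by rewrite -{2}(evX x); apply: gen_ev. Qed.

Lemma gen0 x : gen x 0. Proof. by rewrite -(rmorph0 (ev x)); apply: gen_ev. Qed.

Lemma gen1 x : gen x 1. Proof. by rewrite -(rmorph1 (ev x)); apply: gen_ev. Qed.

Lemma genD x f h : gen x f -> gen x h -> gen x (f + h).
Proof.
move=> [p [q [q0 ->]]] [p' [q' [q'0 ->]]].
exists (p * q' + p' * q), (q * q').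
by rewrite rmorphD !rmorphM mulf_neq0 // addf_div.
Qed.

Lemma genN x f : gen x f -> gen x (- f).
Proof.
by move=> [p [q [q0 ->]]]; exists (- p), q; rewrite rmorphN mulNr.
Qed.

Lemma genB x f h : gen x f -> gen x h -> gen x (f - h).
Proof. by move=> gf gh; apply/genD/genN. Qed.

Lemma genM x f h : gen x f -> gen x h -> gen x (f * h).
Proof.
move=> [p [q [q0 ->]]] [p' [q' [q'0 ->]]].
by exists (p * p'), (q * q'); rewrite !rmorphM mulf_neq0 // mulf_div.
Qed.

Lemma genV x f : gen x f -> gen x f^-1.
Proof.
move=> [p [q [q0 ->]]]; have [p0|p0] := eqVneq (ev x p) 0.
  by rewrite p0 mul0r invr0; apply: gen0.
by exists q, p; rewrite p0 invf_div.
Qed.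

Lemma gen_div x f h : gen x f -> gen x h -> gen x (f / h).
Proof. by move=> gf gh; apply/genM/genV. Qed.

Lemma genX x f (n : nat) : gen x f -> gen x (f ^+ n).
Proof.
by move=> gf; elim: n => [|n IHn]; rewrite ?expr0 ?exprS; [apply: gen1|apply: genM].
Qed.

Lemma gen_sub_ev x y p : gen x y -> gen x (ev y p).
Proof.
move=> gy; elim/poly_ind: p => [|p c IHp]; first by rewrite rmorph0; apply: gen0.
rewrite rmorphD rmorphM /= evX evC.
by apply/genD/gen_cst; apply: genM.
Qed.

Lemma gen_sub x y f : gen x y -> gen y f -> gen x f.
Proof.
by move=> gy [p [q [_ ->]]]; apply: gen_div; apply: gen_sub_ev.
Qed.

Lemma vge_ev P x p : vge P 0 x -> vge P 0 (ev x p).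
Proof.
move=> x0; elim/poly_ind: p => [|p c IHp]; first by rewrite rmorph0 vge_0.
rewrite rmorphD rmorphM /= evX evC; apply/vgeD/vge_cst.
exact: vgeM0.
Qed.

Lemma ord_ev_pole P x p : ord P x < 0 -> p != 0 ->
  ev x p != 0 /\ ord P (ev x p) = ord P x * (size p).-1%:Z.
Proof.
move=> x0; elim/poly_ind: p => [|p c IHp]; first by rewrite eqxx.
have xn : x != 0 by apply: contraTneq x0 => ->; rewrite Defs.ord0.
have [->|p0] := eqVneq p 0.
  rewrite mul0r add0r => c0; rewrite evC fmorph_eq0 ord_cst size_polyC.
  by move: c0; rewrite polyC_eq0 => ->; rewrite mulr0.
move=> _; have [ep0 eo] := IHp p0.
have e0 : ev x (p * 'X) != 0 by rewrite rmorphM mulf_neq0 //= evX.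
have sp : (0 < size p)%N by rewrite size_poly_gt0.
have eo' : ord P (ev x (p * 'X)) = ord P x * (size p)%:Z.
  by rewrite rmorphM /= evX ordM // eo; case: (size p) sp => // n _ /=; lia.
have [|s1 s2] := dominant (n := 0) (h := cst C c) e0 _ (vge_cst P c).
  by rewrite eo'; nia.
by rewrite rmorphD /= evC s1 s2 eo' size_MXaddC (negPf p0).
Qed.

Lemma vge_value P x a p : vge P 1 (x - cst C a) ->
  vge P 1 (ev x p - cst C p.[a]).
Proof.
move=> xa; have : root (p - p.[a]%:P) a by rewrite /root !hornerE subrr.
move=> /factor_theorem[q qE]; have -> : ev x p - cst C p.[a] = ev x q * (x - cst C a).
  by rewrite -(evC x) -rmorphB qE rmorphM /= evXsubC.
apply: vgeMl => //; apply: vge_ev; rewrite -(subrK (cst C a) x).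
by apply/vgeD/vge_cst; apply: vge_le xa.
Qed.

Lemma unit_of_value P f c : c != 0 -> vge P 1 (f - cst C c) ->
  f != 0 /\ ord P f = 0.
Proof.
move=> c0 fc; have cc0 : cst C c != 0 by rewrite fmorph_eq0.
have := dominant cc0 _ fc; rewrite ord_cst addrC subrK. 
by apply.
Qed.

Lemma ord_ev_unit P x a p : vge P 1 (x - cst C a) -> p.[a] != 0 ->
  ev x p != 0 /\ ord P (ev x p) = 0.
Proof. by move=> xa pa; apply: unit_of_value (vge_value p xa). Qed.

Lemma vge1_unique P f a b : vge P 1 (f - cst C a) -> vge P 1 (f - cst C b) -> a = b.
Proof.
move=> fa fb; apply/eqP; rewrite -subr_eq0; apply/negPn/negP => ab.
have : vge P 1 (cst C (a - b)).
  rewrite rmorphB (_ : _ - _ = (f - cst C b) - (f - cst C a)); first exact: vgeB.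
  by rewrite /=; ring.
by rewrite vgeE ?fmorph_eq0 // ord_cst.
Qed.

End Evaluation.

Arguments transc {k C} x.
Arguments gen {k C} x f.

Lemma ev_morph (k : closedFieldType) (C D : curve k)
    (s : {rmorphism funfield C -> funfield D}) x p :
  (forall c, s (cst C c) = cst D c) -> s (ev x p) = ev (s x) p.
Proof.
move=> sc; elim/poly_ind: p => [|p c IHp]; first by rewrite !rmorph0.
by rewrite !(rmorphD, rmorphM) /= !evX !evC IHp sc.
Qed.

Lemma gen_morph (k : closedFieldType) (C D : curve k)
    (s : {rmorphism funfield C -> funfield D}) x f :
  (forall c, s (cst C c) = cst D c) -> gen x f -> gen (s x) (s f).
Proof.
move=> sc [p [q [q0 ->]]]; exists p, q.
by rewrite -!(ev_morph _ _ sc) fmorph_eq0 fmorph_div.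
Qed.

(** * Extending a point along an involution *)

Definition kinvolution (k : closedFieldType) (C : curve k)
    (s : {rmorphism funfield C -> funfield C}) : Prop :=
  (forall f, s (s f) = f) /\ (forall c, s (cst C c) = cst C c).

(** The residue field at P is k. This is not part of the notion of point; [residues] obtains it for
    all points of a double cover of the line. *)
Definition has_residues (k : closedFieldType) (C : curve k) (P : point C) :=
  forall f, vge P 0 f -> exists a, vge P 1 (f - cst C a).

Section UnitsAtPoint.
Variables (k : closedFieldType) (C : curve k) (P : point C).
Implicit Types f h t u : funfield C.

Lemma unit_ord f : vge P 0 f -> ~~ vge P 1 f -> f != 0 /\ ord P f = 0.
Proof. by rewrite /vge !negb_or => + /andP[f0]; rewrite f0 (negPf f0) /=; lia. Qed.

Lemma nvge1 f : f != 0 -> ord P f = 0 -> ~~ vge P 1 f.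
Proof. by move=> f0 fo; rewrite vgeE // fo. Qed.

Lemma nvge1M f h : vge P 0 f -> vge P 0 h ->
  ~~ vge P 1 f -> ~~ vge P 1 h -> ~~ vge P 1 (f * h).
Proof.
move=> f0 h0 /(unit_ord f0)[fn fo] /(unit_ord h0)[hn ho].
by apply: nvge1; rewrite ?mulf_neq0 // ordM // fo ho.
Qed.

Lemma nvge1D f h : ~~ vge P 1 f -> vge P 1 h -> ~~ vge P 1 (f + h).
Proof.
by move=> f1 h1; apply: contra f1 => fh; rewrite -(addrK h f); apply: vgeB.
Qed.

Lemma uniformizer_decomp t f : ord P t = 1 -> f != 0 ->
  exists n u, [/\ u != 0, ord P u = 0 & f = t ^ n * u].
Proof.
move=> tP f0; have t0 : t != 0 by apply: contra_eq_neq tP => ->; rewrite Defs.ord0.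
exists (ord P f), (f / t ^ ord P f); split.
- by rewrite mulf_neq0 ?invr_eq0 ?expfz_neq0.
- by rewrite ord_div ?expfz_neq0 // ord_Xz // tP; lia.
- by rewrite mulrC divfK // expfz_neq0.
Qed.

Lemma primitive_pair t f h : ord P t = 1 -> (f != 0) || (h != 0) ->
  exists n f' h', [/\ f = t ^ n * f', h = t ^ n * h', vge P 0 f', vge P 0 h'
    & ~~ vge P 1 f' \/ ~~ vge P 1 h'].
Proof.
move=> tP; have t0 : t != 0 by apply: contra_eq_neq tP => ->; rewrite Defs.ord0.
have aux f1 h1 : f1 != 0 -> vge P (ord P f1) h1 ->
  exists n f' h', [/\ f1 = t ^ n * f', h1 = t ^ n * h', vge P 0 f', vge P 0 h'
    & ~~ vge P 1 f'].
  move=> f0 h0; have [n [u [u0 uo fE]]] := uniformizer_decomp tP f0.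
  have fn : ord P f1 = n by rewrite fE ordM ?expfz_neq0 // ord_Xz // uo tP; lia.
  exists n, u, (t ^ (- n) * h1); split=> //.
  - by rewrite mulrA -expfzDr // subrr mul1r.
  - by rewrite vgeE // uo.
  - have -> : 0 = - n + n by lia.
    by apply: vgeM; rewrite -?fn // vgeE ?expfz_neq0 // ord_Xz // tP; lia.
  - exact: nvge1.
have [-> /= h0|f0 _] := eqVneq f 0.
  have [|n [h' [f' [? ? ? ? ?]]]] := aux h 0 h0; first exact: vge_0.
  by exists n, f', h'; split=> //; right.
have [hf|] := boolP (vge P (ord P f) h).
  by have [n [f' [h' [? ? ? ? ?]]]] := aux f h f0 hf; exists n, f', h'; split=> //; left.
rewrite /vge negb_or => /andP[h0 lt].
have [|n [h' [f' [? ? ? ? ?]]]] := aux h f h0; first by apply: vge_ord; lia.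
by exists n, f', h'; split=> //; right.
Qed.

End UnitsAtPoint.

Section Extension.
Variables (k : closedFieldType) (C B : curve k).
Variables (iota : {rmorphism funfield B -> funfield C}).
Variables (s : {rmorphism funfield C -> funfield C}).
Hypothesis iota_cst : forall c, iota (cst B c) = cst C c.
Hypothesis sI : kinvolution s.
Hypothesis fixE : forall f, s f = f <-> exists h, f = iota h.

Variable R : point B.

Section LocalBasis.
Variables (t : funfield B) (y : funfield C) (T N : funfield B).
Hypothesis tR : ord R t = 1.
Hypothesis sy : s y != y.
Hypothesis yT : y + s y = iota T.
Hypothesis yN : y * s y = iota N.
Hypothesis T0 : vge R 0 T.
Hypothesis N1 : vge R 1 N.
Hypothesis dich : ~~ vge R 1 T \/ (vge R 1 T /\ ord R N = 1).

Let s_iota h : s (iota h) = iota h.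
Proof. by apply/fixE; exists h. Qed.

Let el (a b : funfield B) := iota a + iota b * y.

Let yy : y * y = iota T * y - iota N.
Proof. by rewrite -yT -yN; ring. Qed.

Let elD a b c d : el a b + el c d = el (a + c) (b + d).
Proof. by rewrite /el !rmorphD; ring. Qed.

Let elM a b c d :
  el a b * el c d = el (a * c - b * d * N) (a * d + b * c + b * d * T).
Proof.
rewrite /el !(rmorphD, rmorphB, rmorphM, rmorphN) /=.
have -> : (iota a + iota b * y) * (iota c + iota d * y) =
  iota a * iota c + (iota a * iota d + iota b * iota c) * y +
  iota b * iota d * (y * y) by ring.
by rewrite yy; ring.
Qed.

Let el0 a : el a 0 = iota a.
Proof. by rewrite /el rmorph0 mul0r addr0. Qed.

Let el_y : el 0 1 = y.
Proof. by rewrite /el rmorph0 rmorph1 mul1r add0r. Qed.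

Let s_el a b : s (el a b) = el (a + b * T) (- b).
Proof.
rewrite /el !(rmorphD, rmorphM, rmorphN) /= !s_iota -yT.
by ring.
Qed.

Let el_ex f : exists a b, f = el a b.
Proof.
have d0 : y - s y != 0 by rewrite subr_eq0 eq_sym.
have [b bE] : exists b, (f - s f) / (y - s y) = iota b.
  apply/fixE; rewrite fmorph_div !rmorphB /= !(proj1 sI).
  by rewrite -(opprB f) -(opprB y) invrN mulrNN.
have [a aE] : exists a, f - iota b * y = iota a.
  apply/fixE; rewrite rmorphB rmorphM /= s_iota; apply/eqP; rewrite -subr_eq0.
  have -> : s f - iota b * s y - (f - iota b * y) =
    iota b * (y - s y) - (f - s f) by ring.
  by rewrite -bE divfK // subrr.
by exists a, b; rewrite /el -aE subrK.
Qed.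

Let el_inj a b c d : el a b = el c d -> a = c /\ b = d.
Proof.
move=> e; have e' := congr1 s e; rewrite !s_el in e'.
have inj : injective iota by apply: fmorph_inj.
have bd : b = d.
  have d0 : y - s y != 0 by rewrite subr_eq0 eq_sym.
  apply/inj/(mulIf d0)/eqP; rewrite -subr_eq0.
  have -> : iota b * (y - s y) - iota d * (y - s y) =
    el a b - el (a + b * T) (- b) - (el c d - el (c + d * T) (- d)).
    by rewrite /el !(rmorphD, rmorphM, rmorphN) /= -yT; ring.
  by rewrite e e' subrr.
by split=> //; move: e; rewrite /el bd => /addIr/inj.
Qed.

Let el_neq0 a b : ~~ vge R 1 a -> el a b != 0.
Proof.
move=> a1; apply/eqP => e0.
have : el a b = el 0 0 by rewrite el0 rmorph0.
by move=> /el_inj[a0 _]; rewrite a0 vge_0 in a1.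
Qed.

(* The local ring at the point of the fibre where y vanishes. *)
Let O f := exists a b c d, [/\ vge R 0 a /\ vge R 0 b, vge R 0 c /\ vge R 0 d,
  ~~ vge R 1 c & f * el c d = el a b].

Let O_el a b : vge R 0 a -> vge R 0 b -> O (el a b).
Proof.
move=> a0 b0; exists a, b, 1, 0; split=> //.
- by split; [apply: vge_1|apply: vge_0].
- by apply: nvge1; rewrite ?oner_eq0 ?ord_1.
- by rewrite el0 rmorph1 mulr1.
Qed.

Let vgeN1 : vge R 0 N. Proof. by apply: vge_le N1. Qed.

(** Denominators are the elements whose constant part is a unit at R. They are closed under products
    because N vanishes at R. *)
Let den c d c' d' : vge R 0 c -> vge R 0 d -> vge R 0 c' -> vge R 0 d' ->
  ~~ vge R 1 c -> ~~ vge R 1 c' -> ~~ vge R 1 (c * c' - d * d' * N).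
Proof.
move=> *; apply: nvge1D; first exact: nvge1M.
by rewrite vgeN; apply: vgeMl => //; apply: vgeM0.
Qed.

Let OD f h : O f -> O h -> O (f + h).
Proof.
move=> [a [b [c [d [[a0 b0] [c0 d0] c1 e]]]]].
move=> [a' [b' [c' [d' [[a'0 b'0] [c'0 d'0] c'1 e']]]]].
have fhE : (f + h) * (el c d * el c' d') =
  (f * el c d) * el c' d' + (h * el c' d') * el c d by ring.
rewrite e e' !elM elD in fhE; do 4 eexists; split; last exact: fhE; last exact: den.
- by split; repeat (apply: vgeB || apply: vgeD || apply: vgeM0).
- by split; repeat (apply: vgeB || apply: vgeD || apply: vgeM0).
Qed.

Let OM f h : O f -> O h -> O (f * h).
Proof.
move=> [a [b [c [d [[a0 b0] [c0 d0] c1 e]]]]].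
move=> [a' [b' [c' [d' [[a'0 b'0] [c'0 d'0] c'1 e']]]]].
have fhE : (f * h) * (el c d * el c' d') = (f * el c d) * (h * el c' d') by ring.
rewrite e e' !elM in fhE; do 4 eexists; split; last exact: fhE; last exact: den.
- by split; repeat (apply: vgeB || apply: vgeD || apply: vgeM0).
- by split; repeat (apply: vgeB || apply: vgeD || apply: vgeM0).
Qed.

Let U g := [/\ g != 0, O g & O g^-1].

Let UM g h : U g -> U h -> U (g * h).
Proof.
by move=> [g0 Og Og'] [h0 Oh Oh']; split; rewrite ?mulf_neq0 ?invfM //; apply: OM.
Qed.

Let UV g : U g -> U g^-1.
Proof. by move=> [g0 Og Og']; split; rewrite ?invr_eq0 ?invrK. Qed.

Let U1 : U 1.
Proof.
have O1 : O 1 by rewrite -(rmorph1 iota) -el0; apply: O_el; [apply: vge_1|apply: vge_0].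
by split; rewrite ?invr1 ?oner_eq0.
Qed.

Let UX g (n : int) : U g -> U (g ^ n).
Proof.
move=> Ug; have Un (m : nat) : U (g ^+ m).
  by elim: m => [|m IHm]; rewrite ?expr0 // exprS; apply: UM.
by case: n => m; rewrite ?NegzE -?exprnP -?exprnN //; apply: UV.
Qed.

Let U_el a b : vge R 0 a -> vge R 0 b -> ~~ vge R 1 a -> U (el a b).
Proof.
move=> a0 b0 a1; have n0 := el_neq0 b a1; split=> //; first exact: O_el.
exists 1, 0, a, b; split=> //.
  by split; [apply: vge_1|apply: vge_0].
by rewrite mulVf // el0 rmorph1.
Qed.

Let U_iota u : u != 0 -> ord R u = 0 -> U (iota u).
Proof.
move=> u0 uo; rewrite -el0; apply: U_el; rewrite ?vge_0 //.
  by rewrite vgeE // uo.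
exact: nvge1.
Qed.

Let tn0 : t != 0. Proof. by apply: contra_eq_neq tR => ->; rewrite Defs.ord0. Qed.

Let Ot : O (iota t).
Proof. by rewrite -el0; apply: O_el; rewrite ?vge_0 ?vgeE // tR. Qed.

Let nOt : ~ O (iota t)^-1.
Proof.
move=> [a [b [c [d [[a0 b0] [c0 d0] c1 e]]]]].
have : el c d = el (t * a) (t * b).
  have it0 : iota t != 0 by rewrite fmorph_eq0.
  rewrite -[LHS](mulKf (x := (iota t)^-1)) ?invr_eq0 // e invrK /el !rmorphM /=.
  by ring.
move=> /el_inj[cE _]; move: c1; rewrite cE mulrC.
by rewrite -[1]add0r vgeM // vgeE // tR.
Qed.

Let el_norm a b : el a b != 0 -> exists n u,
  U u /\ el a b * s (el a b) = iota t ^ n * u.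
Proof.
move=> e0; have [h hE] : exists h, el a b * s (el a b) = iota h.
  by apply/fixE; rewrite rmorphM /= (proj1 sI) mulrC.
have h0 : h != 0 by rewrite -(fmorph_eq0 iota) -hE mulf_neq0 // fmorph_eq0.
have [n [u [u0 uo hE']]] := uniformizer_decomp tR h0.
by exists n, (iota u); rewrite hE hE' rmorphM fmorphXz; split=> //; apply: U_iota.
Qed.

Let el_prim f : f != 0 -> exists n a b, [/\ f = iota t ^ n * el a b,
  vge R 0 a, vge R 0 b & ~~ vge R 1 a \/ vge R 1 a /\ ~~ vge R 1 b].
Proof.
move=> f0; have [a [b fE]] := el_ex f.
have ab : (a != 0) || (b != 0).
  apply: contraNT f0; rewrite negb_or !negbK => /andP[/eqP a0 /eqP b0].
  by rewrite fE a0 b0 el0 rmorph0.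
have [n [a' [b' [aE bE a0 b0 or]]]] := primitive_pair tR ab.
exists n, a', b'; split=> //; last first.
  by case: or => [|b1]; [left|case: (boolP (vge R 1 a')) => ?; [right|left]].
by rewrite fE /el aE bE !rmorphM fmorphXz; ring.
Qed.

(** The only difficult case is a + b y with a vanishing and b a unit. Its conjugate has constant
    part a + b T, a unit, so a + b y is its norm, a power of t times a unit, divided by a unit. *)
Let split_case : ~~ vge R 1 T -> forall f, f != 0 ->
  exists (n : int) u, [/\ u != 0, O u, O u^-1 & f = iota t ^ n * u].
Proof.
move=> T1 f f0; suff [n [u [[u0 Ou Ou'] fE]]] : exists n u, U u /\ f = iota t ^ n * u.
  by exists n, u.
have [n [a [b [fE a0 b0 [a1|[a1 b1]]]]]] := el_prim f0.
  by exists n, (el a b); split=> //; apply: U_el.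
have e0 : el a b != 0 by apply: contraNneq f0 => e0; rewrite fE e0 mulr0.
have Us : U (s (el a b)).
  rewrite s_el; apply: U_el; first by apply/vgeD/vgeM0.
    by rewrite vgeN.
  by rewrite addrC; apply: nvge1D => //; apply: nvge1M.
have [m [u [Uu nE]]] := el_norm e0.
exists (n + m), (u / s (el a b)); split; first by apply/UM/UV.
have s0 : s (el a b) != 0 by rewrite fmorph_eq0.
rewrite fE -[el a b in LHS](mulfK s0) nE expfzDr ?fmorph_eq0 //.
by ring.
Qed.

(** From y (T - y) = N follows a = (a / N) y (T - y), so y divides a + b y; the cofactor has
    constant part b + (a / N) T, still a unit. *)
Let ram_unit a b : vge R 1 T -> ord R N = 1 -> vge R 1 a -> vge R 0 b ->
  ~~ vge R 1 b -> exists2 u, U u & el a b = y * u.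
Proof.
move=> T1 No a1 b0 b1.
have N0 : N != 0 by apply: contra_eq_neq No => ->; rewrite Defs.ord0.
have aN : vge R 0 (a / N).
  have Nv : vge R (- 1) N^-1 by rewrite vgeE ?invr_eq0 // ord_V No.
  by have := vgeM a1 Nv; rewrite subrr.
have aTN : vge R 1 (a / N * T) by apply: vgeMl.
exists (el (b + a / N * T) (- (a / N))).
  apply: U_el; rewrite ?vgeN //; last exact: nvge1D.
  by apply: vgeD => //; apply: vgeM0.
rewrite -[in RHS]el_y elM; congr el; first by field.
by field.
Qed.

Let ram_case : vge R 1 T -> ord R N = 1 -> forall f, f != 0 ->
  exists (n : int) u, [/\ u != 0, O u, O u^-1 & f = y ^ n * u].
Proof.
move=> T1 No f f0; suff [n [u [[u0 Ou Ou'] fE]]] : exists n u, U u /\ f = y ^ n * u.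
  by exists n, u.
have N0 : N != 0 by apply: contra_eq_neq No => ->; rewrite Defs.ord0.
have y0 : y != 0.
  by apply: contra_neq N0 => y0; apply/eqP; rewrite -(fmorph_eq0 iota) -yN y0 mul0r.
(* N = y (T - y), where T - y is y times a unit, and N is t times a unit: hence t is y^2 times a
   unit. *)
have [v Uv tE] : exists2 v, U v & iota t = y ^ (2 : int) * v.
  have [u Uu sE] : exists2 u, U u & el T (- 1) = y * u.
    apply: ram_unit => //; rewrite vgeN ?vge_1 //.
    by apply: nvge1; rewrite ?oner_eq0 ?ord_1.
  have [n [w [w0 wo NE]]] := uniformizer_decomp tR N0.
  have n1 : n = 1.
    by move: No; rewrite NE ordM ?expfz_neq0 // ord_Xz // tR wo; clear; lia.
  exists (u / iota w); first by apply/UM/UV/U_iota.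
  have sE' : s y = y * u.
    by rewrite -sE -[in LHS]el_y s_el add0r mul1r.
  have iw0 : iota w != 0 by rewrite fmorph_eq0.
  apply: (mulIf iw0); rewrite -rmorphM.
  have <- : N = t * w by rewrite NE n1 expr1z.
  rewrite -yN sE' -exprnP expr2; field.
  exact: iw0.
have [n [a [b [fE a0 b0 or]]]] := el_prim f0.
have fE' : f = y ^ (2 * n) * (v ^ n * el a b).
  case: (Uv) => v0 _ _; rewrite fE tE exprzMl ?unitfE ?expfz_neq0 //.
  by rewrite exprz_exp mulrA.
case: or => [a1|[a1 b1]].
  by exists (2 * n), (v ^ n * el a b); split=> //; apply: UM; [apply: UX|apply: U_el].
have [u Uu eE] := ram_unit T1 No a1 b0 b1.
exists (2 * n + 1), (v ^ n * u); split; first by apply: UM => //; apply: UX.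
by rewrite fE' eE expfzDr // expr1z; ring.
Qed.

Lemma extend_local : exists (P : point C) (e : int),
  0 < e /\ forall h, ord P (iota h) = e * ord R h.
Proof.
have Oc c : O (cst C c).
  by rewrite -iota_cst -el0; apply: O_el; [apply: vge_cst|apply: vge_0].
have [P PE] : exists P : point C, forall f, O f <-> vge P 0 f.
  case: dich => [T1|[T1 No]].
    by have [P [PO _]] := point_of_ring Oc OD OM Ot nOt (split_case T1); exists P.
  have Oy : O y by rewrite -el_y; apply: O_el; [apply: vge_0|apply: vge_1].
  have nOy : ~ O y^-1.
    move=> [a [b [c [d [[a0 b0] [c0 d0] c1 e]]]]].
    have N0 : N != 0 by apply: contra_eq_neq No => ->; rewrite Defs.ord0.
    have y0 : y != 0.
      by apply: contra_neq N0 => y0; apply/eqP; rewrite -(fmorph_eq0 iota) -yN y0 mul0r.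
    have : el c d = el a b * el 0 1 by rewrite -e el_y mulrC mulrA mulfV // mul1r.
    rewrite elM => /el_inj[cE _]; move: c1; rewrite cE mulr0 add0r vgeN mulr1.
    by rewrite vgeMl.
  by have [P [PO _]] := point_of_ring Oc OD OM Oy nOy (ram_case T1 No); exists P.
have it0 : iota t != 0 by rewrite fmorph_eq0.
exists P, (ord P (iota t)); split.
  rewrite ltNge; apply/negP => le; apply: nOt; apply/PE.
  by apply: vge_ord; rewrite ord_V; move: le; clear; lia.
move=> h; have [->|h0] := eqVneq h 0; first by rewrite rmorph0 !Defs.ord0 mulr0.
have [n [u [u0 uo hE]]] := uniformizer_decomp tR h0.
have iu0 : iota u != 0 by rewrite fmorph_eq0.
have : ord P (iota u) = 0.
  have [_ /PE + /PE] := U_iota u0 uo; rewrite !vgeE ?invr_eq0 // ord_V; clear; lia.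
move=> iuo; rewrite hE rmorphM fmorphXz !ordM ?expfz_neq0 //.
by rewrite !ord_Xz // tR uo iuo mul1r !addr0.
Qed.

End LocalBasis.

Hypothesis snt : exists y, s y != y.
Hypothesis resR : has_residues R.

(* Take y integral with discriminant of least valuation, translated so that its
   norm vanishes at R: then either its trace is a unit (R splits, and t is a
   uniformizer) or its norm is a uniformizer (R ramifies, and y is one), since
   otherwise y / t would be integral of smaller discriminant. *)
Lemma extend_point : exists (P : point C) (e : int),
  0 < e /\ forall h, ord P (iota h) = e * ord R h.
Proof.
have [t tR] := ord_onto R.
have t0 : t != 0 by apply: contra_eq_neq tR => ->; rewrite Defs.ord0.
have tr_ex f : exists T, f + s f = iota T.
  by apply/fixE; rewrite rmorphD /= (proj1 sI) addrC.
have nm_ex f : exists N, f * s f = iota N.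
  by apply/fixE; rewrite rmorphM /= (proj1 sI) mulrC.
have s_iota h : s (iota h) = iota h by apply/fixE; exists h.
pose good (n : nat) := `[< exists y T N, [/\ s y != y, y + s y = iota T,
  y * s y = iota N, vge R 0 T /\ vge R 0 N & ord R (T ^+ 2 - 4 * N) = n%:Z] >].
(* Being the square of y - s y, the discriminant is nonzero in characteristic 2 as well. *)
have discE y T N : y + s y = iota T -> y * s y = iota N ->
    iota (T ^+ 2 - 4 * N) = (y - s y) ^+ 2.
  by move=> e e'; rewrite rmorphB rmorphXn rmorphM /= -e -e' rmorph_nat; ring.
have disc0 y T N : s y != y -> y + s y = iota T -> y * s y = iota N ->
    T ^+ 2 - 4 * N != 0.
  move=> ny e e'; rewrite -(fmorph_eq0 iota) (discE y) // expf_neq0 //.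
  by rewrite subr_eq0 eq_sym.
have disc_ge T N : vge R 0 T -> vge R 0 N -> vge R 0 (T ^+ 2 - 4 * N).
  move=> ? ?; apply: vgeB; first exact: vgeX.
  by apply: vgeM0 => //; rewrite -(rmorph_nat (cst B)) vge_cst.
have exg : exists n, good n.
  have [y ny] := snt; have [T TE] := tr_ex y; have [N NE] := nm_ex y.
  have ge f : exists m : nat, forall m' : nat, (m <= m')%N -> vge R 0 (t ^+ m' * f).
    exists `|ord R f|%N => m' le; have [->|f0] := eqVneq f 0.
      by rewrite mulr0 vge_0.
    by rewrite vgeE ?mulf_neq0 ?expf_neq0 // ordM ?expf_neq0 // ord_X tR; lia.
  have [m1 h1] := ge T; have [m2 h2] := ge N; pose m := maxn m1 m2.
  have Tm : vge R 0 (t ^+ m * T) by apply: h1; lia.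
  have Nm : vge R 0 (t ^+ (m + m) * N) by apply: h2; lia.
  have ty : s (iota (t ^+ m) * y) != iota (t ^+ m) * y.
    rewrite rmorphM /= s_iota; apply: contraNneq ny => /(mulfI _)-> //.
    by rewrite fmorph_eq0 expf_neq0.
  have Te : iota (t ^+ m) * y + s (iota (t ^+ m) * y) = iota (t ^+ m * T).
    by rewrite !rmorphM /= s_iota -TE; ring.
  have Ne : iota (t ^+ m) * y * s (iota (t ^+ m) * y) = iota (t ^+ (m + m) * N).
    by rewrite !rmorphM /= s_iota -NE exprD rmorphM /=; ring.
  have := disc_ge _ _ Tm Nm; rewrite vgeE ?(disc0 _ _ _ ty Te Ne) // => d0.
  exists `|ord R ((t ^+ m * T) ^+ 2 - 4 * (t ^+ (m + m) * N))|%N; apply/asboolP.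
  by exists (iota (t ^+ m) * y), (t ^+ m * T), (t ^+ (m + m) * N); split=> //; lia.
case: (ex_minnP exg) => n /asboolP[y [T [N [ny TE NE [T0 N0] dn]]]] minn.
have [Tb Tb1] := resR T0; have [Nb Nb1] := resR N0.
(* [al] is a root of the reduction X^2 - Tb X + Nb, so the norm of y - al vanishes at R. *)
have [al alE] := @solve_monicpoly k 2 (fun i => if i == 0 then - Nb else Tb) isT.
rewrite !big_ord_recl big_ord0 /= addr0 expr0 mulr1 expr1 in alE.
pose y' := y - cst C al; pose T' := T - 2 * cst B al.
pose N' := N - cst B al * T + cst B al ^+ 2.
have ny' : s y' != y' by rewrite rmorphB /= (proj2 sI) (inj_eq (addIr _)).
have T'E : y' + s y' = iota T'.
  rewrite /y' /T' !rmorphB rmorphM rmorph_nat iota_cst /= (proj2 sI) -TE.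
  by ring.
have N'E : y' * s y' = iota N'.
  rewrite /y' /N' !(rmorphD, rmorphB, rmorphM, rmorphXn, rmorphN) /=.
  rewrite iota_cst (proj2 sI) -TE -NE.
  by ring.
have dE : T' ^+ 2 - 4 * N' = T ^+ 2 - 4 * N by rewrite /T' /N'; ring.
have T'0 : vge R 0 T'.
  apply: vgeB => //; apply: vgeM0; last exact: vge_cst.
  by rewrite -(rmorph_nat (cst B)) vge_cst.
have N'1 : vge R 1 N'.
  have -> : N' = (N - cst B Nb) - cst B al * (T - cst B Tb) +
      cst B (al ^+ 2 - (- Nb + Tb * al)).
    by rewrite /N' !(rmorphD, rmorphB, rmorphM, rmorphXn, rmorphN) /=; ring.
  rewrite alE subrr rmorph0 addr0; apply: vgeB => //.
  by apply: vgeMl => //; apply: vge_cst.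
apply: (extend_local tR ny' T'E N'E T'0 N'1).
have [T1|T1] := boolP (vge R 1 T'); [right; split=> //|by left].
have N'n0 : N' != 0.
  rewrite -(fmorph_eq0 iota) -N'E mulf_neq0 ?fmorph_eq0 //.
    by apply: contraNneq ny' => ->; rewrite rmorph0.
  by apply: contraNneq ny' => ->; rewrite rmorph0.
move: (N'1); rewrite vgeE // => N'1'.
have [//|ge2] : ord R N' = 1 \/ 2 <= ord R N' by move: N'1'; clear; lia.
pose y2 := y' / iota t.
have it0 : iota t != 0 by rewrite fmorph_eq0.
have ny2 : s y2 != y2.
  by rewrite fmorph_div /= s_iota (inj_eq (mulIf _)) ?invr_eq0.
have T2E : y2 + s y2 = iota (T' / t).
  by rewrite /y2 !fmorph_div /= s_iota -T'E; field.
have N2E : y2 * s y2 = iota (N' / t ^+ 2).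
  by rewrite /y2 !fmorph_div /= s_iota -N'E rmorphXn /=; field.
have T20 : vge R 0 (T' / t).
  have [->|Tn] := eqVneq T' 0; first by rewrite mul0r vge_0.
  by move: T1; rewrite !vgeE ?mulf_neq0 ?invr_eq0 // ord_div // tR; clear; lia.
have N20 : vge R 0 (N' / t ^+ 2).
  rewrite vgeE ?mulf_neq0 ?invr_eq0 ?expf_neq0 // ord_div ?expf_neq0 //.
  by rewrite ord_X tR; move: ge2; clear; lia.
have d2E : (T' / t) ^+ 2 - 4 * (N' / t ^+ 2) = (T ^+ 2 - 4 * N) / t ^+ 2.
  by rewrite -dE; field.
have d2n : ord R ((T' / t) ^+ 2 - 4 * (N' / t ^+ 2)) = n%:Z - 2.
  by rewrite d2E ord_div ?expf_neq0 // ?(disc0 _ _ _ ny TE NE) // dn ord_X tR; clear; lia.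
have := disc_ge _ _ T20 N20; rewrite vgeE ?(disc0 _ _ _ ny2 T2E N2E) // d2n => ge0.
suff /minn : good `|n%:Z - 2|%N by move: ge0; clear; lia.
apply/asboolP; exists y2, (T' / t), (N' / t ^+ 2); split=> //.
by rewrite d2n; move: ge0; clear; lia.
Qed.

End Extension.

(** * Fibres and ramification *)

Section Conjugation.
Variables (k : closedFieldType) (C : curve k).
Variable s : {rmorphism funfield C -> funfield C}.
Hypothesis sI : kinvolution s.
Implicit Types (P Q : point C) (f h : funfield C).

Lemma conj_pt_ex P : exists Q, forall f, ord Q f = ord P (s f).
Proof.
have o0 : ord P (s 0) = 0 by rewrite rmorph0 Defs.ord0.
have oM f h : f != 0 -> h != 0 -> ord P (s (f * h)) = ord P (s f) + ord P (s h).
  by move=> f0 h0; rewrite rmorphM ordM ?fmorph_eq0.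
have oD f h : f != 0 -> h != 0 -> f + h != 0 ->
    Num.min (ord P (s f)) (ord P (s h)) <= ord P (s (f + h)).
  by move=> f0 h0 fh0; rewrite rmorphD ordD -?rmorphD ?fmorph_eq0.
have oc c : ord P (s (cst C c)) = 0 by rewrite (proj2 sI) ord_cst.
have ot : exists t, ord P (s t) = 1.
  by have [t tP] := ord_onto P; exists (s t); rewrite (proj1 sI).
by exists (Point o0 oM oD oc ot).
Qed.

Definition conj_pt P : point C := projT1 (cid (conj_pt_ex P)).

Lemma ord_conj P f : ord (conj_pt P) f = ord P (s f).
Proof. by rewrite /conj_pt; case: (cid _). Qed.

Lemma vge_conj P n f : vge (conj_pt P) n f = vge P n (s f).
Proof. by rewrite /vge ord_conj fmorph_eq0. Qed.

Lemma conj_ptK P : conj_pt (conj_pt P) = P.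
Proof. by apply: point_eq => f; rewrite !ord_conj (proj1 sI). Qed.

Lemma ord_conj_fix P f : s f = f -> ord (conj_pt P) f = ord P f.
Proof. by move=> sf; rewrite ord_conj sf. Qed.

(** For a uniformizer t either the trace has nonzero order, or it is regular and the norm (t + s t)
    t - t^2 vanishes at P. *)
Lemma fixed_nontrivial P : exists f, s f = f /\ ord P f != 0.
Proof.
have [t tP] := ord_onto P.
have t0 : t != 0 by apply: contra_eq_neq tP => ->; rewrite Defs.ord0.
have [T0|T0] := eqVneq (ord P (t + s t)) 0; last first.
  by exists (t + s t); rewrite rmorphD /= (proj1 sI) addrC.
exists (t * s t); rewrite rmorphM /= (proj1 sI) mulrC; split=> //.
have : vge P 1 (t * s t).
  have -> : t * s t = (t + s t) * t - t * t by ring.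
  have t1 : vge P 1 t by rewrite vgeE // tP.
  apply: vgeB; apply: vgeMl => //; last exact: vge_le t1.
  by apply: vge_ord; rewrite T0.
by rewrite vgeE ?mulf_neq0 ?fmorph_eq0 // mulrC; clear; lia.
Qed.

(** Otherwise some h has a pole at P and is regular at Q and at its conjugate. Its trace and norm
    are then regular at Q, hence at P by hypothesis, and h would be integral over the ring at P. *)
Lemma fibre P Q : (forall f, s f = f -> vge Q 0 f -> vge P 0 f) ->
  P = Q \/ P = conj_pt Q.
Proof.
move=> sub; apply: contrapT => /not_orP[PQ PQ'].
have [f1 [f10 f1P f1Q]] := separate PQ.
have [f2 [f20 f2P f2Q']] := separate PQ'.
suff [h [h0 hP hQ hQ']] : exists h, [/\ h != 0, ord P h < 0, vge Q 0 h &
    vge (conj_pt Q) 0 h].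
  have : vge P 0 h.
    apply: (@integral _ _ _ _ (h + s h) (h * s h)); last by ring.
    - apply: sub; first by rewrite rmorphD /= (proj1 sI) addrC.
      by apply: vgeD; rewrite -?vge_conj.
    - apply: sub; first by rewrite rmorphM /= (proj1 sI) mulrC.
      by apply: vgeM0; rewrite -?vge_conj.
  by rewrite vgeE //; lia.
have [h1|h1] := boolP (vge (conj_pt Q) 0 f1).
  by exists f1; split=> //; apply: vge_ord; lia.
have [h2|h2] := boolP (vge Q 0 f2).
  by exists f2; split=> //; apply: vge_ord; lia.
rewrite vgeE // in h1; rewrite vgeE // in h2.
have f1v : f1^-1 != 0 by rewrite invr_eq0.
have f2v : f2^-1 != 0 by rewrite invr_eq0.
have [||g0 gQ] := @dominant _ _ Q 0 f1^-1 f2^-1 f1v.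
- by rewrite ord_V; lia.
- by apply: vge_ord; rewrite ord_V; lia.
have [||_ gQ'] := @dominant _ _ (conj_pt Q) 0 f2^-1 f1^-1 f2v.
- by rewrite ord_V; lia.
- by apply: vge_ord; rewrite ord_V; lia.
(* Both inverses vanish at P, so h has a pole there. At Q only f1^-1 has a pole, at the conjugate of
   Q only f2^-1, so h vanishes at both. *)
exists (f1^-1 + f2^-1)^-1; rewrite invr_eq0 g0; split=> //.
- have : vge P 1 (f1^-1 + f2^-1).
    by apply: vgeD; apply: vge_ord; rewrite ord_V; lia.
  by rewrite vgeE // ord_V; lia.
- by apply: vge_ord; rewrite ord_V gQ ord_V; lia.
- by apply: vge_ord; rewrite ord_V addrC gQ' ord_V; lia.
Qed.

Section Ramification.
Variables (P : point C) (t : funfield C).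
Hypothesis st : s t = t.
Hypothesis tP : 0 < ord P t.
Hypothesis dvd : forall f, s f = f -> f != 0 -> (ord P t %| ord P f)%Z.

(* A function vanishing simply at P and not at s P has norm of valuation 1. *)
Lemma unramified : conj_pt P <> P -> ord P t = 1.
Proof.
move=> ne; have [h [h0 hP' hP]] := separate ne.
have h1 : 1 + h != 0 /\ ord P (1 + h) = 0.
  have := @dominant _ _ P 1 1 h (oner_neq0 _); rewrite ord_1; apply=> //.
  by apply: vge_ord; lia.
have [_ h1'] : 1 + h != 0 /\ ord (conj_pt P) (1 + h) = ord (conj_pt P) h.
  by rewrite addrC; apply: (@dominant _ _ _ 0) => //; apply: vge_1.
case: h1 => h10 h1P.
have [t1 t1P] := ord_onto P.
have t10 : t1 != 0 by apply: contra_eq_neq t1P => ->; rewrite Defs.ord0.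
(* u + u' = 1, where u vanishes at P and is a unit at the conjugate, and u' the other way round. A
   large power of u' makes t1 vanish at the conjugate without changing its order at P; adding u^2
   then makes it a unit at the conjugate. *)
pose u' := (1 + h)^-1; pose u := h * u'.
have u'0 : u' != 0 by rewrite invr_eq0.
have u0 : u != 0 by rewrite mulf_neq0.
have u'P : ord P u' = 0 by rewrite ord_V h1P.
have u'P' : ord (conj_pt P) u' > 0 by rewrite ord_V h1'; lia.
have uP : ord P u > 0 by rewrite ordM // u'P; lia.
have uP' : ord (conj_pt P) u = 0 by rewrite ordM // ord_V h1'; lia.
pose i := `|ord (conj_pt P) t1|%N; pose w0 := t1 * u' ^+ i.+1.
have w00 : w0 != 0 by rewrite mulf_neq0 ?expf_neq0.
have w0P : ord P w0 = 1 by rewrite ordM ?expf_neq0 // ord_X u'P t1P; lia.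
have w0P' : ord (conj_pt P) w0 > 0.
  rewrite ordM ?expf_neq0 // ord_X.
  have : i.+1%:Z <= ord (conj_pt P) u' * i.+1%:Z by rewrite -[leLHS]mul1r ler_wpM2r //; lia.
  by rewrite /i; lia.
have u20 : u ^+ 2 != 0 by rewrite expf_neq0.
have [||wn wP] := @dominant _ _ P 2 w0 (u ^+ 2) w00.
- by rewrite w0P.
- by apply: vge_ord; rewrite ord_X; lia.
have [||_ wP'] := @dominant _ _ (conj_pt P) 1 (u ^+ 2) w0 u20.
- by rewrite ord_X uP'.
- by apply: vge_ord; lia.
pose w := w0 + u ^+ 2.
have sww : s (w * s w) = w * s w by rewrite rmorphM /= (proj1 sI) mulrC.
have := dvd sww; rewrite mulf_neq0 ?fmorph_eq0 // => /(_ isT).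
rewrite ordM ?fmorph_eq0 // -ord_conj /w wP w0P (addrC w0) wP' ord_X uP'.
by rewrite mul0r addr0 dvdz1; move: tP; clear; lia.
Qed.

Hypothesis snt : exists y, s y != y.
Hypothesis resP : has_residues P.

(* If t were a uniformizer, expanding in powers of t with constant
   coefficients would make every regular function s-invariant. *)
Lemma ramified : conj_pt P = P -> ord P t = 2.
Proof.
move=> cP; have [t1 t1P] := ord_onto P.
have t10 : t1 != 0 by apply: contra_eq_neq t1P => ->; rewrite Defs.ord0.
have t0 : t != 0 by apply: contraTneq tP => ->; rewrite Defs.ord0.
have sww : s (t1 * s t1) = t1 * s t1 by rewrite rmorphM /= (proj1 sI) mulrC.
have := dvd sww; rewrite mulf_neq0 ?fmorph_eq0 // => /(_ isT).
rewrite ordM ?fmorph_eq0 // -ord_conj cP t1P => d2.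
have le2 : ord P t <= 2 by have := dvdn_leq (isT : (0 < 2)%N) d2; move: tP; clear; lia.
have [t1'|//] : ord P t = 1 \/ ord P t = 2 by move: tP le2; clear; lia.
have expand (m : nat) f : vge P 0 f -> exists g f', [/\ s g = g, vge P 0 f' &
    f = g + t ^+ m * f'].
  move=> f0; elim: m => [|m [g [f' [sg f'0 fE]]]].
    by exists 0, f; rewrite rmorph0 expr0 mul1r add0r.
  have [a f'a] := resP f'0; exists (g + t ^+ m * cst C a), ((f' - cst C a) / t).
  split.
  - by rewrite rmorphD rmorphM rmorphXn /= st sg (proj2 sI).
  - have tv : vge P (- 1) t^-1 by rewrite vgeE ?invr_eq0 // ord_V t1'.
    by have := vgeM f'a tv; rewrite subrr.
  - by rewrite {1}fE exprSr; field.
have fixO f : vge P 0 f -> s f = f.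
  move=> f0; apply/eqP; rewrite -subr_eq0; apply/negPn/negP => d0.
  pose m := `|ord P (s f - f)|.+1.
  have [g [f' [sg f'0 fE]]] := expand m f f0.
  have : vge P m%:Z (s f - f).
    have -> : s f - f = (s f' - f') * t ^+ m.
      by rewrite {1 2}fE rmorphD rmorphM rmorphXn /= st sg; ring.
    apply: vgeMl; last by rewrite vgeE ?expf_neq0 // ord_X t1' mul1r.
    by apply: vgeB => //; rewrite -vge_conj cP.
  by rewrite vgeE // /m; lia.
have [y /negP[]] := snt; have [yP|yP] := boolP (vge P 0 y).
  by rewrite fixO.
have : vge P 0 y^-1.
  by move: yP; rewrite /vge negb_or invr_eq0 ord_V => /andP[/negPf->] /=; lia.
by move/fixO; rewrite fmorphV => /invr_inj->.
Qed.

End Ramification.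
End Conjugation.

(** * Double covers of the line *)

Lemma inv_eq_div (F : fieldType) (t p q : F) :
  t != 0 -> q != 0 -> t^-1 = p / q -> q = t * p.
Proof.
by move=> t0 q0 /(congr1 ( *%R^~ (t * q))); rewrite mulKf // mulrCA divfK.
Qed.

Lemma root_split (k : closedFieldType) (a : k) (p : {poly k}) : p != 0 ->
  exists n q, q.[a] != 0 /\ p = ('X - a%:P) ^+ n * q.
Proof.
move=> p0; have [n [q qa ->]] := multiplicity_XsubC p a.
by exists n, q; rewrite p0 /= in qa; rewrite mulrC.
Qed.

Lemma rational_point (k : closedFieldType) (C : curve k) (x : funfield C) (a : k) :
  transc x -> (forall f, gen x f) ->
  exists R : point C, ord R (x - cst C a) = 1 /\ has_residues R.
Proof.
move=> tx gx.
pose O f := exists p q : {poly k}, q.[a] != 0 /\ f = ev x p / ev x q.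
have nz (q : {poly k}) : q.[a] != 0 -> ev x q != 0.
  by rewrite transc_eq0 //; apply: contraNneq => ->; rewrite horner0.
have Op (p : {poly k}) : O (ev x p).
  by exists p, 1; rewrite hornerC oner_eq0 rmorph1 divr1.
have OD f h : O f -> O h -> O (f + h).
  move=> [p [q [qa ->]]] [p' [q' [q'a ->]]]; exists (p * q' + p' * q), (q * q').
  by rewrite hornerM mulf_neq0 // addf_div ?nz // rmorphD !rmorphM.
have OM f h : O f -> O h -> O (f * h).
  move=> [p [q [qa ->]]] [p' [q' [q'a ->]]]; exists (p * p'), (q * q').
  by rewrite hornerM mulf_neq0 // mulf_div !rmorphM.
have Oc c : O (cst C c) by rewrite -(evC x).
set t := x - cst C a; have tE : t = ev x ('X - a%:P) by rewrite evXsubC.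
have t0 : t != 0 by rewrite tE transc_eq0 // polyXsubC_eq0.
have Ot : O t by rewrite tE.
have nOt : ~ O t^-1.
  move=> [p [q [qa e]]]; move/eqP: (inv_eq_div t0 (nz _ qa) e).
  rewrite tE -rmorphM (inj_eq (transc_inj tx)) => /eqP qE; move: qa.
  by rewrite qE hornerM !hornerE subrr mul0r eqxx.
have dec f : f != 0 -> exists (n : int) u, [/\ u != 0, O u, O u^-1 & f = t ^ n * u].
  move=> f0; have [p [q [q0 fE]]] := gx f.
  have p0 : p != 0 by apply: contraNneq f0 => p0; rewrite fE p0 rmorph0 mul0r.
  have [n [p' [p'a pE]]] := root_split a p0.
  rewrite transc_eq0 // in q0; have [m [q' [q'a qE]]] := root_split a q0.
  exists (n%:Z - m%:Z), (ev x p' / ev x q'); split.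
  - by rewrite mulf_neq0 ?invr_eq0 ?nz.
  - by exists p', q'.
  - by exists q', p'; rewrite invf_div.
  - rewrite fE pE qE !rmorphM !rmorphXn /= -tE expfzDr // -exprnN -exprnP.
    by rewrite mulf_div.
have [R [RO Rt]] := point_of_ring Oc OD OM Ot nOt dec.
exists R; split=> // f /RO[p [q [qa ->]]].
exists (p.[a] / q.[a]).
have : root (p - (p.[a] / q.[a]) *: q) a by rewrite /root !hornerE divfK // subrr.
move=> /factor_theorem[r rE].
have -> : ev x p / ev x q - cst C (p.[a] / q.[a]) = (ev x r / ev x q) * t.
  rewrite mulrAC tE -rmorphM -rE rmorphB /= evZ.
  by rewrite mulrBl mulfK ?nz.
by apply: vgeMl; [apply/RO; exists r, q|rewrite vgeE // Rt].
Qed.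

Section ProjectiveLinePoints.
Variable k : closedFieldType.

Let X : funfield (P1 k) := tofrac 'X.

Lemma ev_P1 (p : {poly k}) : ev X p = tofrac p.
Proof.
elim/poly_ind: p => [|p c IHp]; first by rewrite !rmorph0.
by rewrite !(rmorphD, rmorphM) /= evX evC IHp.
Qed.

Lemma P1_point (a : k) : exists R : point (P1 k),
  ord R (tofrac ('X - a%:P)) = 1 /\ has_residues R.
Proof.
have tX : transc X by move=> p /eqP; rewrite ev_P1 tofrac_eq0 => /eqP.
have gX f : gen X f.
  have [p [q [q0 fE]]] := frac_decomp f.
  by exists p, q; rewrite transc_eq0 // !ev_P1.
have [R [Ra Rres]] := rational_point a tX gX.
by exists R; rewrite -ev_P1 evXsubC.
Qed.

End ProjectiveLinePoints.

(** A degree two map to the line, given by its Galois involution. In characteristic 2 this form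
    contains separability. *)
Definition double_cover (k : closedFieldType) (C : curve k)
    (s : {rmorphism funfield C -> funfield C}) (x : funfield C) : Prop :=
  [/\ kinvolution s, exists y, s y != y, transc x
    & forall f, s f = f <-> gen x f].

Lemma double_cover_inv (k : closedFieldType) (C : curve k)
    (s : {rmorphism funfield C -> funfield C}) (x : funfield C) :
  double_cover s x -> kinvolution s.
Proof. by case. Qed.

Section ChangeGenerator.
Variables (k : closedFieldType) (C : curve k).
Implicit Types x y f : funfield C.

Lemma gen_of_cst a f : gen (cst C a) f -> exists b, f = cst C b.
Proof.
have eva p : ev (cst C a) p = cst C p.[a].
  elim/poly_ind: p => [|p c IHp]; first by rewrite horner0 !rmorph0.
  by rewrite !(rmorphD, rmorphM) /= evX evC IHp !hornerE rmorphD rmorphM.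
by move=> [p [q [_ ->]]]; exists (p.[a] / q.[a]); rewrite fmorph_div !eva.
Qed.

Lemma transc_gen x y : transc x -> gen y x -> transc y.
Proof.
move=> tx gx; apply: not_cst_transc => a ya; rewrite ya in gx.
by have [b] := gen_of_cst gx; apply: transc_not_cst.
Qed.

Lemma double_cover_gen s x y :
  double_cover s x -> gen x y -> gen y x -> double_cover s y.
Proof.
move=> [sI snt tx fixx] gxy gyx; split=> //; first exact: transc_gen gyx.
by move=> f; rewrite fixx; split; apply: gen_sub.
Qed.

Lemma double_coverV s x : double_cover s x -> double_cover s x^-1.
Proof.
move=> dc; apply: (double_cover_gen dc); first exact/genV/gen_x.
by rewrite -[X in gen _ X]invrK; apply/genV/gen_x.
Qed.

End ChangeGenerator.

Section DoubleCover.
Variables (k : closedFieldType) (C : curve k).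
Variables (s : {rmorphism funfield C -> funfield C}) (x : funfield C).
Hypothesis dc : double_cover s x.
Implicit Types (P Q : point C) (f h : funfield C).

Let sI := double_cover_inv dc.
Let snt : exists y, s y != y. Proof. by case: dc. Qed.
Let tx : transc x. Proof. by case: dc. Qed.
Let fixE f : s f = f <-> gen x f. Proof. by case: dc. Qed.

Lemma point_over a : exists P, vge P 1 (x - cst C a).
Proof.
have [iota iE] := frac_lift (transc_inj tx).
have icst c : iota (cst (P1 k) c) = cst C c by rewrite -(evC x) -iE.
have fix' f : s f = f <-> exists u : {fraction {poly k}}, f = iota u.
  rewrite fixE; split=> [[p [q [_ ->]]]|[u ->]].
    by exists (tofrac p / tofrac q); rewrite fmorph_div !iE.
  have [p [q [q0 ->]]] := frac_decomp u.
  by exists p, q; rewrite transc_eq0 // fmorph_div !iE.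
have [R [Ra Rres]] := P1_point a.
have [P [e [e0 PE]]] := extend_point icst sI fix' snt Rres.
by exists P; rewrite -evXsubC -iE; apply: vge_ord; rewrite PE Ra; lia.
Qed.

Section OverPoint.
Variable a : k.

Let t := x - cst C a.

Let t0 : t != 0.
Proof. by rewrite /t -evXsubC transc_eq0 // polyXsubC_eq0. Qed.

Let tgt P : vge P 1 t = (0 < ord P t).
Proof. by rewrite vgeE //; lia. Qed.

(** Leading exponent and coefficient of f in powers of x - a. They depend on a alone, so they serve
    all points over a at once. *)
Lemma local_expansion f : gen x f -> f != 0 -> exists (n : int) c,
  c != 0 /\ forall P, vge P 1 t -> vge P 1 (f / t ^ n - cst C c).
Proof.
move=> [p [q [q0 ->]]]; rewrite mulf_eq0 negb_or => /andP[p0 _].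
rewrite !transc_eq0 // in p0 q0.
have [n [p' [p'a pE]]] := root_split a p0.
have [m [q' [q'a qE]]] := root_split a q0.
exists (n%:Z - m%:Z), (p'.[a] / q'.[a]); split; first by rewrite mulf_neq0 ?invr_eq0.
move=> P Pt; have [q'0 q'o] := ord_ev_unit Pt q'a.
have -> : ev x p / ev x q / t ^ (n%:Z - m%:Z) = ev x p' / ev x q'.
  rewrite pE qE !rmorphM !rmorphXn /= !evXsubC -/t expfzDr // -exprnN -exprnP.
  by field; apply/and3P; split=> //; apply: expf_neq0.
have vp := vge_value p' Pt; have vq := vge_value q' Pt.
have cq0 : cst C q'.[a] != 0 by rewrite fmorph_eq0.
have -> : ev x p' / ev x q' - cst C (p'.[a] / q'.[a]) =
    ((ev x p' - cst C p'.[a]) * cst C q'.[a]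
     - cst C p'.[a] * (ev x q' - cst C q'.[a])) * (ev x q' * cst C q'.[a])^-1.
  by rewrite fmorph_div; field; apply/andP; split.
rewrite mulrC; apply: vgeMl; last apply: vgeB.
- by rewrite vgeE ?invr_eq0 ?mulf_neq0 // ord_V ordM // q'o ord_cst.
- by rewrite mulrC; apply: vgeMl => //; apply: vge_cst.
- by apply: vgeMl => //; apply: vge_cst.
Qed.

Lemma ord_gen f : gen x f -> f != 0 -> exists n, forall P, vge P 1 t ->
  ord P f = n * ord P t.
Proof.
move=> gf f0; have [n [c [c0 cP]]] := local_expansion gf f0.
exists n => P Pt; have [_] := unit_of_value c0 (cP P Pt).
by rewrite ord_div ?expfz_neq0 // ord_Xz // => /eqP; rewrite subr_eq0 mulrC => /eqP.
Qed.

Lemma residue_gen P f : vge P 1 t -> gen x f -> vge P 0 f ->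
  exists c, vge P 1 (f - cst C c).
Proof.
move=> Pt gf f0; have [->|fn] := eqVneq f 0.
  by exists 0; rewrite rmorph0 subrr vge_0.
have [n [c [c0 cP]]] := local_expansion gf fn.
have [_] := unit_of_value c0 (cP P Pt).
rewrite ord_div ?expfz_neq0 // ord_Xz // => /eqP; rewrite subr_eq0 => /eqP fo.
have [n0|n0] := eqVneq n 0.
  by exists c; have := cP P Pt; rewrite n0 expr0z divr1.
exists 0; rewrite rmorph0 subr0 vgeE //.
have : ord P f != 0 by rewrite fo mulf_neq0 //; move: Pt; rewrite tgt; clear; lia.
by move: f0; rewrite vgeE //; clear; lia.
Qed.

(** If trace and norm are regular at P, the residue of f is a root of the reduced quadratic
    equation. They may fail to be, since s f can have a pole at P; the equation divided by the worse
    of the two poles then becomes linear modulo the maximal ideal. *)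
Lemma residues_over P : vge P 1 t -> has_residues P.
Proof.
move=> Pt f f0; pose T := f + s f; pose N := f * s f.
have gT : gen x T by apply/fixE; rewrite rmorphD /= (proj1 sI) addrC.
have gN : gen x N by apply/fixE; rewrite rmorphM /= (proj1 sI) mulrC.
have fE : f * f = T * f - N by rewrite /T /N; ring.
have [/andP[T0 N0]|nTN] := boolP (vge P 0 T && vge P 0 N).
  have [Tb Tb1] := residue_gen Pt gT T0; have [Nb Nb1] := residue_gen Pt gN N0.
  have [al alE] := @solve_monicpoly k 2 (fun i => if i == 0 then - Nb else Tb) isT.
  rewrite !big_ord_recl big_ord0 /= addr0 expr0 mulr1 expr1 in alE.
  have : vge P 1 ((f - cst C al) * (f - cst C (Tb - al))).
    have -> : (f - cst C al) * (f - cst C (Tb - al)) =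
        (T - cst C Tb) * f - (N - cst C Nb) - cst C (al ^+ 2 - (- Nb + Tb * al)).
      rewrite !(rmorphD, rmorphB, rmorphM, rmorphXn, rmorphN) /=.
      by rewrite mulrBl mulrBr fE; ring.
    rewrite alE subrr rmorph0 subr0; apply: vgeB => //.
    by rewrite mulrC; apply: vgeMl.
  have [h1|/nvge1M h1 h] := boolP (vge P 1 (f - cst C al)); first by exists al.
  exists (Tb - al); apply: contraLR h => h2.
  by apply: h1 => //; apply: vgeB => //; apply: vge_cst.
(* d is whichever of T and N has the deepest pole, so the residues of T / d and N / d exist and one
   of them is 1. *)
have [d [gd d0 dn [T0 N0] de]] : exists d, [/\ gen x d, d != 0, ord P d < 0,
    vge P 0 (T / d) /\ vge P 0 (N / d) & d = T \/ d = N].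
  have aux A B : gen x A -> A != 0 -> ord P A < 0 -> vge P (ord P A) B ->
      vge P 0 (B / A).
    move=> gA A0 An BA; have Av : vge P (- ord P A) A^-1.
      by rewrite vgeE ?invr_eq0 // ord_V.
    by have := vgeM BA Av; rewrite subrr.
  have [NT|] := boolP ((T != 0) && (ord P T < 0) && vge P (ord P T) N).
    case/andP: NT => /andP[Tn To] NT; exists T; split=> //; last by left.
    by split; apply: aux => //; apply: vge_ord.
  have [/andP[Nn No] nT|] := boolP ((N != 0) && (ord P N < 0)).
    exists N; split=> //; last by right.
    split; apply: aux => //; last exact: vge_ord.
    have [T0|Tn] := eqVneq T 0; first by rewrite T0 vge_0.
    by move: nT No; rewrite Tn /= !vgeE //; clear; lia.
  move=> nN nT; move: nTN nN nT; rewrite /vge.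
  by case: (T == 0); case: (N == 0) => //=; clear; lia.
have [tb tb1] := residue_gen Pt (gen_div gT gd) T0.
have [nb nb1] := residue_gen Pt (gen_div gN gd) N0.
have key : vge P 1 (cst C tb * f - cst C nb).
  have -> : cst C tb * f - cst C nb = f * f / d - (T / d - cst C tb) * f
      + (N / d - cst C nb) by rewrite fE; field.
  apply: vgeD => //; apply: vgeB; last by rewrite mulrC; apply: vgeMl.
  apply: vgeMl; first exact: vgeM0.
  by rewrite vgeE ?invr_eq0 // ord_V; move: dn; clear; lia.
have [tb0|tb0] := eqVneq tb 0.
  exfalso; move: key; rewrite tb0 rmorph0 mul0r sub0r vgeN.
  have [nb0|nb0] := eqVneq nb 0.
    have : vge P 1 (d / d - cst C 0).
      by case: de => dE; rewrite {1}dE rmorph0 subr0;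
        [move: tb1; rewrite tb0|move: nb1; rewrite nb0]; rewrite rmorph0 subr0.
    by rewrite divff // rmorph0 subr0 vgeE ?oner_eq0 // ord_1.
  by rewrite vgeE ?fmorph_eq0 // ord_cst.
exists (nb / tb).
have ct : cst C tb != 0 by rewrite fmorph_eq0.
have -> : f - cst C (nb / tb) = cst C tb^-1 * (cst C tb * f - cst C nb).
  by rewrite fmorph_div fmorphV; field.
by apply: vgeMl => //; apply: vge_cst.
Qed.

Lemma fibre_over P Q : vge P 1 t -> vge Q 1 t -> P = Q \/ P = conj_pt sI Q.
Proof.
move=> Pt Qt; apply: fibre => f /fixE gf; have [->|f0] := eqVneq f 0.
  by rewrite !vge_0.
have [n nE] := ord_gen gf f0; rewrite !vgeE // !nE //.
by move: Pt Qt; rewrite !tgt => ? ?; rewrite !pmulr_lge0.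
Qed.

Lemma ord_over P Q : vge Q 1 t -> vge P 0 t ->
  ord P t = (Q == P)%:Z + (conj_pt sI Q == P)%:Z.
Proof.
move=> Qt Pt.
have gt : gen x t by apply/genB/gen_cst/gen_x.
have st : s t = t by apply/fixE.
have Qct : vge (conj_pt sI Q) 1 t by rewrite vge_conj st.
have [P1|P1] := boolP (vge P 1 t); last first.
  have -> : ord P t = 0 by have [] := unit_ord Pt P1.
  have [QP|_] := eqVneq Q P; first by rewrite -QP Qt in P1.
  by have [QP|_] := eqVneq (conj_pt sI Q) P; rewrite ?addr0 // -QP Qct in P1.
have dvd P' : vge P' 1 t -> forall f, s f = f -> f != 0 -> (ord P' t %| ord P' f)%Z.
  by move=> P't f /fixE gf f0; have [n ->] := ord_gen gf f0; rewrite // dvdz_mull.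
have ordQ : ord Q t = 1 + (conj_pt sI Q == Q)%:Z.
  move: (Qt); rewrite tgt => Qt'; have [e|/eqP ne] := eqVneq (conj_pt sI Q) Q.
    by rewrite (ramified st Qt' (dvd Q Qt) snt (residues_over Qt) e).
  by rewrite (unramified Qt' (dvd Q Qt) ne) addr0.
have [->|->] := fibre_over P1 Qt; first by rewrite eqxx ordQ.
by rewrite ord_conj_fix // ordQ eqxx eq_sym addrC.
Qed.

End OverPoint.

(** If every x - a were a unit at P, then [ord P] would be trivial on k(x), the fixed field of s. *)
Lemma over_some_point P : vge P 0 x -> exists a, vge P 1 (x - cst C a).
Proof.
move=> x0; apply: contrapT => /forallNP na.
have ord_p p : p != 0 -> ord P (ev x p) = 0.
  move=> p0; have [r ->] := poly_split p0; rewrite evZ.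
  have la0 : cst C (lead_coef p) != 0 by rewrite fmorph_eq0 lead_coef_eq0.
  have [] : ev x (\prod_(z <- r) ('X - z%:P)) != 0 /\
      ord P (ev x (\prod_(z <- r) ('X - z%:P))) = 0.
    elim: r => [|z r [IH1 IH2]]; first by rewrite big_nil rmorph1 oner_eq0 ord_1.
    rewrite big_cons rmorphM /= evXsubC.
    have [|z0 zo] := unit_ord _ (introN idP (na z)).
      by apply: vgeB => //; apply: vge_cst.
    by rewrite mulf_neq0 // ordM // zo IH2.
  by move=> r0 ro; rewrite ordM // ro ord_cst.
have ord_g f : gen x f -> ord P f = 0.
  have [->|f0] := eqVneq f 0; first by rewrite Defs.ord0.
  move=> [p [q [q0 fE]]]; have p0 : ev x p != 0.
    by apply: contraNneq f0 => p0; rewrite fE p0 mul0r.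
  by rewrite fE ord_div // !ord_p // -?(transc_eq0 _ tx).
by have [f [/fixE gf]] := fixed_nontrivial sI P; rewrite ord_g ?eqxx.
Qed.

End DoubleCover.

(** * The pole divisor X of a double cover and the spaces L(nX) *)

Section PoleDivisor.
Variables (k : closedFieldType) (C : curve k).
Variables (s : {rmorphism funfield C -> funfield C}) (x : funfield C).
Hypothesis dc : double_cover s x.
Implicit Types (P Q : point C) (f h : funfield C) (p q r : {poly k}).

Let sI := double_cover_inv dc.
Let tx : transc x. Proof. by case: dc. Qed.
Let fixE f : s f = f <-> gen x f. Proof. by case: dc. Qed.

Let x0 : x != 0.
Proof. by apply/eqP => x0; have := @transc_not_cst _ _ x 0 tx; rewrite x0 rmorph0. Qed.

Lemma sx : s x = x. Proof. by apply/fixE/gen_x. Qed.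

Lemma tr_gen f : gen x (f + s f).
Proof. by apply/fixE; rewrite rmorphD /= (proj1 sI) addrC. Qed.

Lemma nm_gen f : gen x (f * s f).
Proof. by apply/fixE; rewrite rmorphM /= (proj1 sI) mulrC. Qed.

Let over_inf P : ord P x < 0 -> vge P 1 (x^-1 - cst C 0).
Proof. by move=> xP; rewrite rmorph0 subr0 vgeE ?invr_eq0 // ord_V; lia. Qed.

Lemma residues P : has_residues P.
Proof.
have [xP|xP] := ltP (ord P x) 0.
  exact (residues_over (double_coverV dc) (over_inf xP)).
have [a Pa] := over_some_point dc (vge_ord xP).
exact (residues_over dc Pa).
Qed.

Lemma pole_exists : exists P, ord P x < 0.
Proof.
have [P] := point_over (double_coverV dc) 0.
by rewrite rmorph0 subr0 vgeE ?invr_eq0 // ord_V => ?; exists P; lia.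
Qed.

Definition pole : point C := projT1 (cid pole_exists).

Lemma pole_lt0 : ord pole x < 0.
Proof. by rewrite /pole; case: (cid _). Qed.

Definition mult2 Q P : int := (Q == P)%:Z + (conj_pt sI Q == P)%:Z.

Definition fib Q : divisor C := << Q >> + << conj_pt sI Q >>.

Lemma coeff_fib Q P : coeff P (fib Q) = mult2 Q P.
Proof. by rewrite /fib coeffD !coeffU !mul1r !natz. Qed.

Lemma deg_fib Q : deg (fib Q) = 2.
Proof. by rewrite /fib degD !degU. Qed.

Lemma coeff_fibMn Q P n : coeff P (fib Q *+ n) = n%:Z * mult2 Q P.
Proof. by rewrite coeffMn coeff_fib -[LHS]mulr_natl natz. Qed.

Lemma deg_fibMn Q n : deg (fib Q *+ n) = n%:Z * 2.
Proof. by rewrite degMn deg_fib -[LHS]mulr_natl natz. Qed.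

Lemma mult2_ge0 Q P : 0 <= mult2 Q P.
Proof. by rewrite /mult2; lia. Qed.

Lemma mult2_conj Q P : mult2 Q (conj_pt sI P) = mult2 Q P.
Proof.
have cK := conj_ptK sI; rewrite /mult2 addrC (inj_eq (can_inj cK)).
by rewrite -(can_eq cK (conj_pt sI Q) P) cK.
Qed.

Lemma mult2_self Q : 0 < mult2 Q Q.
Proof. by rewrite /mult2 eqxx; lia. Qed.

Definition xpole P := mult2 pole P.

Lemma ord_x_pole P : ord P x < 0 -> ord P x = - xpole P.
Proof.
move=> Px; have xv : x^-1 - cst C 0 = x^-1 by rewrite rmorph0 subr0.
have := ord_over (double_coverV dc) (a := 0) (P := P) (over_inf pole_lt0).
rewrite xv vgeE ?invr_eq0 // ord_V => e; rewrite -[LHS]opprK e; last by lia.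
(* The two conjugate points carry different proofs of [kinvolution], hence the detour through
   [point_eq]. *)
rewrite /xpole /mult2 -/pole; congr (- (_ + (_ == _)%:Z)).
by apply: point_eq => f; rewrite !ord_conj.
Qed.

Lemma x_nonpole P : 0 <= ord P x -> xpole P = 0.
Proof.
move=> Px; rewrite /xpole /mult2.
have [e|_] := eqVneq pole P; first by have := pole_lt0; rewrite e; lia.
have [e|//] := eqVneq (conj_pt sI pole) P.
by have := pole_lt0; rewrite -(ord_conj_fix sI pole sx) e; lia.
Qed.

Lemma ord_x_sub a P : ord P x < 0 -> ord P (x - cst C a) = ord P x.
Proof.
by move=> Px; have [] := dominant x0 Px (_ : vge P 0 (- cst C a)); rewrite ?vgeN ?vge_cst.
Qed.

(** All fibres of x are linearly equivalent to X, through x - a, or through 1 when Q is a pole of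
    x. *)
Lemma fib_fun Q : exists u, [/\ u != 0, gen x u, (exists p, u = ev x p /\ (size p <= 2)%N)
  & forall P, ord P u = mult2 Q P - xpole P].
Proof.
have [Qx|Qx] := ltP (ord Q x) 0.
  exists 1; split; [exact: oner_neq0|exact: gen1| |].
    by exists 1; rewrite rmorph1 size_poly1.
  move=> P; rewrite ord_1 /xpole.
  have [e|e] := fibre_over (double_coverV dc) (over_inf Qx) (over_inf pole_lt0).
    by rewrite e; lia.
  have -> : Q = conj_pt sI pole by rewrite e; apply: point_eq => f; rewrite !ord_conj.
  by rewrite /mult2 conj_ptK; lia.
have [a Qa] := over_some_point dc (vge_ord Qx).
exists (x - cst C a); split.
- by rewrite -evXsubC transc_eq0 // polyXsubC_eq0.
- by apply/genB/gen_cst/gen_x.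
- by exists ('X - a%:P); rewrite evXsubC size_XsubC.
move=> P; have [Px|Px] := ltP (ord P x) 0.
  rewrite ord_x_sub // ord_x_pole // /mult2.
  have ne R : vge R 0 x -> R != P.
    by apply: contraTneq => ->; rewrite vgeE //; lia.
  have Qx' := vge_ord Qx.
  by rewrite !(negPf (ne _ _)) ?vge_conj ?sx //; lia.
rewrite (x_nonpole Px) subr0 (ord_over dc Qa) //; last first.
  by apply: vgeB; [apply: vge_ord|apply: vge_cst].
Qed.

(* The space L(n X) for X the pole divisor of [x]. *)
Definition Lsp (n : nat) f := forall P, vge P (- (n%:Z * xpole P)) f.

Lemma Lsp_RR n f : riemann_roch_space (fib pole *+ n) f <-> Lsp n f.
Proof.
have cE P : coeff P (fib pole *+ n) = n%:Z * xpole P.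
  exact: coeff_fibMn.
split=> [[->|h] P|h]; first exact: vge_0.
  by apply: vge_ord; have := h P; rewrite cE; lia.
have [f0|f0] := eqVneq f 0; [by left|right=> P].
by have := h P; rewrite vgeE // cE; lia.
Qed.

Lemma xpole_ge0 P : 0 <= xpole P. Proof. exact: mult2_ge0. Qed.

Lemma Lsp0 n : Lsp n 0. Proof. by move=> P; apply: vge_0. Qed.

Lemma LspD n f h : Lsp n f -> Lsp n h -> Lsp n (f + h).
Proof. by move=> nf nh P; apply: vgeD. Qed.

Lemma LspM n m f h : Lsp n f -> Lsp m h -> Lsp (n + m) (f * h).
Proof.
by move=> nf nh P; rewrite PoszD mulrDl opprD; apply: vgeM.
Qed.

Lemma Lsp_le n m f : (n <= m)%N -> Lsp n f -> Lsp m f.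
Proof.
move=> nm nf P; apply: vge_le (nf P).
by rewrite lerN2 ler_wpM2r ?xpole_ge0 //; lia.
Qed.

Lemma Lsp_cst c : Lsp 0 (cst C c).
Proof. by move=> P; rewrite mul0r oppr0 vge_cst. Qed.

Lemma LspZ n c f : Lsp n f -> Lsp n (cst C c * f).
Proof. by move=> nf; rewrite -[n]add0n; apply/LspM/nf/Lsp_cst. Qed.

Lemma Lsp_x : Lsp 1 x.
Proof.
move=> P; rewrite mul1r; have [Px|Px] := ltP (ord P x) 0.
  by rewrite vgeE // ord_x_pole.
by rewrite (x_nonpole Px) vgeE //; lia.
Qed.

Lemma Lsp_ev n p : (size p <= n.+1)%N -> Lsp n (ev x p).
Proof.
elim/poly_ind: p n => [|p c IHp] n; first by rewrite rmorph0 => _; apply: Lsp0.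
rewrite rmorphD rmorphM /= evX evC size_MXaddC => szp.
apply: LspD; last by apply: Lsp_le (Lsp_cst c).
move: szp; case: ifP => [/andP[/eqP-> _] _|_ szp].
  by rewrite rmorph0 mul0r; apply: Lsp0.
have [p0|p0] := eqVneq p 0; first by rewrite p0 rmorph0 mul0r; apply: Lsp0.
have sp : (0 < size p)%N by rewrite size_poly_gt0.
case: n szp => [|n] szp; first by lia.
by rewrite -addn1; apply: LspM Lsp_x; apply: IHp; lia.
Qed.

Lemma Lsp_s n f : Lsp n f -> Lsp n (s f).
Proof.
move=> nf P; rewrite -(vge_conj sI); have := nf (conj_pt sI P).
by rewrite /xpole mult2_conj.
Qed.

(** A root a of the denominator is also a root of the numerator, because f is regular at a point
    over a; cancelling such roots leaves a polynomial. Its degree is read off at a pole of x. *)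
Lemma Lsp_gen n f : Lsp n f -> gen x f ->
  exists p, (size p <= n.+1)%N /\ f = ev x p.
Proof.
move=> nf gf; have [f0|f0] := eqVneq f 0.
  by exists 0; rewrite size_poly0 rmorph0.
have [p fE] : exists p, f = ev x p.
  have [p [q [q0 fE]]] := gf; rewrite transc_eq0 // in q0.
  have [m] := ubnP (size q); elim: m p q q0 fE => // m IHm p q q0 fE szq.
  have [q1|/closed_rootP[a qa]] := altP (size_poly1P q).
    case: q1 => c c0 qE; exists (c^-1 *: p).
    by rewrite evZ fE qE evC mulrC fmorphV.
  have [P Pa] := point_over dc a.
  have xa : x - cst C a != 0 by rewrite -evXsubC transc_eq0 // polyXsubC_eq0.
  have Px : 0 <= ord P x.
    rewrite leNgt; apply/negP => Px; move: Pa.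
    by rewrite vgeE // ord_x_sub //; lia.
  have [q' qE] := factor_theorem _ _ qa.
  have q'0 : q' != 0 by apply: contraNneq q0 => q'0; rewrite qE q'0 mul0r.
  have pa : root p a.
    apply/negPn/negP => pa; have [p0 po] := ord_ev_unit Pa pa.
    have := nf P; rewrite (x_nonpole Px) mulr0 oppr0 vgeE //.
    have : vge P 1 (ev x q).
      rewrite qE rmorphM /= evXsubC; apply: vgeMl Pa.
      by apply: vge_ev; apply: vge_ord.
    have eq0 : ev x q != 0 by rewrite transc_eq0.
    by rewrite fE ord_div // po vgeE //; lia.
  have [p' pE] := factor_theorem _ _ pa.
  apply: (IHm p' q' q'0).
    rewrite fE pE qE !rmorphM /= !evXsubC; have := transc_eq0 q' tx.
    by rewrite (negPf q'0) => q'n; field; rewrite xa q'n.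
  by move: szq; rewrite qE size_Mmonic ?monicXsubC // size_XsubC addn2; clear; lia.
exists p; split=> //; rewrite fE in f0; rewrite transc_eq0 // in f0.
have [_] := ord_ev_pole pole_lt0 f0; rewrite -fE.
have := nf pole; have fn : f != 0 by rewrite fE transc_eq0.
rewrite vgeE // ord_x_pole ?pole_lt0 // => le e; rewrite e in le.
have xp : 0 < xpole pole by apply: mult2_self.
move: le; rewrite mulNr lerN2 mulrC ler_pM2r //.
by clear; lia.
Qed.

(** Where x is regular, f is integral over its trace and norm; at a pole of x the same holds for f /
    x^n. The right side involves only s and polynomials in x, which makes L(nX) computable on
    quotients of C. *)
Lemma Lsp_tr_nm n f : Lsp n f <->
  (exists p, (size p <= n.+1)%N /\ f + s f = ev x p) /\
  (exists r, (size r <= (n + n).+1)%N /\ f * s f = ev x r).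
Proof.
split=> [nf|[[p [szp pE]] [r [szr rE]]] P].
  split; apply: Lsp_gen; rewrite ?tr_gen ?nm_gen //.
  - by apply: LspD => //; apply: Lsp_s.
  - exact: tr_gen.
  - by apply: LspM => //; apply: Lsp_s.
  - exact: nm_gen.
have fE : f * f = ev x p * f - ev x r by rewrite -pE -rE; ring.
have pP := Lsp_ev szp P; have rP := Lsp_ev szr P.
have [Px|Px] := ltP (ord P x) 0; last first.
  move: pP rP; rewrite (x_nonpole Px) !mulr0 oppr0 => p0 r0.
  exact: integral p0 r0 fE.
have xv : vge P (n%:Z * xpole P) (x ^- n).
  by rewrite vgeE ?invr_eq0 ?expf_neq0 // ord_V ord_X ord_x_pole //; lia.
have -> : f = (f * x ^- n) * x ^+ n by rewrite mulfVK // expf_neq0.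
rewrite -[- _]add0r; apply: vgeM; last first.
  by rewrite vgeE ?expf_neq0 // ord_X ord_x_pole //; lia.
have p0 : vge P 0 (ev x p * x ^- n) by have := vgeM pP xv; rewrite addNr.
have r0 : vge P 0 (ev x r * (x ^- n * x ^- n)).
  have := vgeM rP (vgeM xv xv); rewrite PoszD mulrDl addNr.
  by [].
by apply: integral p0 r0 _; rewrite mulrACA fE; ring.
Qed.

End PoleDivisor.

(** * Dimensions *)

Section Dimension.
Variables (k : closedFieldType) (C : curve k).
Implicit Types (P Q : point C) (f h : funfield C) (V W : funfield C -> Prop).

Definition comb n (c : 'I_n -> k) (e : 'I_n -> funfield C) : funfield C :=
  \sum_(i < n) cst C (c i) * e i.

Definition indep n (e : 'I_n -> funfield C) : Prop :=
  forall c, comb c e = 0 -> forall i, c i = 0.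

(** The spanning functions need not lie in V: this is only the bound dim V <= n. *)
Definition spanned V n : Prop :=
  exists e : 'I_n -> funfield C, forall f, V f -> exists c, f = comb c e.

Lemma indep_le_span V m n (e : 'I_m -> funfield C) :
  indep e -> (forall i, V (e i)) -> spanned V n -> (m <= n)%N.
Proof.
move=> ie Ve [g gV]; rewrite leqNgt; apply/negP => lt_nm.
have [A AE] := choice (fun i => gV _ (Ve i)).
pose M : 'M[k]_(m, n) := \matrix_(i, j) A i j.
have : kermx M != 0.
  rewrite -mxrank_eq0 mxrank_ker subn_eq0 -ltnNge.
  exact: leq_ltn_trans (rank_leq_col M) lt_nm.
case/rowV0Pn => v /sub_kermxP vM v0; case/negP: v0; apply/eqP/rowP => i.
rewrite mxE; apply: (ie (fun j => v 0 j)); rewrite /comb.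
under eq_bigr => j _ do rewrite AE /comb big_distrr /=.
rewrite exchange_big big1 // => j _.
have /rowP/(_ j) := vM; rewrite !mxE => /(congr1 (cst C)).
rewrite rmorph0 rmorph_sum /= => vMj.
transitivity ((\sum_(i < m) cst C (v 0 i * M i j)) * g j); last first.
  by rewrite vMj mul0r.
by rewrite mulr_suml; apply: eq_bigr => l _; rewrite mxE rmorphM mulrA.
Qed.

Definition extend n (f : funfield C) (e : 'I_n -> funfield C) (i : 'I_n.+1) :=
  if unlift ord0 i is Some j then e j else f.

Lemma comb_extend n (c : 'I_n.+1 -> k) f (e : 'I_n -> funfield C) :
  comb c (extend f e) = cst C (c ord0) * f + comb (c \o fintype.lift ord0) e.
Proof.
rewrite /comb big_ord_recl /extend unlift_none; congr (_ + _).
by apply: eq_bigr => i _; rewrite liftK.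
Qed.

Lemma combZ n a (c : 'I_n -> k) (e : 'I_n -> funfield C) :
  cst C a * comb c e = comb (fun i => a * c i) e.
Proof.
rewrite /comb big_distrr /=.
by apply: eq_bigr => i _; rewrite rmorphM mulrA.
Qed.

Lemma indep_basis V n (e : 'I_n -> funfield C) :
  indep e -> (forall i, V (e i)) -> spanned V n ->
  forall f, V f -> exists c, f = comb c e.
Proof.
move=> ie Ve sV f Vf; apply: contrapT => nf.
suff : (n.+1 <= n)%N by rewrite ltnn.
apply: (@indep_le_span V _ _ (extend f e)) => //; last first.
  by move=> i; rewrite /extend; case: unliftP.
move=> c; rewrite comb_extend => c0.
have c00 : c ord0 = 0.
  apply: contra_notP nf => /eqP cn; exists (fun i => - (c ord0)^-1 * c (fintype.lift ord0 i)).
  move/eqP: c0; rewrite addrC addr_eq0 => /eqP cE.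
  rewrite -combZ -/(comp c _) cE rmorphN fmorphV.
  by rewrite mulNr mulrN opprK mulKf // fmorph_eq0.
move: c0; rewrite c00 rmorph0 mul0r add0r => /ie ci i.
by case: (unliftP ord0 i) => [j ->|-> //]; apply: ci.
Qed.

Lemma spanned_add V W n f0 : (forall f, W f -> exists a, V (f - cst C a * f0)) ->
  spanned V n -> spanned W n.+1.
Proof.
move=> WV [e eV]; exists (extend f0 e) => f /WV[a /eV[c fE]].
exists (fun i => if unlift ord0 i is Some j then c j else a).
rewrite comb_extend unlift_none (_ : comb _ e = comb c e); last first.
  by apply: eq_bigr => i _ /=; rewrite liftK.
by rewrite -fE addrC subrK.
Qed.

Lemma comb_closed V n (c : 'I_n -> k) (e : 'I_n -> funfield C) :
  V 0 -> (forall f h, V f -> V h -> V (f + h)) ->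
  (forall a f, V f -> V (cst C a * f)) -> (forall i, V (e i)) -> V (comb c e).
Proof.
by move=> V0 VD VZ Ve; rewrite /comb; elim/big_ind: _ => // i _; apply: VZ.
Qed.

Lemma has_dim_basis V n (e : 'I_n -> funfield C) :
  V 0 -> (forall f h, V f -> V h -> V (f + h)) ->
  (forall a f, V f -> V (cst C a * f)) -> (forall i, V (e i)) ->
  indep e -> spanned V n -> has_dim (cst C) V n.
Proof.
move=> V0 VD VZ Ve ie sV; exists e; split=> // f; split.
  exact: indep_basis.
by move=> [c ->]; apply: comb_closed.
Qed.

Lemma has_dim_spanned V n : has_dim (cst C) V n -> spanned V n.
Proof. by move=> [e [_ eV]]; exists e => f /eV. Qed.

Lemma indepM n (e : 'I_n -> funfield C) u : u != 0 -> indep e ->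
  indep (fun i => e i * u).
Proof.
move=> u0 ie c; rewrite /comb; under eq_bigr do rewrite mulrA.
by rewrite -mulr_suml => /eqP; rewrite mulf_eq0 (negPf u0) orbF => /eqP/ie.
Qed.

Definition rr (D : divisor C) f : Prop := forall P, vge P (- coeff P D) f.

Lemma rrE D f : riemann_roch_space D f <-> rr D f.
Proof.
split=> [[->|h] P|h]; first exact: vge_0.
  by apply: vge_ord; have := h P; lia.
have [f0|f0] := eqVneq f 0; [by left|right=> P].
by have := h P; rewrite vgeE //; lia.
Qed.

(** A function f0 of L(D + P) outside L(D) attains the full pole order at P, so for f in L(D + P)
    the quotient f / f0 has a residue a there, and f - a f0 lies in L(D). *)
Lemma spanned_addpt D P n : has_residues P ->
  spanned (rr D) n -> spanned (rr (D + << P >>)) n.+1.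
Proof.
move=> resP sD.
have cP Q : coeff Q (D + << P >>) = coeff Q D + (P == Q)%:Z.
  by rewrite coeffD coeffU mul1r natz.
have [[f0 f0D f0nD]|sub] := pselect (exists2 f0, rr (D + << P >>) f0 & ~ rr D f0).
  have f0n : f0 != 0 by apply: contra_notN f0nD => /eqP-> Q; apply: vge_0.
  have f0P : ord P f0 = - coeff P D - 1.
    have := f0D P; rewrite cP eqxx vgeE // => le.
    suff : ~~ vge P (- coeff P D) f0 by rewrite vgeE //; lia.
    apply: contra_notN f0nD => vP Q; have [<- //|ne] := eqVneq P Q.
    by have := f0D Q; rewrite cP (negPf ne) addr0.
  apply: (@spanned_add _ _ _ f0) sD => f fD.
  have [|a fa] := resP (f / f0).
    have f0v : vge P (coeff P D + 1) f0^-1.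
      by rewrite vgeE ?invr_eq0 // ord_V f0P; lia.
    have := vgeM (fD P) f0v; rewrite cP eqxx.
    by congr vge; lia.
  exists a => Q; have [<-|ne] := eqVneq P Q.
    have -> : f - cst C a * f0 = (f / f0 - cst C a) * f0.
      by rewrite mulrBl divfK.
    have f0v : vge P (- coeff P D - 1) f0 by rewrite vgeE // f0P.
    by have := vgeM fa f0v; congr vge; lia.
  have := fD Q; have := f0D Q; rewrite cP (negPf ne) addr0 => ? ?.
  by apply: vgeB => //; apply: vgeMl => //; apply: vge_cst.
apply: (@spanned_add _ _ _ 0) sD => f fD; exists 0; rewrite mulr0 subr0.
by apply: contrapT => nf; apply: sub; exists f.
Qed.

Hypothesis res : forall P, has_residues P.

(** E - D is a sum of points, and each of them adds at most one dimension. *)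
Lemma spanned_mono D E n : (forall P, coeff P D <= coeff P E) ->
  spanned (rr D) n ->
  exists m : nat, m%:Z = n%:Z + deg E - deg D /\ spanned (rr E) m.
Proof.
move=> DE sD; pose a P := absz (coeff P (E - D)).
have aE P : (a P)%:Z = coeff P (E - D).
  by rewrite /a gez0_abs // coeffB subr_ge0.
have addr (r : seq (point C)) : spanned (rr (D + \sum_(P <- r) << P >> *+ a P))
    (n + \sum_(P <- r) a P).
  elim: r => [|P r IHr]; first by rewrite !big_nil addr0 addn0.
  rewrite !big_cons addrCA addrC addnCA addnC.
  elim: (a P) => [|b IHb]; first by rewrite mulr0n addr0 addn0.
  by rewrite mulrSr addrA addnS; apply: spanned_addpt.
have EE : E = D + \sum_(P <- dom (E - D)) << P >> *+ a P.
  rewrite -[LHS](subrK D) addrC; congr (_ + _).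
  rewrite -[LHS]freeg_sumE; apply: eq_bigr => P _.
  by rewrite freegU_muln -aE natz.
have dE : deg E = deg D + (\sum_(P <- dom (E - D)%R) a P)%:Z.
  rewrite [in LHS]EE degD raddf_sum /=; congr (_ + _).
  by rewrite (big_morph Posz PoszD erefl); apply: eq_bigr => P _; rewrite degMn degU natz.
exists (n + \sum_(P <- dom (E - D)%R) a P)%N; split.
  by rewrite dE PoszD; clear; lia.
by have := addr (dom (E - D)); rewrite -EE.
Qed.

End Dimension.

(** * The genus of a double cover *)

Section GenusOfDoubleCover.
Variables (k : closedFieldType) (C : curve k).
Variables (s : {rmorphism funfield C -> funfield C}) (x : funfield C).
Hypothesis dc : double_cover s x.
Implicit Types (P Q : point C) (f h y : funfield C) (p q r : {poly k}).

Let sI := double_cover_inv dc.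
Let tx : transc x. Proof. by case: dc. Qed.
Let fixE f : s f = f <-> gen x f. Proof. by case: dc. Qed.

(** Multiplying by the denominators of trace and norm makes both polynomials; n is merely large
    enough for their degrees. *)
Lemma integral_multiple f : exists n d, d != 0 /\ Lsp dc n (ev x d * f).
Proof.
have [p [q [q0 pE]]] := tr_gen dc f; have [p' [q' [q'0 p'E]]] := nm_gen dc f.
pose u := ev x (q * q').
have su : s u = u by apply/fixE/gen_ev.
exists (addn (size (q' * p)) (size (q * q * q' * p'))), (q * q'); split.
  by rewrite -(transc_eq0 _ tx) rmorphM mulf_neq0.
apply/Lsp_tr_nm; split.
  exists (q' * p); split; first by lia.
  rewrite rmorphM /= su -mulrDr pE /u !rmorphM /=.
  by field.
exists (q * q * q' * p'); split; first by lia.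
rewrite rmorphM /= su mulrACA p'E /u !rmorphM /=.
by field.
Qed.

Definition gap (M : nat) : Prop :=
  (exists f, Lsp dc M f /\ ~ gen x f) /\
  (forall n f, (n < M)%N -> Lsp dc n f -> gen x f).

Lemma gap_exists : exists M, gap M.
Proof.
have [_ [y sy] _ _] := dc; have [n [d [d0 nf]]] := integral_multiple y.
have ex : exists n, `[< exists f, Lsp dc n f /\ ~ gen x f >].
  exists n; apply/asboolP; exists (ev x d * y); split=> // g.
  case/negP: sy; apply/eqP/fixE; have ed0 : ev x d != 0 by rewrite transc_eq0.
  by rewrite -[y](mulKf ed0) mulrC; apply: gen_div => //; apply: gen_ev.
case: (ex_minnP ex) => M /asboolP hM minM; exists M; split=> // m f lt mf.
apply: contrapT => ng; suff /minM : `[< exists f, Lsp dc m f /\ ~ gen x f >] by lia.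
by apply/asboolP; exists f.
Qed.

(** Trace and norm of such an f are constants, so f is algebraic over k. *)
Lemma Lsp_0_cst f : Lsp dc 0 f -> exists c, f = cst C c.
Proof.
move/Lsp_tr_nm => [[p [szp pE]] [r [szr rE]]].
rewrite (size1_polyC szp) evC in pE; rewrite (size1_polyC szr) evC in rE.
move: (p`_0) (r`_0) pE rE => a b pE rE.
apply: (@algebraic_cst _ _ f ('X^2 - a *: 'X + b%:P)).
  apply/eqP => /(congr1 (fun p : {poly k} => p`_2))/eqP.
  by rewrite !coefD coefN coefZ coefX coefXn coefC coef0 mulr0 subr0 addr0 oner_eq0.
rewrite !(rmorphD, rmorphN, rmorphXn) /= evZ evX evC -pE -rE.
by ring.
Qed.

Lemma gap_gt0 M : gap M -> (0 < M)%N.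
Proof.
move=> [[f [fM nf]] _]; rewrite lt0n; apply: contra_notN nf => /eqP M0.
by move: fM; rewrite M0 => /Lsp_0_cst[c ->]; apply: gen_cst.
Qed.

Definition mono_basis (y : funfield C) n m (i : 'I_(n + m)) : funfield C :=
  match split i with inl a => x ^+ a | inr b => x ^+ b * y end.

Lemma ev_coef n (c : 'I_n -> k) :
  \sum_(i < n) cst C (c i) * x ^+ i = ev x (\sum_(i < n) c i *: 'X^i).
Proof.
rewrite rmorph_sum /=; apply: eq_bigr => i _.
by rewrite evZ rmorphXn /= evX.
Qed.

Lemma coef_sum n (c : 'I_n -> k) (i : 'I_n) :
  (\sum_(j < n) c j *: 'X^j)`_i = c i.
Proof.
rewrite coef_sum (bigD1 i) //= coefZ coefXn eqxx mulr1 big1 ?addr0 // => j ji.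
by rewrite coefZ coefXn (_ : (_ == _) = false) ?mulr0 // eq_sym; apply: negbTE.
Qed.

Lemma comb_mono y n m (c : 'I_(n + m) -> k) :
  comb c (@mono_basis y n m) =
  ev x (\sum_(i < n) c (lshift m i) *: 'X^i) +
  ev x (\sum_(i < m) c (rshift n i) *: 'X^i) * y.
Proof.
rewrite /comb big_split_ord /= -!ev_coef mulr_suml; congr (_ + _).
  by apply: eq_bigr => i _; rewrite /mono_basis (unsplitK (inl i)).
by apply: eq_bigr => i _; rewrite /mono_basis (unsplitK (inr i)) mulrA.
Qed.

Lemma indep_mono y n m : ~ gen x y -> indep (@mono_basis y n m).
Proof.
move=> ny c; rewrite comb_mono; set p := \sum_(i < n) _; set q := \sum_(i < m) _.
move=> e0.
have q0 : q = 0.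
  apply/tx/eqP/negPn/negP => q0; apply: ny; exists (- p), q; split=> //.
  apply: (canRL (mulfK q0)); rewrite rmorphN mulrC.
  by apply/eqP; rewrite -addr_eq0 addrC e0.
move: e0; rewrite q0 rmorph0 mul0r addr0 => /tx p0 i.
case: (splitP i) => j ij.
  have -> : i = lshift m j by apply: val_inj.
  by have := coef_sum (fun i => c (lshift m i)) j; rewrite -/p p0 coef0.
have -> : i = rshift n j by apply: val_inj.
by have := coef_sum (fun i => c (rshift n i)) j; rewrite -/q q0 coef0.
Qed.

Lemma Lsp_xX n : Lsp dc n (x ^+ n).
Proof. by rewrite -{2}(evX x) -rmorphXn; apply: Lsp_ev; rewrite size_polyXn. Qed.

Lemma mono_Lsp y M n m : Lsp dc M y -> (n < m.+1)%N ->
  forall l : nat, (l + M <= m.+1)%N -> forall i, Lsp dc m (@mono_basis y n.+1 l i).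
Proof.
move=> yM nm l lm i; rewrite /mono_basis; case: split => j.
  by apply: Lsp_le (Lsp_xX j); have := ltn_ord j; lia.
by apply: Lsp_le (LspM (Lsp_xX j) yM); have := ltn_ord j; lia.
Qed.

Lemma rr_fib n f : rr (fib dc (pole dc) *+ n) f <-> Lsp dc n f.
Proof. by rewrite -rrE; apply: Lsp_RR. Qed.

(** L((M - 1)X) consists of the polynomials of degree < M, of dimension M, and passing to MX adds at
    most deg X = 2. The functions 1, ..., x^M and y attain M + 2. *)
Lemma gap_has_dim M : gap M ->
  has_dim (cst C) (riemann_roch_space (fib dc (pole dc) *+ M)) (M.+1 + 1).
Proof.
move=> gM; have := gap_gt0 gM; case: gM => [[y [yM ny]] lowM] M0.
have [||m [mE sM]] := @spanned_mono _ _ (residues dc)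
    (fib dc (pole dc) *+ M.-1) (fib dc (pole dc) *+ M) M.
- move=> P; rewrite !coeff_fibMn.
  by rewrite ler_wpM2r ?mult2_ge0 // lez_nat leq_pred.
- exists (fun i => x ^+ i) => f /rr_fib fL.
  have [|p [szp ->]] := Lsp_gen fL; first by apply: lowM fL; lia.
  exists (fun i => p`_i); rewrite /comb ev_coef -poly_def; congr (ev x _).
  apply/polyP => j; rewrite coef_poly; case: ltnP => // Mj.
  by rewrite nth_default // (leq_trans szp) // prednK.
have mM : (m = M.+1 + 1)%N.
  by move: mE; rewrite !deg_fibMn; move: M0; clear; lia.
rewrite {}mM in sM.
have sM' : spanned (riemann_roch_space (fib dc (pole dc) *+ M)) (M.+1 + 1).
  by have [e eV] := sM; exists e => f /rrE; apply: eV.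
apply: (has_dim_basis (e := @mono_basis y M.+1 1)) sM'.
- by left.
- by move=> f h /Lsp_RR fL /Lsp_RR hL; apply/Lsp_RR/LspD.
- by move=> a f /Lsp_RR fL; apply/Lsp_RR/LspZ.
- by move=> i; apply/Lsp_RR; apply: (mono_Lsp yM); lia.
- exact: indep_mono.
Qed.

(* [D <= E] where [E] is linearly equivalent to n X with n large, and
   deg D + 1 - l(D) can only increase with D. *)
Lemma gap_upper M (D : divisor C) l : gap M ->
  has_dim (cst C) (riemann_roch_space D) l -> deg D + 1 - l%:Z <= M%:Z - 1.
Proof.
move=> [[y [yM ny]] lowM] hD.
have sD : spanned (rr D) l.
  by have [e eV] := has_dim_spanned hD; exists e => f /rrE; apply: eV.
have [u uP] := choice (fib_fun dc).
pose a P := absz (coeff P D).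
(* E replaces each P in the support by |D(P)| copies of its whole fibre, so E >= D and E is
   equivalent to nX, through U. The summand MX ensures n >= M. *)
pose E := \sum_(P <- dom D) fib dc P *+ a P + fib dc (pole dc) *+ M.
pose n := (\sum_(P <- dom D) a P + M)%N.
pose U := \prod_(P <- dom D) u P ^+ a P.
have U0 : U != 0.
  rewrite /U; elim/big_ind: _ => [|f h|P _]; rewrite ?oner_eq0 //.
    exact: mulf_neq0.
  by rewrite expf_neq0 //; case: (uP P).
have cE P : coeff P E = \sum_(Q <- dom D) mult2 dc Q P * (a Q)%:Z + M%:Z * xpole dc P.
  rewrite /E coeffD raddf_sum /= coeff_fibMn; congr (_ + _).
  by apply: eq_bigr => Q _; rewrite coeff_fibMn mulrC.
have UP P : ord P U = coeff P E - n%:Z * xpole dc P.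
  rewrite cE /n PoszD mulrDl opprD addrACA subrr addr0 /U.
  have : forall Q, u Q != 0 by move=> Q; case: (uP Q).
  move=> un; elim: (dom D) => [|Q r IHr]; first by rewrite !big_nil ord_1 mul0r subr0.
  rewrite !big_cons ordM ?expf_neq0 // ?IHr; last first.
    rewrite prodf_seq_neq0; apply/allP => R _; by rewrite expf_neq0.
  have [_ _ _ /(_ P) uQ] := uP Q.
  by rewrite ord_X uQ PoszD; ring.
have DE P : coeff P D <= coeff P E.
  rewrite cE; have ge0 : 0 <= M%:Z * xpole dc P by rewrite mulr_ge0 ?xpole_ge0.
  have sge0 (r : seq (point C)) : 0 <= \sum_(Q <- r) mult2 dc Q P * (a Q)%:Z.
    by apply: sumr_ge0 => Q _; rewrite mulr_ge0 ?mult2_ge0.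
  have [PD|PD] := boolP (P \in dom D); last first.
    by rewrite (coeff_outdom PD) addr_ge0.
  rewrite (big_rem P PD) /= -addrA; apply: ler_wpDr; first exact: addr_ge0.
  apply: (@le_trans _ _ (a P)%:Z); first by rewrite /a; clear; lia.
  rewrite -{1}[(a P)%:Z]mul1r; apply: ler_wpM2r => //.
  by have := mult2_self dc P; clear; lia.
have [m [mE sE]] := spanned_mono (residues dc) DE sD.
(* The functions x^i with i <= n and x^j y with j <= n - M, all divided by U, lie in L(E). *)
have : (n.+1 + (n - M).+1 <= m)%N.
  have ie := indepM (invr_neq0 U0) (@indep_mono y n.+1 (n - M).+1 ny).
  apply: (indep_le_span ie _ sE) => i P.
  have := mono_Lsp (n := n) (m := n) yM (leqnn _) (l := (n - M).+1).
  have le : ((n - M).+1 + M <= n.+1)%N by rewrite /n; lia.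
  move=> /(_ le i P) vP.
  have vU : vge P (- ord P U) U^-1 by rewrite vgeE ?invr_eq0 // ord_V.
  by have := vgeM vP vU; rewrite UP; congr vge; ring.
have dE : deg E = n%:Z * 2.
  rewrite /E /n degD raddf_sum /= deg_fibMn PoszD mulrDl; congr (_ + _).
  rewrite (big_morph Posz PoszD erefl) mulr_suml; apply: eq_bigr => P _.
  exact: deg_fibMn.
by move: mE; rewrite dE /n; clear; lia.
Qed.

Lemma gap_genus M : gap M -> has_genus C (M%:Z - 1).
Proof.
move=> gM; split=> [D l|]; first exact: gap_upper.
exists (fib dc (pole dc) *+ M), (M.+1 + 1)%N; split; first exact: gap_has_dim.
by rewrite deg_fibMn; clear; lia.
Qed.

End GenusOfDoubleCover.

Lemma genus_unique (k : closedFieldType) (C : curve k) g g' :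
  has_genus C g -> has_genus C g' -> g = g'.
Proof.
move=> [ub [D [l [hl gE]]]] [ub' [D' [l' [hl' gE']]]].
by have := ub _ _ hl'; have := ub' _ _ hl; rewrite gE gE'; lia.
Qed.

(** * Constructing double covers *)

Section QuadraticCover.
Variables (k : closedFieldType) (C : curve k).
Variables (x w T N : funfield C).
Hypothesis tx : transc x.
Hypothesis gT : gen x T.
Hypothesis gN : gen x N.
Hypothesis wE : w * w = T * w - N.
Hypothesis nw : ~ gen x w.
Hypothesis basis : forall f, exists a b, [/\ gen x a, gen x b & f = a + b * w].
Hypothesis sep : w + w <> T.

(** T - w is the other root of X^2 - T X + N, so a + b w -> a + b (T - w) respects products. [sep]
    makes it move w, and then only k(x) is fixed. *)
Lemma quadratic_cover : exists s : {rmorphism funfield C -> funfield C},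
  double_cover s x /\ s w = T - w.
Proof.
have uniq a b c d : gen x a -> gen x b -> gen x c -> gen x d ->
    a + b * w = c + d * w -> a = c /\ b = d.
  move=> ga gb gc gd e; have [bd|bd] := eqVneq b d.
    by split=> //; move: e; rewrite bd => /addIr.
  exfalso; apply: nw; have bd0 : b - d != 0 by rewrite subr_eq0.
  have -> : w = (c - a) / (b - d).
    apply: (canRL (mulfK bd0)); apply/eqP; rewrite -subr_eq0.
    have -> : w * (b - d) - (c - a) = (a + b * w) - (c + d * w) by ring.
    by rewrite e subrr.
  by apply: gen_div; apply: genB.
pose rel f g := exists a b, [/\ gen x a, gen x b, f = a + b * w & g = a + b * (T - w)].
have ex f : exists g, rel f g.
  by have [a [b [ga gb fE]]] := basis f; exists (a + b * (T - w)), a, b.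
have [s sP] := choice ex.
have sE a b : gen x a -> gen x b -> s (a + b * w) = a + b * (T - w).
  move=> ga gb; have [c [d [gc gd e ->]]] := sP (a + b * w).
  by have [-> ->] := uniq _ _ _ _ ga gb gc gd e.
have sB : zmod_morphism s.
  move=> f h; have [a [b [ga gb -> ->]]] := sP f; have [c [d [gc gd -> ->]]] := sP h.
  have -> : a + b * w - (c + d * w) = (a - c) + (b - d) * w by ring.
  by rewrite sE; [ring|exact: genB|exact: genB].
have sM : monoid_morphism s.
  split=> [|f h].
    have -> : 1 = 1 + 0 * w :> funfield C by rewrite mul0r addr0.
    by rewrite sE ?mul0r //; [exact: gen1|exact: gen0].
  have [a [b [ga gb -> ->]]] := sP f; have [c [d [gc gd -> ->]]] := sP h.
  have mulE v : v * v = T * v - N -> (a + b * v) * (c + d * v) =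
      (a * c - b * d * N) + (a * d + b * c + b * d * T) * v.
    move=> vE; have -> : (a + b * v) * (c + d * v) =
      a * c + (a * d + b * c) * v + b * d * (v * v) by ring.
    by rewrite vE; ring.
  have g1 : gen x (a * c - b * d * N).
    by apply: genB; [apply: genM|apply: genM gN; apply: genM].
  have g2 : gen x (a * d + b * c + b * d * T).
    apply: genD; last by apply: genM gT; apply: genM.
    by apply: genD; apply: genM.
  rewrite mulE // sE // mulE //.
  have -> : (T - w) * (T - w) = T * T - (T * w + T * w) + w * w by ring.
  by rewrite wE; ring.
pose sR : {rmorphism funfield C -> funfield C} :=
  HB.pack s (GRing.isZmodMorphism.Build _ _ s sB)
    (GRing.isMonoidMorphism.Build _ _ s sM).
have sg f : gen x f -> s f = f.
  by move=> gf; have := sE _ _ gf (gen0 x); rewrite !mul0r !addr0.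
have sw : s w = T - w.
  by have := sE _ _ (gen0 x) (gen1 x); rewrite !mul1r !add0r.
exists sR; split=> //; split=> //.
- split=> [f|c]; last exact/sg/gen_cst.
  change (s (s f) = f).
  have [a [b [ga gb fE ->]]] := sP f; rewrite fE.
  have -> : a + b * (T - w) = (a + b * T) + (- b) * w by ring.
  rewrite sE; [by ring| |exact: genN].
  by apply: genD => //; apply: genM.
- exists w; change (s w != w); rewrite sw; apply/eqP => e; apply: sep.
  by rewrite -{1}e subrK.
- move=> f; split=> [|/sg//]; change (s f = f -> gen x f).
  have [a [b [ga gb fE ->]]] := sP f; rewrite fE => e.
  have b0 : b * (T - (w + w)) = 0.
    have -> : b * (T - (w + w)) = a + b * (T - w) - (a + b * w) by ring.
    by rewrite e subrr.
  move/eqP: b0; rewrite mulf_eq0 subr_eq0 => /orP[/eqP->|/eqP/esym//].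
  by rewrite mul0r addr0.
Qed.

End QuadraticCover.

Lemma size_XsubX2 (k : closedFieldType) : size ('X - 'X^2 : {poly k}) = 3%N.
Proof. by rewrite addrC size_polyDl ?size_polyN ?size_polyXn ?size_polyX. Qed.

(** Composition with X - X^2 doubles degrees, so the two sides have degrees of opposite parity. *)
Lemma Xcomp_parity (k : closedFieldType) (p q : {poly k}) : q != 0 ->
  'X * (q \Po ('X - 'X^2)) <> p \Po ('X - 'X^2).
Proof.
have sz2 := size_XsubX2 k.
move=> q0 /(congr1 (fun p : {poly k} => (size p).-1)).
rewrite size_comp_poly sz2 mulrC size_mulX; last by rewrite comp_poly_eq0 ?sz2.
have := size_comp_poly q ('X - 'X^2); rewrite sz2 /=.
have : size (q \Po ('X - 'X^2)) != 0%N by rewrite size_poly_eq0 comp_poly_eq0 ?sz2.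
by case: (size _) => //= a _ -> /(congr1 odd) /=; rewrite !oddM !andbF.
Qed.

(* The cover of the line by itself given by z = u (1 - u), which is separable
   in every characteristic. *)
Section LineCover.
Variables (k : closedFieldType) (C : curve k) (u : funfield C).
Hypothesis tu : transc u.
Let z := u * (1 - u).

Lemma ev_line p : ev z p = ev u (p \Po ('X - 'X^2)).
Proof.
elim/poly_ind: p => [|p c IHp]; first by rewrite comp_poly0 !rmorph0.
rewrite comp_polyD comp_polyM comp_polyX comp_polyC.
rewrite 2!rmorphD 2!rmorphM /= -IHp !evX !evC rmorphB rmorphXn /= evX /z.
by ring.
Qed.

Lemma line_not_gen : ~ gen z u.
Proof.
move=> [p [q [q0 uE]]]; have qn : q != 0 by apply: contraNneq q0 => ->; rewrite rmorph0.
have : u * ev z q = ev z p by rewrite {1}uE divfK.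
rewrite !ev_line -{1}(evX u) -rmorphM => /(transc_inj tu).
exact: Xcomp_parity.
Qed.

Lemma line_transc : transc z.
Proof.
by move=> p; rewrite ev_line => /tu /eqP; rewrite comp_poly_eq0 ?size_XsubX2 // => /eqP.
Qed.

Lemma line_basis f : gen u f -> exists a b, [/\ gen z a, gen z b & f = a + b * u].
Proof.
have uu : u * u = u - z by rewrite /z; ring.
have pol p : exists a b, [/\ gen z a, gen z b & ev u p = a + b * u].
  elim/poly_ind: p => [|p c [a [b [ga gb pE]]]].
    by exists 0, 0; rewrite rmorph0 mul0r addr0; split=> //; apply: gen0.
  exists (cst C c - b * z), (a + b).
  rewrite rmorphD rmorphM /= evX evC pE; split; [| exact: genD|].
    by apply: genB; [exact: gen_cst|apply: genM (gen_x z)].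
  by rewrite mulrDl -mulrA uu; ring.
move=> [p [q [q0 ->]]]; have [a [b [ga gb ->]]] := pol p.
have [c [d [gc gd qE]]] := pol q; rewrite {}qE in q0 *.
(* This is the conjugate of c + d u under u -> 1 - u; n below is the norm, used to clear the
   denominator. *)
have conj0 : c + d - d * u != 0.
  apply: contra_notN line_not_gen => /eqP; have [d0|d0] := eqVneq d 0.
    by rewrite d0 mul0r subr0 addr0 => c0; move: q0; rewrite d0 c0 mul0r addr0 eqxx.
  move/eqP; rewrite subr_eq0 => /eqP e.
  have -> : u = (c + d) / d by rewrite e mulrAC divff // mul1r.
  by apply: gen_div (gd); apply: genD.
pose n := c * c + c * d + d * d * z.
have nE : n = (c + d * u) * (c + d - d * u) by rewrite /n /z; ring.
have n0 : n != 0 by rewrite nE mulf_neq0.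
have gn : gen z n.
  by apply: genD; [apply: genD; apply: genM|apply: genM (gen_x z); apply: genM].
exists ((a * (c + d) + b * d * z - b * d * 0) / n), ((b * c - a * d) / n); split.
- apply: gen_div (gn); apply: genB; last by rewrite mulr0; apply: gen0.
  apply: genD; first by apply: genM => //; apply: genD.
  by apply: genM (gen_x z); apply: genM.
- by apply: gen_div (gn); apply: genB; apply: genM.
- by rewrite mulr0 subr0 nE /z; field; rewrite conj0 q0.
Qed.

Lemma line_sep : u + u <> 1.
Proof.
move=> e; have := @tu ('X + 'X - 1%:P).
rewrite !(rmorphD, rmorphN) /= !evX evC rmorph1 e subrr => /(_ erefl).
move/(congr1 (fun p : {poly k} => p.[0])); rewrite !hornerE ?add0r => /eqP.
by rewrite oppr_eq0 oner_eq0.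
Qed.

Hypothesis gu : forall f, gen u f.

(** The genus formula applies to double covers, so the line is made one over the coordinate z. The
    gap is 1, since u has trace 1 and norm z. *)
Lemma rational_genus : has_genus C 0.
Proof.
have gN : gen z z by apply: gen_x.
have wE : u * u = 1 * u - z by rewrite /z; ring.
have [s [dc su]] := quadratic_cover line_transc (gen1 z) gN wE line_not_gen
  (fun f => line_basis (gu f)) line_sep.
have gap1 : gap dc 1.
  split=> [|n f]; last first.
    by rewrite ltnS leqn0 => /eqP-> /Lsp_0_cst[c ->]; apply: gen_cst.
  exists u; split; last exact: line_not_gen.
  apply/Lsp_tr_nm; split.
    by exists 1; rewrite size_poly1 rmorph1 su addrC subrK.
  by exists 'X; rewrite size_polyX evX su.
by have := gap_genus gap1; rewrite subrr.
Qed.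

End LineCover.

(** * The canonical involution *)

Section Rigidity.
Variables (k : closedFieldType) (C : curve k).
Variables (s : {rmorphism funfield C -> funfield C}) (x : funfield C).
Hypothesis dc : double_cover s x.
Implicit Types (P Q R : point C) (f h : funfield C) (p q r : {poly k}).

Let sI := double_cover_inv dc.
Let tx : transc x. Proof. by case: dc. Qed.
Let fixE f : s f = f <-> gen x f. Proof. by case: dc. Qed.

Lemma over_nonpole P a : vge P 1 (x - cst C a) -> 0 <= ord P x.
Proof.
move=> Pa; rewrite leNgt; apply/negP => Px; move: Pa.
have t0 : x - cst C a != 0 by rewrite -evXsubC transc_eq0 // polyXsubC_eq0.
by rewrite vgeE // (ord_x_sub dc) //; lia.
Qed.

Lemma Lsp_regular n f P a : Lsp dc n f -> vge P 1 (x - cst C a) -> vge P 0 f.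
Proof.
by move=> nf /over_nonpole Px; have := nf P; rewrite (x_nonpole dc Px) mulr0 oppr0.
Qed.

(** Otherwise the norm of a multiple of h would be a nonzero polynomial in x vanishing at every
    a. *)
Lemma many_zeros h :
  (forall a, exists P, vge P 1 (x - cst C a) /\ vge P 1 h) -> h = 0.
Proof.
move=> hz; apply/eqP/negPn/negP => h0.
have [n [d [d0 nh]]] := integral_multiple dc h.
have /Lsp_tr_nm[_ [r [_ rE]]] := nh.
have r0 : r != 0.
  by rewrite -(transc_eq0 _ tx) -rE mulf_neq0 ?fmorph_eq0 // mulf_neq0 ?transc_eq0.
have [a ra] := closed_nonrootP r r0; have [P [Pa Ph]] := hz a.
have [rn ro] := ord_ev_unit Pa ra.
have : vge P 1 (ev x r).
  rewrite -rE mulrC; apply: vgeMl.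
    by apply: (Lsp_regular _ Pa); apply: Lsp_s nh.
  by apply: vgeMl Ph; apply: vge_ev; apply: vge_ord; apply: over_nonpole Pa.
by rewrite vgeE // ro.
Qed.

(* [alpha f] and [f] have the same value at every point where [f] is regular. *)
Lemma local_endo_id (alpha : {rmorphism funfield C -> funfield C}) :
  (forall c, alpha (cst C c) = cst C c) ->
  (forall P f, vge P 0 f -> vge P 0 (alpha f)) -> forall f, alpha f = f.
Proof.
move=> ac av.
(* If [alpha] f had residue c != 0, then f - c would be a unit at P whose image vanishes, although
   its inverse stays regular. *)
have a1 P f : vge P 1 f -> vge P 1 (alpha f).
  move=> f1; apply/negPn/negP => nf.
  have f0 : vge P 0 f by apply: vge_le f1.
  have [c fc] := residues dc (av P f f0).
  have c0 : c != 0 by apply: contraNneq nf => c0; move: fc; rewrite c0 rmorph0 subr0.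
  have cc0 : - cst C c != 0 by rewrite oppr_eq0 fmorph_eq0.
  have [|d0 dn] := dominant cc0 _ f1; first by rewrite ord_N ord_cst.
  rewrite ord_N ord_cst in dn.
  have : vge P 0 (- cst C c + f)^-1 by apply: vge_ord; rewrite ord_V dn.
  move/av; rewrite fmorphV rmorphD rmorphN ac => vv.
  have an : - cst C c + alpha f != 0.
    by rewrite -ac -rmorphN -rmorphD fmorph_eq0.
  move: fc vv; rewrite addrC !vgeE ?invr_eq0 // ord_V oppr_ge0 => ge1 le0.
  by have := le_trans ge1 le0.
have same f : (forall P a, vge P 1 (x - cst C a) -> vge P 0 f) -> alpha f = f.
  move=> reg; apply/eqP; rewrite -subr_eq0; apply/eqP/many_zeros => a.
  have [P Pa] := point_over dc a; exists P; split=> //.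
  have [b fb] := residues dc (reg P a Pa).
  have -> : alpha f - f = alpha (f - cst C b) - (f - cst C b).
    by rewrite rmorphB ac; ring.
  by apply: vgeB => //; apply: a1.
have ax : alpha x = x.
  by apply: same => P a /over_nonpole; apply: vge_ord.
move=> f; have [n [d [d0 nf]]] := integral_multiple dc f.
have := same _ (fun P a => Lsp_regular nf (P := P) (a := a)).
by rewrite rmorphM (ev_morph _ _ ac) ax => /mulfI-> //; rewrite transc_eq0.
Qed.

(** Multiplication by functions of divisor fib Q1 - X and fib Q2 - X carries f into L(2X), which
    lies in k(x) because M > 2. *)
Lemma few_poles_gen M f Q1 Q2 : gap dc M -> (2 < M)%N ->
  (forall P, vge P (- ((Q1 == P)%:Z + (Q2 == P)%:Z)) f) -> gen x f.
Proof.
move=> [_ lowM] M2 fP.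
have [u1 [u10 gu1 _ o1]] := fib_fun dc Q1; have [u2 [u20 gu2 _ o2]] := fib_fun dc Q2.
have : Lsp dc 2 (f * (u1 * u2)).
  move=> P; have uP : vge P (ord P (u1 * u2)) (u1 * u2) by apply: vge_ord.
  apply: vge_le (vgeM (fP P) uP); rewrite ordM // o1 o2 /mult2.
  by clear; lia.
move=> /(lowM _ _ M2) g.
by rewrite -[f](mulfK (mulf_neq0 u10 u20)); apply: gen_div => //; apply: genM.
Qed.

Lemma even_ramified P f : conj_pt sI P = P -> gen x f -> (2 %| ord P f)%Z.
Proof.
move=> cP gf; have [->|f0] := eqVneq f 0; first by rewrite Defs.ord0 dvdz0.
have [Px|Px] := ltP (ord P x) 0.
  have Pt : vge P 1 (x^-1 - cst C 0).
    have x0 : x != 0 by apply: contraTneq Px => ->; rewrite Defs.ord0.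
    by rewrite rmorph0 subr0 vgeE ?invr_eq0 // ord_V; lia.
  have gf' : gen x^-1 f by apply: gen_sub gf; rewrite -[X in gen _ X]invrK; apply/genV/gen_x.
  have [n ->] := ord_gen (double_coverV dc) 0 gf' f0; last exact: Pt.
  rewrite (ord_over (double_coverV dc) Pt); last by apply: vge_le Pt.
  rewrite eqxx (_ : conj_pt _ P = P) ?eqxx ?dvdz_mull //.
  by rewrite -[RHS]cP; apply: point_eq => h; rewrite !ord_conj.
have [a Pa] := over_some_point dc (vge_ord Px).
have [n ->] := ord_gen dc a gf f0; last exact: Pa.
rewrite (ord_over dc Pa); last by apply: vge_le Pa.
by rewrite eqxx cP eqxx dvdz_mull.
Qed.

Lemma regularE f P : regular_at f P <-> vge P 0 f.
Proof.
split=> [h|]; first exact: vge_ord.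
by move=> /orP[/eqP->|//]; rewrite /regular_at Defs.ord0.
Qed.

(** [order_two] speaks of points only. The square of the pullback preserves the ring at each point,
    so it is the identity by [local_endo_id]. *)
Lemma order_two_kinv (phi : morphism C C) : order_two phi ->
  exists phiI : kinvolution (pullback phi), forall P, phi P = conj_pt phiI P.
Proof.
move=> [phi2 _].
have reg P f : vge (phi P) 0 f -> vge P 0 (pullback phi f).
  by move=> /regularE h; apply/regularE; apply: pullback_regular.
have phiI : kinvolution (pullback phi).
  split=> [f|c]; last exact: pullback_cst.
  apply: (@local_endo_id (pullback phi \o pullback phi)) => [c|P h vh] /=.
    by rewrite !pullback_cst.
  by do 2 apply: (reg); rewrite phi2.
exists phiI => P; apply: ring_eq => f; rewrite vge_conj; exact: reg.
Qed.

Lemma order_two_nontrivial (phi : morphism C C) : order_two phi ->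
  exists f, pullback phi f != f.
Proof.
move=> phi2; apply: contrapT => triv; case: (proj2 phi2) => P.
have [phiI ->] := order_two_kinv phi2; apply: point_eq => f; rewrite ord_conj.
by congr ord; apply/eqP/negPn/negP => nf; apply: triv; exists f.
Qed.

(** The exceptional values of x are encoded as roots of a polynomial, so that finitely many such
    conditions are met by avoiding the roots of a product. *)
Lemma avoid_point P : exists r, r != 0 /\
  forall a, ~~ root r a -> forall Q, vge Q 1 (x - cst C a) -> Q <> P.
Proof.
have [Px|Px] := ltP (ord P x) 0.
  exists 1; split=> [|a _ Q /over_nonpole Qx QP]; first exact: oner_neq0.
  by move: Qx Px; rewrite QP; lia.
have [b Pb] := over_some_point dc (vge_ord Px).
exists ('X - b%:P); split=> [|a]; first by rewrite polyXsubC_eq0.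
rewrite root_XsubC => ab Q Qa QP; rewrite QP in Qa.
by case/eqP: ab; apply: vge1_unique Qa Pb.
Qed.

(** Take Q avoiding P and delta P. As P + delta P and Q + delta Q belong to one series, some g has
    divisor Q + delta Q - P - delta P. Having at most two poles, g lies in k(x), so its polar set is
    stable under s and contains the conjugate of P. *)
Lemma canonical_conj M (delta : morphism C C) : gap dc M -> (2 < M)%N ->
  canonical_involution delta -> forall P, delta P = conj_pt sI P.
Proof.
move=> gM M2 [delta2 [S [D [V [_ _ _ SE]]] Sd]] P.
have fdiv R : exists f, f != 0 /\ forall R',
    coeff R' (<< R >> + << delta R >>) = coeff R' D + ord R' f.
  by have /SE[f [_ f0 fE]] := Sd R; exists f.
have [r1 [r10 r1P]] := avoid_point P; have [r2 [r20 r2P]] := avoid_point (delta P).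
have [a] := closed_nonrootP _ (mulf_neq0 r10 r20).
rewrite rootM negb_or => /andP[ra1 ra2]; have [Q Qa] := point_over dc a.
have QP := r1P a ra1 Q Qa; have QdP := r2P a ra2 Q Qa.
have dQP : delta Q <> P by move=> e; apply: QdP; rewrite -e (proj1 delta2).
have dQdP : delta Q <> delta P.
  by move=> e; apply: QP; rewrite -(proj1 delta2 Q) e (proj1 delta2).
have [f [f0 fE]] := fdiv P; have [h [h0 hE]] := fdiv Q.
pose g := h / f; have g0 : g != 0 by rewrite mulf_neq0 ?invr_eq0.
have gE R : ord R g = (Q == R)%:Z + (delta Q == R)%:Z
    - ((P == R)%:Z + (delta P == R)%:Z).
  have := fE R; have := hE R; rewrite !coeffD !coeffU !mul1r !natz ord_div //.
  by move=> -> ->; ring.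
have gg : gen x g.
  apply: (@few_poles_gen M g P (delta P)) => // R; rewrite vgeE // gE.
  by clear; lia.
have gP : ord P g = - (1 + (delta P == P)%:Z).
  by rewrite gE (introF eqP QP) (introF eqP dQP) eqxx; clear; lia.
have : ord (conj_pt sI P) g < 0.
  by rewrite ord_conj_fix ?gP; [clear; lia|apply/fixE].
rewrite gE => lt0.
(* The pole at the conjugate of P is delta P or P. If it were P alone, g would have a simple pole at
   a ramification point, where orders are even. *)
have [e|ne1] := eqVneq (delta P) (conj_pt sI P); first by [].
have [e|ne2] := eqVneq P (conj_pt sI P); last first.
  by move: lt0; rewrite (negPf ne1) (negPf ne2); clear; lia.
have := even_ramified (esym e) gg; rewrite gP.
by have -> : (delta P == P) = false by apply: negbTE; rewrite {2}e.
Qed.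

Lemma canonical_pullback M (delta : morphism C C) : gap dc M -> (2 < M)%N ->
  canonical_involution delta -> forall f, pullback delta f = s f.
Proof.
move=> gM M2 cd f; have dE := canonical_conj gM M2 cd.
have [dI dE'] := order_two_kinv (proj1 cd).
have sdE : forall f, s (pullback delta f) = f.
  move=> h; apply: (@local_endo_id (s \o pullback delta)) => [c|P h' vh'] /=.
    by rewrite pullback_cst (proj2 sI).
  by rewrite -(vge_conj sI) -dE -(vge_conj dI) -dE' (proj1 (proj1 cd)).
by rewrite -[LHS](proj1 sI) sdE.
Qed.

End Rigidity.

Lemma closed_sqrt (k : closedFieldType) (c : k) : exists a, a ^+ 2 = c.
Proof.
have [a aE] := @solve_monicpoly k 2 (fun i => if i == 0 then c else 0) isT.
exists a; rewrite aE !big_ord_recl big_ord0 /=.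
by rewrite expr0 mulr1 mul0r !addr0.
Qed.

(* In characteristic 2 every polynomial over a perfect field has this form,
   so adjoining any inseparable square root to k(x) adjoins that of x. *)
Lemma char2_split (k : closedFieldType) (p : {poly k}) : (2 : k) = 0 ->
  exists a b : {poly k}, p = a ^+ 2 + 'X * b ^+ 2.
Proof.
move=> two0; elim/poly_ind: p => [|p c [a [b ->]]].
  by exists 0, 0; rewrite !expr0n mulr0 addr0.
have [d dE] := closed_sqrt c; exists ('X * b + d%:P), a.
have two0' : (2 : {poly k}) = 0 by rewrite -(rmorph_nat polyC) two0.
rewrite -dE rmorphXn /=.
have -> : ('X * b + d%:P) ^+ 2 =
  'X ^+ 2 * b ^+ 2 + d%:P ^+ 2 + 2 * ('X * b * d%:P) by ring.
by rewrite two0' mul0r addr0; ring.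
Qed.

Section DegreeTwo.
Variables (k : closedFieldType) (C : curve k) (x w T N : funfield C).
Hypothesis tx : transc x.
Hypothesis gT : gen x T.
Hypothesis gN : gen x N.
Hypothesis wE : w * w = T * w - N.
Hypothesis nw : ~ gen x w.
Hypothesis basis : forall f, exists a b, [/\ gen x a, gen x b & f = a + b * w].

(** In characteristic 2, w^2 = p / q and p q = a^2 + x b^2 give (q w + a)^2 = x b^2. So u = (q w +
    a) / b is a square root of x, and C has function field k(u). *)
Lemma inseparable_rational : w + w = T -> has_genus C 0.
Proof.
move=> wT.
have two0 : (2 : k) = 0.
  apply/eqP/negPn/negP => two0; apply: nw.
  have two0' : (2 : funfield C) != 0 by rewrite -(rmorph_nat (cst C)) fmorph_eq0.
  have -> : w = T / cst C 2 by rewrite -wT rmorph_nat; field.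
  exact: gen_div (gen_cst _ _).
have twoK : (2 : funfield C) = 0 by rewrite -(rmorph_nat (cst C)) two0 rmorph0.
have addff (f : funfield C) : f + f = 0 by rewrite -mulr2n -mulr_natr twoK mulr0.
have wN : w * w = - N by rewrite wE -wT addff mul0r sub0r.
have [p [q [q0 NE]]] := genN gN.
have [a [b pqE]] := char2_split (p * q) two0.
have sq : (ev x q * w + ev x a) ^+ 2 = x * ev x b ^+ 2.
  have -> : (ev x q * w + ev x a) ^+ 2 =
    ev x q ^+ 2 * (w * w) + ev x a ^+ 2 + 2 * (ev x q * w * ev x a) by ring.
  have e : ev x p * ev x q = ev x a ^+ 2 + x * ev x b ^+ 2.
    by rewrite -rmorphM pqE rmorphD rmorphM !rmorphXn /= evX.
  rewrite twoK mul0r addr0 wN NE.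
  have -> : ev x q ^+ 2 * (ev x p / ev x q) = ev x p * ev x q by field.
  by rewrite e addrAC addff add0r.
have b0 : ev x b != 0.
  apply: contra_notN nw => /eqP b0; move: sq; rewrite b0 expr0n mulr0 => /eqP.
  rewrite expf_eq0 /= addr_eq0 => /eqP e.
  have -> : w = - ev x a / ev x q by rewrite -e mulrAC divff // mul1r.
  by apply: gen_div; [apply/genN|]; apply: gen_ev.
pose u := (ev x q * w + ev x a) / ev x b.
have uu : u ^+ 2 = x by rewrite /u expr_div_n sq mulfK // expf_neq0.
have gx : gen u x by rewrite -uu; apply/genX/gen_x.
have gw : gen u w.
  have -> : w = (u * ev x b - ev x a) / ev x q.
    by rewrite /u divfK // addrK mulrAC divff // mul1r.
  have ge p' : gen u (ev x p') by apply: gen_sub_ev.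
  by apply: gen_div => //; apply: genB => //; apply: genM => //; apply: gen_x.
apply: (@rational_genus _ _ u); first exact: transc_gen tx gx.
move=> f; have [c [d [gc gd ->]]] := basis f.
by apply: genD; [apply: gen_sub gc|apply: genM gw; apply: gen_sub gd].
Qed.

End DegreeTwo.

(** A degree two map without Galois involution is inseparable, and then C is rational; the genus
    hypothesis excludes this. *)
Lemma degree_two_cover (k : closedFieldType) (C : curve k)
    (phi : morphism C (P1 k)) : has_degree phi 2 -> ~ has_genus C 0 ->
  exists (s : {rmorphism funfield C -> funfield C}) x, double_cover s x.
Proof.
move=> [e [ie se]] ng0; pose x := pullback phi (tofrac 'X).
have evE p : ev x p = pullback phi (tofrac p).
  by rewrite -(ev_morph _ _ (pullback_cst phi)) ev_P1.
have tx : transc x.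
  by move=> p /eqP; rewrite evE fmorph_eq0 tofrac_eq0 => /eqP.
have gx (c : funfield (P1 k)) : gen x (pullback phi c).
  have [p [q [q0 ->]]] := frac_decomp c.
  by exists p, q; rewrite transc_eq0 // fmorph_div /= !evE.
have xg f : gen x f -> exists c, f = pullback phi c.
  by move=> [p [q [q0 ->]]]; exists (tofrac p / tofrac q); rewrite fmorph_div /= !evE.
pose i0 : 'I_2 := ord0; pose i1 : 'I_2 := ord_max.
have bas f : exists a b, [/\ gen x a, gen x b & f = a * e i0 + b * e i1].
  have [c ->] := (se f).1 I; exists (pullback phi (c i0)), (pullback phi (c i1)).
  split=> //; rewrite !big_ord_recl big_ord0 addr0.
  by rewrite (_ : fintype.lift ord0 ord0 = i1) //; apply: val_inj.
have ind a b : gen x a -> gen x b -> a * e i0 + b * e i1 = 0 -> a = 0 /\ b = 0.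
  move=> /xg[a' ->] /xg[b' ->] ab.
  pose c (i : 'I_2) := if i == i0 then a' else b'.
  have c0 : \sum_(i < 2) pullback phi (c i) * e i = 0.
    rewrite !big_ord_recl big_ord0 addr0 -ab /c /=; congr (_ + _ * e _).
    exact: val_inj.
  by have := ie c c0 i0; have := ie c c0 i1; rewrite /c /= => -> ->; rewrite rmorph0.
have [w nw] : exists w, ~ gen x w.
  apply: contrapT => /forallNP all; have g f : gen x f by apply: contrapT => /all.
  have [|||e10 /eqP] := ind (e i1) (- e i0); [exact: g|exact: g|by ring|].
  rewrite oppr_eq0 => /eqP e00.
  have [|||/eqP] := ind 1 0; [exact: g|exact: g|by rewrite e00 e10 !mulr0 addr0|].
  by rewrite oner_eq0.
have [al [be [gal gbe oneE]]] := bas 1.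
have [ga [de [gga gde wE]]] := bas w.
(* If 1 and w were dependent over k(x), w would lie in k(x). *)
have det0 : al * de - be * ga != 0.
  apply/eqP => det0.
  have [al0|al0] := eqVneq al 0; last first.
    apply: nw; have -> : w = ga / al; last exact: gen_div.
    have : al * w - ga * 1 = 0.
      rewrite wE {1}oneE.
      have -> : al * (ga * e i0 + de * e i1) - ga * (al * e i0 + be * e i1) =
        (al * de - be * ga) * e i1 by ring.
      by rewrite det0 mul0r.
    by rewrite mulr1 => /eqP; rewrite subr_eq0 => /eqP <-; rewrite mulrAC divff // mul1r.
  have [be0|be0] := eqVneq be 0.
    by move/eqP: oneE; rewrite al0 be0 !mul0r addr0 oner_eq0.
  apply: nw; have -> : w = de / be; last exact: gen_div.
  have : be * w - de * 1 = 0.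
    rewrite wE {1}oneE.
    have -> : be * (ga * e i0 + de * e i1) - de * (al * e i0 + be * e i1) =
      - (al * de - be * ga) * e i0 by ring.
    by rewrite det0 oppr0 mul0r.
  by rewrite mulr1 => /eqP; rewrite subr_eq0 => /eqP <-; rewrite mulrAC divff // mul1r.
have gdet : gen x (al * de - be * ga) by apply: genB; apply: genM.
have basw f : exists a b, [/\ gen x a, gen x b & f = a + b * w].
  have [a [b [ga' gb fE]]] := bas f.
  exists ((a * de - b * ga) / (al * de - be * ga)), ((b * al - a * be) / (al * de - be * ga)).
  split; [by apply: gen_div => //; apply: genB; apply: genM..|].
  rewrite -[X in X + _]mulr1 {1}oneE {1}wE fE.
  by field.
have [N' [T [gN' gT wwE]]] := basw (w * w).
have wwE' : w * w = T * w - (- N') by rewrite opprK wwE addrC.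
have [wT|wT] := pselect (w + w = T).
  by case: ng0; apply: (inseparable_rational tx gT (genN gN') wwE' nw basw wT).
by have [s [dc _]] := quadratic_cover tx gT (genN gN') wwE' nw basw wT; exists s, x.
Qed.

(** * Involutions commuting with the canonical one *)

Section Normalization.
Variables (k : closedFieldType) (C : curve k).
Variables (delta sigma : {rmorphism funfield C -> funfield C}) (x : funfield C).
Variable M : nat.
Hypothesis dc : double_cover delta x.
Hypothesis gM : gap dc M.
Hypothesis M2 : (2 < M)%N.
Hypothesis sI : kinvolution sigma.
Hypothesis snt : exists f, sigma f != f.
Hypothesis snd : exists f, sigma f != delta f.
Implicit Types (P Q : point C) (f : funfield C) (p : {poly k}).

Let dI := double_cover_inv dc.
Let tx : transc x. Proof. by case: dc. Qed.
Let fixE f : delta f = f <-> gen x f. Proof. by case: dc. Qed.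

(* [alpha w] is a root of (X - w)(X - delta w). *)
Lemma quad_conj (alpha : {rmorphism funfield C -> funfield C}) :
  (forall f, gen x f -> alpha f = f) ->
  (forall f, alpha f = f) \/ (forall f, alpha f = delta f).
Proof.
move=> ag; have [_ [w dw] _ _] := dc.
have bas f : exists a b, [/\ gen x a, gen x b & f = a + b * w].
  have d0 : w - delta w != 0 by rewrite subr_eq0 eq_sym.
  have gb : gen x ((f - delta f) / (w - delta w)).
    apply/fixE; rewrite fmorph_div !rmorphB /= !(proj1 dI).
    by rewrite -(opprB f) -(opprB w) invrN mulrNN.
  exists (f - (f - delta f) / (w - delta w) * w), ((f - delta f) / (w - delta w)).
  split=> //; last by rewrite subrK.
  apply/fixE; rewrite rmorphB rmorphM /= (proj2 (fixE _) gb).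
  by field.
have : (alpha w - w) * (alpha w - delta w) = 0.
  have tE := ag _ (tr_gen dc w); have nE := ag _ (nm_gen dc w).
  rewrite rmorphD /= in tE; rewrite rmorphM /= in nE.
  have -> : (alpha w - w) * (alpha w - delta w) =
    alpha w * (alpha w - (w + delta w)) + w * delta w by ring.
  by rewrite -tE -nE; ring.
move/eqP; rewrite mulf_eq0 !subr_eq0 => /orP[/eqP aw|/eqP aw]; [left|right] => f;
  have [a [b [ga gb ->]]] := bas f.
  by rewrite rmorphD rmorphM /= aw !ag.
by rewrite !rmorphD !rmorphM /= aw !ag // (proj2 (fixE _) ga) (proj2 (fixE _) gb).
Qed.

Lemma sigma_x_poles P : vge P (- ((conj_pt sI (pole dc) == P)%:Z
  + (conj_pt sI (conj_pt dI (pole dc)) == P)%:Z)) (sigma x).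
Proof.
have cK := conj_ptK sI.
have := Lsp_x dc (conj_pt sI P); rewrite vge_conj mul1r /xpole /mult2.
by rewrite -(can_eq cK (conj_pt sI (pole dc))) -(can_eq cK (conj_pt sI (conj_pt dI _))) !cK.
Qed.

Lemma sigma_gen_x : gen x (sigma x).
Proof. exact: few_poles_gen gM M2 sigma_x_poles. Qed.

Lemma sigma_gen f : gen x f -> gen x (sigma f).
Proof.
by move=> gf; apply: gen_sub sigma_gen_x _; apply: gen_morph gf; case: sI.
Qed.

(** sigma delta sigma fixes k(x), hence is the identity or delta; the former would make delta
    trivial. *)
Lemma sigma_delta f : sigma (delta f) = delta (sigma f).
Proof.
have [h gh /=|id|conj] := @quad_conj (sigma \o delta \o sigma).
- by rewrite (proj2 (fixE _) (sigma_gen gh)) (proj1 sI).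
- have [_ [w nw] _ _] := dc; case/negP: nw; apply/eqP.
  by have := id (sigma w); rewrite /= (proj1 sI) => /(congr1 sigma); rewrite !(proj1 sI).
- by have := conj (sigma f); rewrite /= (proj1 sI).
Qed.

Lemma sigma_x_neq : sigma x != x.
Proof.
apply/eqP => sx; have [h gh|id|cj] := @quad_conj sigma.
- have [p [q [_ ->]]] := gh.
  by rewrite fmorph_div /= !(ev_morph _ _ (proj2 sI)) sx.
- by have [f] := snt; rewrite id eqxx.
- by have [f] := snd; rewrite cj eqxx.
Qed.

Lemma ev_size2 p : (size p <= 2)%N -> exists a b, ev x p = cst C a * x + cst C b.
Proof.
move=> sp; exists p`_1, p`_0; have -> : p = p`_1 *: 'X + (p`_0)%:P.
  apply/polyP => i; rewrite coefD coefZ coefX coefC.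
  case: i => [|[|i]] /=; rewrite ?mulr0n ?mulr1n ?mulr0 ?mulr1 ?add0r ?addr0 //.
  by rewrite nth_default // (leq_trans sp).
by rewrite rmorphD /= evZ evX evC !coefD !coefZ !coefX !coefC /= !mulr0 !mulr1 add0r addr0.
Qed.

(** As sigma and delta commute, the poles of sigma x form a whole fibre. A polynomial u of degree <=
    1 clears them, and u * sigma x lies in L(X), hence has degree <= 1 too. *)
Lemma sigma_moebius : exists a b c d : k, (c != 0) || (d != 0) /\
  (cst C c * x + cst C d) * sigma x = cst C a * x + cst C b.
Proof.
have cc : conj_pt dI (conj_pt sI (pole dc)) = conj_pt sI (conj_pt dI (pole dc)).
  by apply: point_eq => f; rewrite !ord_conj sigma_delta.
have [u [u0 gu [p [uE sp]] uo]] := fib_fun dc (conj_pt sI (pole dc)).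
have : Lsp dc 1 (u * sigma x).
  move=> P; have uP : vge P (ord P u) u by apply: vge_ord.
  apply: vge_le (vgeM uP (sigma_x_poles P)); rewrite uo /mult2 -/dI cc.
  by clear; lia.
move=> /Lsp_gen/(_ (genM gu sigma_gen_x)) [q [sq qE]].
have [c [d pE]] := ev_size2 sp; have [a [b qE']] := ev_size2 sq.
exists a, b, c, d; rewrite -pE -qE' -uE qE; split=> //.
apply: contraNT u0; rewrite negb_or !negbK uE pE => /andP[/eqP-> /eqP->].
by rewrite rmorph0 mul0r addr0.
Qed.

(* A fixed point of the induced involution of the line is sent to infinity. *)
Lemma normal_form : exists t, [/\ gen x t, gen t x & sigma t = 1 - t].
Proof.
have [a [b [c [d [cd0 yE]]]]] := sigma_moebius.
have sc e : sigma (cst C e) = cst C e by case: sI.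
have yx0 : sigma x - x != 0 by rewrite subr_eq0 sigma_x_neq.
(* A Moebius involution other than the identity has trace zero. *)
have dE : d = - a.
  apply/eqP; rewrite -addr_eq0 -(fmorph_eq0 (cst C)); apply/eqP/(mulIf yx0).
  have := congr1 sigma yE; rewrite !(rmorphM, rmorphD) /= !sc (proj1 sI) => yE'.
  rewrite mul0r; transitivity ((cst C c * x + cst C d) * sigma x
    - (cst C c * sigma x + cst C d) * x - cst C a * x + cst C a * sigma x).
    by ring.
  by rewrite yE yE'; ring.
move: yE; rewrite {}dE rmorphN in cd0 * => yE.
have [c0|c0] := eqVneq c 0.
  have a0 : a != 0 by move: cd0; rewrite c0 eqxx oppr_eq0.
  have ca0 : cst C a != 0 by rewrite fmorph_eq0.
  pose be := - b / a.
  have sx : sigma x = cst C be - x.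
    apply: (mulfI ca0); rewrite /be fmorph_div rmorphN.
    move: yE; rewrite c0 rmorph0 mul0r add0r => yE.
    have -> : cst C a * sigma x = - (- cst C a * sigma x) by ring.
    by rewrite yE; field.
  (* If be = 0 then sigma x = - x differs from x, so 2 is invertible and x + 1/2 serves; otherwise x
     is rescaled by be. *)
  have [be0|be0] := eqVneq be 0.
    have two0 : (2 : funfield C) != 0.
      apply: contraNneq yx0 => two0; rewrite sx be0 rmorph0 sub0r -opprD.
      by rewrite -mulr2n -mulr_natr two0 mulr0 oppr0.
    have two0' : (2 : k) != 0 by rewrite -(fmorph_eq0 (cst C)) rmorph_nat.
    exists (x + cst C 2^-1); split.
    - by apply: genD (gen_cst _ _); apply: gen_x.
    - rewrite -[X in gen _ X](addrK (cst C 2^-1)).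
      by apply: genB (gen_cst _ _); apply: gen_x.
    - rewrite rmorphD /= sc sx be0 rmorph0 fmorphV rmorph_nat.
      by field.
  have cb0 : cst C be != 0 by rewrite fmorph_eq0.
  exists (x / cst C be); split.
  - by apply: gen_div (gen_cst _ _); apply: gen_x.
  - rewrite -[X in gen _ X](divfK cb0).
    by apply: genM (gen_cst _ _); apply: gen_x.
  - by rewrite fmorph_div /= sc sx mulrBl divff.
have cc0 : cst C c != 0 by rewrite fmorph_eq0.
(* [la] is a fixed point, a root of c X^2 - 2 a X - b. Completing the square divides by c only, so
   characteristic 2 is covered. *)
have [la0 laE0] := closed_sqrt ((a / c) ^+ 2 + b / c).
pose la := la0 + a / c.
have laE : c * la ^+ 2 - (a + a) * la - b = 0.
  have -> : c * la ^+ 2 - (a + a) * la - b =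
    c * (la0 ^+ 2 - ((a / c) ^+ 2 + b / c)) by rewrite /la; field.
  by rewrite laE0 subrr mulr0.
have xl0 : x - cst C la != 0 by rewrite -evXsubC transc_eq0 // polyXsubC_eq0.
have cxa : cst C c * x - cst C a != 0.
  have -> : cst C c * x - cst C a = cst C c * (x - cst C (a / c)).
    by rewrite fmorph_div; field.
  by rewrite mulf_neq0 // -evXsubC transc_eq0 // polyXsubC_eq0.
pose m := a - c * la.
have yl : (cst C c * x - cst C a) * (sigma x - cst C la) = cst C m * (x - cst C la).
  have bE : b = c * la ^+ 2 - (a + a) * la by apply/eqP; rewrite eq_sym -subr_eq0 laE.
  rewrite mulrBr yE bE /m !(rmorphB, rmorphM, rmorphD, rmorphXn) /=.
  by ring.
have m0 : m != 0.
  apply/eqP => m0; move/eqP: yl; rewrite m0 rmorph0 mul0r mulf_eq0 (negPf cxa) /=.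
  rewrite subr_eq0 => /eqP yl; have := congr1 sigma yl; rewrite sc (proj1 sI).
  exact: transc_not_cst.
have cm0 : cst C m != 0 by rewrite fmorph_eq0.
have yl0 : sigma x - cst C la != 0.
  by apply: contraNneq xl0 => yl0; move/eqP: yl; rewrite yl0 mulr0 eq_sym mulf_eq0 (negPf cm0).
(* In the coordinate v = 1 / (x - la) the involution is v -> c / m - v; the factor m / c normalizes
   it. *)
pose t := cst C (m / c) / (x - cst C la).
have cmc0 : cst C (m / c) != 0 by rewrite fmorph_eq0 mulf_neq0 ?invr_eq0.
exists t; split.
- by apply: gen_div (gen_cst _ _) _; apply: genB (gen_cst _ _); apply: gen_x.
- have xE : x = cst C (m / c) / t + cst C la.
    by rewrite /t invf_div mulrCA divff // mulr1 subrK.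
  rewrite [X in gen _ X]xE.
  by apply: genD (gen_cst _ _); apply: gen_div (gen_cst _ _) _; apply: gen_x.
- rewrite /t fmorph_div rmorphB /= !sc.
  have -> : sigma x - cst C la =
      cst C m * (x - cst C la) / (cst C c * x - cst C a).
    by rewrite -yl mulrAC divff // mul1r.
  rewrite fmorph_div /m rmorphB rmorphM /=.
  have cm0' : cst C a - cst C c * cst C la != 0 by rewrite -rmorphM -rmorphB.
  by field; rewrite cc0 xl0 cxa cm0'.
Qed.

End Normalization.

(** * Comparing the two gaps *)

Section Flip.
Variable k : closedFieldType.
Implicit Types p q A B : {poly k}.

Lemma size_1subX : size (1 - 'X : {poly k}) = 2%N.
Proof. by rewrite -opprB size_polyN -polyC1 size_XsubC. Qed.

Lemma size_flip p : size (p \Po (1 - 'X)) = size p.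
Proof. by rewrite size_comp_poly2 // size_1subX. Qed.

(** Substituting 1 - X multiplies the coefficient of degree n by (-1)^n. *)
Lemma coef_flip p n : (size p <= n.+1)%N -> ~~ odd n ->
  (p \Po (1 - 'X))`_n = p`_n.
Proof.
move=> szp nn; have [lt|ge] := ltnP (size p) n.+1.
  by rewrite !nth_default ?size_flip.
have sp : size p = n.+1 by apply/eqP; rewrite eqn_leq szp ge.
have lc : lead_coef (1 - 'X : {poly k}) = -1.
  by rewrite -opprB lead_coefN -polyC1 lead_coefXsubC.
have := @lead_coef_comp _ p (1 - 'X); rewrite size_1subX => /(_ isT).
by rewrite lc !lead_coefE size_flip sp /= -signr_odd (negPf nn) mulr1.
Qed.

Lemma size_cut p n : (size p <= n.+1)%N -> p`_n = 0 -> (size p <= n)%N.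
Proof.
move=> szp pn; have [//|lt] := leqP (size p) n.
have sp : size p = n.+1 by apply/eqP; rewrite eqn_leq szp.
have : lead_coef p = 0 by rewrite lead_coefE sp.
by move/eqP; rewrite lead_coef_eq0 -size_poly_eq0 sp.
Qed.

Lemma coef_top A B m : (size A <= m.+1)%N -> (size B <= m.+1)%N ->
  (A * B)`_(m + m) = A`_m * B`_m.
Proof.
move=> sA sB; have lt : (m < (m + m).+1)%N by lia.
rewrite coefM (bigD1 (Ordinal lt)) //= addnK big1 ?addr0 // => j jm.
have jm' : j != m :> nat by apply: contra jm => /eqP jm; apply/eqP/val_inj.
have [jlt|jge] := ltnP j m.
  by rewrite [B`__]nth_default ?mulr0 // (leq_trans sB) //; have := ltn_ord j; lia.
by rewrite [A`__]nth_default ?mul0r // (leq_trans sA) //; lia.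
Qed.

Lemma size_line A : (size (A \Po ('X - 'X^2))).-1 = ((size A).-1 * 2)%N.
Proof. by rewrite size_comp_poly size_XsubX2. Qed.

End Flip.

Section LineInvariants.
Variables (k : closedFieldType) (C : curve k) (x : funfield C).
Hypothesis tx : transc x.
Let z := x * (1 - x).

Lemma line_poly p : exists A B, ev x p = ev z A + ev z B * x.
Proof.
have xx : x * x = x - z by rewrite /z; ring.
elim/poly_ind: p => [|p c [A [B pE]]].
  by exists 0, 0; rewrite !rmorph0 mul0r addr0.
exists (c%:P - B * 'X), (A + B).
rewrite rmorphB !rmorphD !rmorphM /= !evX !evC pE.
by rewrite !mulrDl -mulrA xx; ring.
Qed.

(** k[x] = k[z] + k[z] x, and a nonzero second component would put x in k(z). *)
Lemma line_inv p : gen z (ev x p) -> exists A, p = A \Po ('X - 'X^2).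
Proof.
move=> gp; have [A [B pE]] := line_poly p; exists A.
apply: (transc_inj tx); rewrite -ev_line pE.
have [B0|B0] := eqVneq (ev z B) 0; first by rewrite B0 mul0r addr0.
case: (line_not_gen tx); rewrite -/z.
have -> : x = (ev x p - ev z A) / ev z B by rewrite pE addrC addKr mulrAC divff // mul1r.
by apply: gen_div; [apply: genB => //|]; apply: gen_ev.
Qed.

End LineInvariants.

(* The gap of C/rho over the line with coordinate z = x (1 - x), read on C. *)
Definition igap (k : closedFieldType) (C : curve k)
    (s : {rmorphism funfield C -> funfield C}) (x : funfield C)
    (dc : double_cover s x) (rho : funfield C -> funfield C) (a : nat) : Prop :=
  (exists f, [/\ Lsp dc (a + a) f, rho f = f & ~ gen x f]) /\
  (forall n f, (n < a)%N -> Lsp dc (n + n) f -> rho f = f -> gen x f).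

Section Flips.
Variables (k : closedFieldType) (C : curve k).
Variables (delta : {rmorphism funfield C -> funfield C}) (x : funfield C).
Hypothesis dc : double_cover delta x.
Implicit Types (f y : funfield C) (p q A B : {poly k}).

Let tx : transc x. Proof. by case: dc. Qed.
Let z := x * (1 - x).

Lemma not_gen_lin y a b : ~ gen x y -> gen x a -> gen x b -> a != 0 ->
  ~ gen x (a * y + b).
Proof.
move=> ny ga gb a0 g; apply: ny.
have -> : y = (a * y + b - b) / a by rewrite addrK mulrAC divff // mul1r.
by apply: gen_div => //; apply: genB.
Qed.

Lemma ev_1subX p : ev x (p \Po (1 - 'X)) = ev (1 - x) p.
Proof.
elim/poly_ind: p => [|p c IHp]; first by rewrite comp_poly0 !rmorph0.
rewrite comp_polyD comp_polyM comp_polyX comp_polyC.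
by rewrite 2!rmorphD 2!rmorphM /= IHp !evC rmorphB rmorph1 /= !evX.
Qed.

Section OneFlip.
Variable rho : {rmorphism funfield C -> funfield C}.
Hypothesis rI : kinvolution rho.
Hypothesis rx : rho x = 1 - x.
Hypothesis rd : forall f, rho (delta f) = delta (rho f).

Lemma flip_ev p : rho (ev x p) = ev x (p \Po (1 - 'X)).
Proof. by rewrite (ev_morph _ _ (proj2 rI)) rx ev_1subX. Qed.

Lemma flip_gen f : gen x f -> gen x (rho f).
Proof.
move=> [p [q [q0 ->]]]; rewrite fmorph_div /= !flip_ev.
by apply: gen_div; apply: gen_ev.
Qed.

Lemma flip_z : rho z = z.
Proof. by rewrite /z rmorphM rmorphB rmorph1 /= rx; ring. Qed.

Lemma flip_gen_z f : gen z f -> rho f = f.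
Proof.
by move=> [p [q [_ ->]]]; rewrite fmorph_div /= !(ev_morph _ _ (proj2 rI)) flip_z.
Qed.

Lemma gen_z_x f : gen z f -> gen x f.
Proof.
by apply: gen_sub; apply: genM (gen_x x) _; apply: genB (gen1 x) (gen_x x).
Qed.

Lemma gen_flip_inv f : gen z f <-> gen x f /\ rho f = f.
Proof.
split=> [gf|[gf rf]]; first by split; [apply: gen_z_x|apply: flip_gen_z].
have [a [b [ga gb fE]]] := line_basis tx gf.
suff b0 : b = 0 by rewrite fE b0 mul0r addr0.
have : b * (x + x - 1) = 0.
  move: rf; rewrite {1 2}fE rmorphD rmorphM /= rx !flip_gen_z // => e.
  have -> : b * (x + x - 1) = (a + b * x) - (a + b * (1 - x)) by ring.
  by rewrite e subrr.
move/eqP; rewrite mulf_eq0 => /orP[/eqP//|]; rewrite subr_eq0 => /eqP.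
by move=> e; case: (line_sep tx e).
Qed.

(** [rho] commutes with delta, so it carries trace to trace and norm to norm, and x -> 1 - x
    preserves degrees. *)
Lemma flip_Lsp n f : Lsp dc n f -> Lsp dc n (rho f).
Proof.
move=> /Lsp_tr_nm[[p [sp pE]] [r [sr rE]]]; apply/Lsp_tr_nm; split.
  by exists (p \Po (1 - 'X)); rewrite size_flip -flip_ev -pE rmorphD rd.
by exists (r \Po (1 - 'X)); rewrite size_flip -flip_ev -rE rmorphM rd.
Qed.

End OneFlip.

Variable M : nat.
Hypothesis gM : gap dc M.

Lemma top_space y f : Lsp dc M y -> ~ gen x y -> Lsp dc M f ->
  exists c p, (size p <= M.+1)%N /\ f = cst C c * y + ev x p.
Proof.
move=> yM ny fM.
have ie := @indep_mono _ _ _ _ dc y M.+1 1 ny.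
have Ve (i : 'I_(M.+1 + 1)) :
    riemann_roch_space (fib dc (pole dc) *+ M) (@mono_basis _ _ x y M.+1 1 i).
  by apply/Lsp_RR; apply: (mono_Lsp yM); lia.
have [c ->] := indep_basis ie Ve (has_dim_spanned (gap_has_dim gM)) (proj2 (Lsp_RR _ _ _) fM).
rewrite comb_mono big_ord1 expr0 addrC.
exists (c (rshift M.+1 ord0)), (\sum_(i < M.+1) c (lshift 1 i) *: 'X^i).
split; last by rewrite evZ rmorph1 mulr1.
apply: leq_trans (size_sum _ _ _) _; apply/bigmax_leqP => i _.
by apply: leq_trans (size_scale_leq _ _) _; rewrite size_polyXn; have := ltn_ord i; lia.
Qed.

Section OneFlipBound.
Variable rho : {rmorphism funfield C -> funfield C}.
Hypothesis rI : kinvolution rho.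
Hypothesis rx : rho x = 1 - x.
Hypothesis rd : forall f, rho (delta f) = delta (rho f).

Lemma flip_top y : Lsp dc M y -> ~ gen x y ->
  exists c p, (size p <= M.+1)%N /\ rho y = cst C c * y + ev x p.
Proof. by move=> yM ny; apply: (top_space yM ny); apply: flip_Lsp. Qed.

(** Write rho y = c y + q. Then y + rho y is outside k(x) unless c = -1; in that case x y + rho (x
    y) has y-coefficient 2x - 1, nonzero in every characteristic, at the cost of one more pole
    order, which M < 2n allows. *)
Lemma flip_invariant_exists n : (M < n + n)%N ->
  exists f, [/\ Lsp dc (n + n) f, rho f = f & ~ gen x f].
Proof.
move=> Mn; have [[y [yM ny]] _] := gM.
have [c [q [sq yE]]] := flip_top yM ny.
have tr_inv f : rho (f + rho f) = f + rho f by rewrite rmorphD /= (proj1 rI) addrC.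
have L f : Lsp dc M.+1 f -> Lsp dc (n + n) (f + rho f).
  by move=> fL; apply: LspD; last apply: flip_Lsp => //; apply: Lsp_le fL.
have [c1|c1] := eqVneq (1 + c) 0; last first.
  exists (y + rho y); split=> //; first by apply: L; apply: Lsp_le yM.
  have -> : y + rho y = cst C (1 + c) * y + ev x q.
    by rewrite yE rmorphD rmorph1; ring.
  apply: not_gen_lin => //; [exact: gen_cst|exact: gen_ev|].
  by rewrite fmorph_eq0.
have cE : cst C c = -1.
  by apply/eqP; rewrite -addr_eq0 addrC -(rmorph1 (cst C)) -rmorphD c1 rmorph0.
exists (x * y + rho (x * y)); split=> //.
  by apply: L; rewrite -add1n; apply: LspM yM; apply: Lsp_x.
have -> : x * y + rho (x * y) = (x + x - 1) * y + (1 - x) * ev x q.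
  by rewrite rmorphM /= rx yE cE; ring.
have gx := gen_x x; have g1 := gen1 x.
apply: not_gen_lin => //.
- by apply: genB => //; apply: genD.
- by apply: genM (gen_ev _ _); apply: genB.
- by rewrite subr_eq0; apply/eqP; apply: line_sep tx.
Qed.

Lemma igap_exists : exists a, igap dc rho a.
Proof.
have ex : exists n, `[< exists f, [/\ Lsp dc (n + n) f, rho f = f & ~ gen x f] >].
  by exists M.+1; apply/asboolP; apply: flip_invariant_exists; lia.
case: (ex_minnP ex) => a /asboolP ha mina; exists a; split=> // n f lt nf rf.
apply: contrapT => ng.
suff /mina : `[< exists f, [/\ Lsp dc (n + n) f, rho f = f & ~ gen x f] >] by lia.
by apply/asboolP; exists f.
Qed.

Lemma igap_bounds a : igap dc rho a -> (M <= a + a <= M.+2)%N.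
Proof.
move=> [[f [fL rf ng]] low]; apply/andP; split.
  by rewrite leqNgt; apply/negP => lt; apply: ng; apply: (proj2 gM) lt fL.
rewrite leqNgt; apply/negP => lt.
have [|h [hL rh nh]] := @flip_invariant_exists a.-1; first by lia.
by apply: nh; apply: low hL rh; lia.
Qed.

End OneFlipBound.

Section TwoFlips.
Variable sigma : {rmorphism funfield C -> funfield C}.
Hypothesis sI : kinvolution sigma.
Hypothesis sx : sigma x = 1 - x.
Hypothesis sd : forall f, sigma (delta f) = delta (sigma f).

Let dI := double_cover_inv dc.
Let fixE f : delta f = f <-> gen x f. Proof. by case: dc. Qed.

Definition other : {rmorphism funfield C -> funfield C} := sigma \o delta.

Lemma other_inv : kinvolution other.
Proof.
split=> [f|c] /=; first by rewrite -sd (proj1 sI) (proj1 dI).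
by rewrite (proj2 dI) (proj2 sI).
Qed.

Lemma other_x : other x = 1 - x.
Proof. by rewrite /= (proj2 (fixE _) (gen_x x)). Qed.

Lemma other_delta f : other (delta f) = delta (other f).
Proof. by rewrite /= sd. Qed.

Let gflip f := gen_flip_inv sI sx f.

(* Two such functions would have the same conjugation defect up to a
   polynomial; this forces characteristic 2 and a trace of degree < M, and then
   subtracting a square root of the top coefficient of the norm would put y in
   L((M - 1)X). *)
Lemma not_both m : M = (m + m)%N ->
  ~ ((exists f, [/\ Lsp dc M f, sigma f = f & ~ gen x f]) /\
     (exists f, [/\ Lsp dc M f, other f = f & ~ gen x f])).
Proof.
move=> Mm [[y [yM sy ny]] [y2 [y2M ty2 ny2]]].
have M0 := gap_gt0 gM.
have [c [p [sp y2E]]] := top_space yM ny y2M.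
have c0 : cst C c != 0.
  by apply: contra_notN ny2 => /eqP c0; rewrite y2E c0 mul0r add0r; apply: gen_ev.
pose r := y + delta y.
have sr : sigma r = r by rewrite /r rmorphD /= sd sy.
pose P := c^-1 *: (p - (p \Po (1 - 'X))).
have cn0 : c != 0 by move: c0; rewrite fmorph_eq0.
have dyE : delta y = y + ev x P.
  apply: (mulfI c0); rewrite /P evZ rmorphB /= -(flip_ev sI sx).
  have dp : delta (ev x p) = ev x p by apply/fixE/gen_ev.
  have dcc : delta (cst C c) = cst C c by case: dI.
  have scc : sigma (cst C c) = cst C c by case: sI.
  move: ty2; rewrite /= y2E !(rmorphD, rmorphM) /= dcc dp scc sd sy => e.
  rewrite fmorphV mulrDr mulVKf // -[LHS](addrK (sigma (ev x p))) e.
  by rewrite addrA.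
have two0 : (2 : k) = 0.
  apply/eqP/negPn/negP => two0; apply: ny.
  have two0' : cst C 2 != 0 by rewrite fmorph_eq0.
  have -> : y = (r - ev x P) / cst C 2.
    by rewrite /r dyE rmorph_nat; field; rewrite -(rmorph_nat (cst C)).
  apply: gen_div (gen_cst _ _); apply: genB (gen_ev _ _).
  exact: tr_gen.
have twoK : (2 : funfield C) = 0 by rewrite -(rmorph_nat (cst C)) two0 rmorph0.
have addff (f : funfield C) : f + f = 0 by rewrite -mulr2n -mulr_natr twoK mulr0.
have rP : r = ev x P by rewrite /r dyE addrA addff add0r.
have [R PR] : exists R, P = R \Po ('X - 'X^2).
  apply: (line_inv tx); rewrite -rP; apply/gflip; split=> //; exact: tr_gen.
(* M is even, so p and its flip have the same coefficient of degree M. *)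
have sP : (size P <= M)%N.
  apply: leq_trans (size_scale_leq _ _) _; apply: size_cut.
    rewrite (leq_trans (size_polyD _ _)) // size_polyN geq_max sp size_flip.
    exact: sp.
  by rewrite coefB coef_flip ?subrr // Mm addnn odd_double.
have sR : (size R <= m)%N.
  move: sP; have := size_line R; rewrite -PR Mm; clear - M0 Mm.
  by case: (size P) => [|n] /=; case: (size R) => [|l] /=; lia.
have [_ [S0 [sS0 sE]]] := proj1 (Lsp_tr_nm dc M y) yM.
have [S SE] : exists S, S0 = S \Po ('X - 'X^2).
  apply: (line_inv tx); rewrite -sE; apply/gflip; split; first exact: nm_gen.
  by rewrite rmorphM /= sd sy.
have sS : (size S <= M.+1)%N.
  move: sS0; have := size_line S; rewrite -SE; clear.
  by case: (size S0) => [|n] /=; case: (size S) => [|l] /=; lia.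
have [e eE] := closed_sqrt S`_M.
pose W := ev z (e *: 'X^m).
have gW : gen x W by apply: gen_z_x; apply: gen_ev.
(* T(z) is the norm of y - W. Its coefficient of degree M is S_M + e^2 = 2 S_M = 0, since R has
   degree < m. *)
pose T := S - e *: ('X^m * R) + (e ^+ 2) *: 'X^M.
have sT : (size T <= M)%N.
  apply: size_cut.
    rewrite (leq_trans (size_polyD _ _)) // geq_max (leq_trans (size_polyD _ _)) /=.
      by rewrite (leq_trans (size_scale_leq _ _)) // size_polyXn.
    rewrite geq_max sS size_polyN (leq_trans (size_scale_leq _ _)) //.
    rewrite (leq_trans (size_polyMleq _ _)) // size_polyXn Mm; move: sR; clear.
    by case: (size R) => [|n]; lia.
  have Mlt : (M < m)%N = false by rewrite Mm; lia.
  have Mmm : (M - m = m)%N by rewrite Mm; lia.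
  rewrite /T !coefD coefN !coefZ coefXnM coefXn eqxx mulr1 eE Mlt Mmm.
  by rewrite [R`__]nth_default // mulr0 subr0 -mulr2n -mulr_natr two0 mulr0.
have : Lsp dc M.-1 (y - W).
  have dW : delta W = W by apply/fixE.
  apply/Lsp_tr_nm; split.
    exists P; split; first by rewrite prednK.
    rewrite rmorphB /= dW -rP /r.
    have -> : y - W + (delta y - W) = y + delta y - (W + W) by ring.
    by rewrite addff subr0.
  exists (T \Po ('X - 'X^2)); split.
    have := size_line T; move: sT M0; clear.
    by case: (size (T \Po _)%R) => [|n] /=; case: (size T) => [|l] /=; lia.
  rewrite -ev_line rmorphB /= dW.
  have -> : (y - W) * (delta y - W) = y * delta y - W * r + W ^+ 2 by rewrite /r; ring.
  rewrite sE SE rP PR -!ev_line -/z -rmorphM -rmorphXn -rmorphB -rmorphD.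
  congr (ev z _); rewrite /T exprZn -exprM muln2 -addnn -Mm.
  by rewrite scalerAl.
move/(proj2 gM _ _ _) => /=; rewrite ltn_predL => /(_ M0) gy; apply: ny.
by rewrite -[y](subrK W); apply: genD.
Qed.

(* If rho y = y + q in characteristic 2, adding x q to y makes it invariant
   without raising the pole order as soon as deg_z q < m; taking norms in
   rho y = y + q shows that this holds for sigma or for delta sigma. *)
Lemma one_of_two m : M = (m + m)%N ->
  (exists f, [/\ Lsp dc M f, sigma f = f & ~ gen x f]) \/
  (exists f, [/\ Lsp dc M f, other f = f & ~ gen x f]).
Proof.
move=> Mm; have M0 := gap_gt0 gM; have [[y [yM ny]] _] := gM.
have [c [p [sp yE]]] := flip_top sI sx sd yM ny.
(* sigma acts on y modulo k(x) as multiplication by c, and its square is the identity. *)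
have c2 : (c - 1) * (c + 1) = 0.
  apply/eqP/negPn/negP => c0.
  have scc : sigma (cst C c) = cst C c by case: sI.
  have := congr1 sigma yE; rewrite (proj1 sI) rmorphD rmorphM /= scc yE => e.
  have : gen x (cst C ((c - 1) * (c + 1)) * y + (cst C c * ev x p + sigma (ev x p))).
    have -> : cst C ((c - 1) * (c + 1)) * y + (cst C c * ev x p + sigma (ev x p)) =
        cst C c * (cst C c * y + ev x p) + sigma (ev x p) - y.
      by rewrite rmorphM rmorphB rmorphD rmorph1; ring.
    by rewrite -e subrr; apply: gen0.
  apply: not_gen_lin => //; [exact: gen_cst| |by rewrite fmorph_eq0].
  apply: genD; first by apply: genM; [apply: gen_cst|apply: gen_ev].
  by apply: (flip_gen sI sx); apply: gen_ev.
pose r := y + delta y; have gr : gen x r := tr_gen dc y.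
have dy : delta y = r - y by rewrite /r addrC addKr.
have gsr := flip_gen sI sx gr.
have gsp : gen x (sigma (ev x p)) by apply: (flip_gen sI sx); apply: gen_ev.
have [two0|two0] := eqVneq (2 : k) 0; last first.
  have two0' : (2 : funfield C) != 0 by rewrite -(rmorph_nat (cst C)) fmorph_eq0.
  have g2 : gen x 2 by rewrite -(rmorph_nat (cst C)); apply: gen_cst.
  (* delta acts on y modulo k(x) by -1, so one of sigma and [other] acts by 1, and adding to y its
     image under that one gives an invariant. *)
  move/eqP: c2; rewrite mulf_eq0 subr_eq0 addr_eq0 => /orP[/eqP c1|/eqP c1].
    left; exists (y + sigma y); split.
    - by apply: LspD => //; apply: flip_Lsp.
    - by rewrite rmorphD /= (proj1 sI) addrC.
    - have -> : y + sigma y = 2 * y + ev x p by rewrite yE c1 rmorph1; ring.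
      by apply: not_gen_lin => //; apply: gen_ev.
  right; exists (y + other y); split.
  - by apply: LspD => //; apply: (flip_Lsp other_inv other_x other_delta).
  - by rewrite rmorphD (proj1 other_inv) addrC.
  - have -> : y + other y = 2 * y + (sigma r - ev x p).
      by rewrite [other y]/= dy rmorphB yE c1 rmorphN1; ring.
    by apply: not_gen_lin => //; apply: genB => //; apply: gen_ev.
have twoK : (2 : funfield C) = 0 by rewrite -(rmorph_nat (cst C)) two0 rmorph0.
have addff (f : funfield C) : f + f = 0 by rewrite -mulr2n -mulr_natr twoK mulr0.
have oppK (f : funfield C) : - f = f by apply/eqP; rewrite eq_sym -addr_eq0 addff.
have c1 : c = 1.
  have e : c + 1 = c - 1.
    by apply/eqP; rewrite -subr_eq0 opprB addrC addrA addrNK -two0 -[2]/(1 + 1).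
  by move/eqP: c2; rewrite e -expr2 expf_eq0 /= subr_eq0 => /eqP.
pose q := ev x p; have {}yE : sigma y = y + q by rewrite yE c1 rmorph1 mul1r.
have gq : gen x q by apply: gen_ev.
have sq : sigma q = q.
  have := congr1 sigma yE; rewrite (proj1 sI) rmorphD /= yE => e.
  apply/eqP; rewrite -subr_eq0 oppK addrC; apply/eqP; apply: (addrI y).
  by rewrite addr0 addrA -e.
have dq : delta q = q by apply/fixE.
have sr : sigma r = r.
  have e : sigma r - (y + q) = r - y + q.
    by rewrite -yE -rmorphB -dy sd yE rmorphD /= dq dy.
  have -> : sigma r = (sigma r - (y + q)) + (y + q) by rewrite subrK.
  rewrite e; have -> : r - y + q + (y + q) = r + (q + q) by ring.
  by rewrite addff addr0.
have [Q QE] : exists Q, p = Q \Po ('X - 'X^2) by apply: (line_inv tx); apply/gflip.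
have [[r0 [sr0 r0E]] [s0 [ss0 s0E]]] := proj1 (Lsp_tr_nm dc M y) yM.
have [R RE] : exists R, r0 = R \Po ('X - 'X^2).
  by apply: (line_inv tx); rewrite -r0E; apply/gflip.
have half (A : {poly k}) : (size (A \Po ('X - 'X^2)) <= M.+1)%N -> (size A <= m.+1)%N.
  have := size_line A; rewrite Mm; clear.
  by case: (size (A \Po _)) => [|n] /=; case: (size A) => [|l] /=; lia.
have sQ : (size Q <= m.+1)%N by apply: half; rewrite -QE.
have sR : (size R <= m.+1)%N by apply: half; rewrite -RE.
have sRQ : (size (R - Q)%R <= m.+1)%N.
  by rewrite (leq_trans (size_polyD _ _)) // size_polyN geq_max sR sQ.
have qE : q = ev z Q by rewrite /q QE -ev_line.
have rE : r = ev z R by rewrite /r r0E RE -ev_line.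
(* The norm y (r - y) changes by q (r + q) under sigma. As a polynomial in x it has even top degree
   2M, where a flip changes nothing, so that coefficient of q (r - q) vanishes. *)
have top0 : Q`_m * (R - Q)`_m = 0.
  rewrite -coef_top //.
  have : (s0 \Po (1 - 'X)) - s0 = (Q * (R - Q)) \Po ('X - 'X^2).
    apply: (transc_inj tx); rewrite -ev_line rmorphB rmorphM rmorphB /= -qE -rE.
    rewrite -(flip_ev sI sx) -s0E rmorphM /= sd yE rmorphD /= dy dq.
    have -> : (y + q) * (r - y + q) - y * (r - y) = q * (r + q) by ring.
    by rewrite (oppK q).
  move=> e; have : (size ((s0 \Po (1 - 'X)) - s0)%R <= M + M)%N.
    apply: size_cut.
      by rewrite (leq_trans (size_polyD _ _)) // size_polyN geq_max size_flip ss0.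
    by rewrite coefB coef_flip ?subrr // addnn odd_double.
  rewrite e; have := size_line (Q * (R - Q)) => e' le.
  rewrite nth_default //; move: e' le M0; rewrite Mm; clear.
  by case: (size _) => [|n] /=; case: (size (Q * _)) => [|l] /=; lia.
have fixer (A : {poly k}) : (size A <= m)%N -> Lsp dc M (y + x * ev z A).
  move=> sA; apply: LspD => //; 
  have -> : x * ev z A = ev x ('X * (A \Po ('X - 'X^2))).
    by rewrite rmorphM /= evX -ev_line.
  apply: Lsp_ev; rewrite (leq_trans (size_polyMleq _ _)) // size_polyX.
  have := size_line A; move: sA M0; rewrite Mm; clear.
  by case: (size (A \Po _)) => [|n] /=; case: (size A) => [|l] /=; lia.
have ng h : gen x h -> ~ gen x (y + x * h).
  move=> gh; rewrite -[y]mul1r; apply: not_gen_lin => //; [exact: gen1| |exact: oner_neq0].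
  by apply: genM => //; apply: gen_x.
move/eqP: top0; rewrite mulf_eq0 => /orP[/eqP Q0|/eqP RQ0].
  left; exists (y + x * ev z Q); split; first by apply: fixer; apply: size_cut.
    rewrite -qE rmorphD rmorphM /= yE sq sx.
    have -> : y + q + (1 - x) * q = y + (q + q) + (- (x * q)) by ring.
    by rewrite addff addr0 oppK.
  by apply: ng; rewrite -qE.
have zE : ev z (R - Q) = r - q by rewrite rmorphB /= -qE -rE.
(* [other] y = r - y - q, which in characteristic 2 is y + (r - q): R - Q plays for [other] the role
   of Q for sigma. *)
right; exists (y + x * ev z (R - Q)); split; first by apply: fixer; apply: size_cut.
  rewrite zE; have orq : other (r - q) = r - q.
    by rewrite /= rmorphB /= dq (proj2 (fixE _) gr) rmorphB /= sr sq.
  rewrite rmorphD rmorphM orq other_x [other y]/= dy rmorphB /= sr yE.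
  have -> : r - (y + q) + (1 - x) * (r - q) =
    (r + r) - (q + q) + - y + - (x * (r - q)) by ring.
  by rewrite !addff subr0 add0r !oppK.
by apply: ng; rewrite zE; apply: genB.
Qed.

(** The bounds M <= 2a, 2b <= M + 2 decide odd M. For M = 2m, [one_of_two] makes one gap equal to m
    and [not_both] makes the other m + 1. *)
Lemma igap_sum a b : igap dc sigma a -> igap dc other b -> (a + b = M.+1)%N.
Proof.
move=> ga gb.
have /andP[la ua] := igap_bounds sI sx sd ga.
have /andP[lb ub] := igap_bounds other_inv other_x other_delta gb.
have [oM|eM] := boolP (odd M); first by have := odd_double_half M; lia.
pose m := M./2; have Mm : M = (m + m)%N by have := odd_double_half M; rewrite /m; lia.
have ab : ~ (a = m /\ b = m).
  move=> [am bm]; apply: (not_both Mm); rewrite Mm.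
  by split; [rewrite -am; case: ga|rewrite -bm; case: gb].
have [am|bm] : (a <= m)%N \/ (b <= m)%N.
- have [[f [fL sf ng]]|[f [fL sf ng]]] := one_of_two Mm; [left|right];
    rewrite leqNgt; apply/negP => lt; apply: ng; rewrite Mm in fL.
    exact: (proj2 ga) lt fL sf.
  exact: (proj2 gb) lt fL sf.
- have am' : a = m by lia.
  have bm : b <> m by move=> bm; apply: ab.
  by lia.
- have bm' : b = m by lia.
  have am : a <> m by move=> am; apply: ab.
  by lia.
Qed.

End TwoFlips.
End Flips.

(** * Quotient curves *)

Section QuotientGenus.
Variables (k : closedFieldType) (C D : curve k).
Variables (delta rho : {rmorphism funfield C -> funfield C}) (x : funfield C).
Variable iota : {rmorphism funfield D -> funfield C}.
Hypothesis dc : double_cover delta x.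
Hypothesis rI : kinvolution rho.
Hypothesis rx : rho x = 1 - x.
Hypothesis rd : forall f, rho (delta f) = delta (rho f).
Hypothesis iota_cst : forall c, iota (cst D c) = cst C c.
Hypothesis iota_im : forall f, rho f = f <-> exists h, f = iota h.

Let dI := double_cover_inv dc.
Let tx : transc x. Proof. by case: dc. Qed.
Let fixE f : delta f = f <-> gen x f. Proof. by case: dc. Qed.
Let z := x * (1 - x).
Let inj : injective iota := @fmorph_inj _ _ iota.

Lemma iota_ev (u : funfield D) p : iota (ev u p) = ev (iota u) p.
Proof. exact: ev_morph. Qed.

Lemma iota_gen (u h : funfield D) : gen (iota u) (iota h) <-> gen u h.
Proof.
split=> [[p [q [q0 hE]]]|]; last exact: gen_morph.
exists p, q; rewrite -iota_ev fmorph_eq0 in q0; split=> //.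
by apply: inj; rewrite hE -!iota_ev fmorph_div.
Qed.

(** delta commutes with rho, so it acts on the fixed field of rho; the functions fixed by both are
    the flip invariants of k(x), that is k(z). *)
Lemma quotient_cover : exists (s : {rmorphism funfield D -> funfield D}) (u : funfield D),
  [/\ double_cover s u, iota u = z & forall h, iota (s h) = delta (iota h)].
Proof.
have ri h : rho (iota h) = iota h by apply/iota_im; exists h.
have ex h : exists h', iota h' = delta (iota h).
  have /iota_im[h' hE] : rho (delta (iota h)) = delta (iota h) by rewrite rd ri.
  by exists h'.
have [s sE] := choice ex.
have [u uE] : exists u, iota u = z.
  by have /iota_im[u uE] := flip_z rx; exists u.
have sB : zmod_morphism s by move=> f h; apply: inj; rewrite !(sE, rmorphB).
have sM : monoid_morphism s.
  by split=> [|f h]; apply: inj; rewrite !(sE, rmorph1, rmorphM).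
pose sR : {rmorphism funfield D -> funfield D} :=
  HB.pack s (GRing.isZmodMorphism.Build _ _ s sB) (GRing.isMonoidMorphism.Build _ _ s sM).
exists sR, u; split=> //; split.
- split=> [f|c]; apply: inj; first by rewrite !sE (proj1 dI).
  by rewrite sE iota_cst (proj2 dI).
(* A rho-invariant function outside k(x) is moved by delta. *)
- have [M gM] := gap_exists dc.
  have [a [[f [_ rf nf]] _]] := igap_exists gM rI rx rd.
  have /iota_im[h hE] := rf; exists h; apply: contra_notN nf => /eqP sh.
  by apply/fixE; rewrite hE -sE; exact: (congr1 iota sh).
- move=> p up; apply: (line_transc tx); rewrite -/z -uE -iota_ev up.
  by rewrite rmorph0.
- move=> h; split=> [sh|/iota_gen]; last first.
    rewrite uE => /(gen_flip_inv dc rI rx)[/fixE dh _].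
    by apply: inj; rewrite -[RHS]dh -sE.
  apply/iota_gen; rewrite uE; apply/(gen_flip_inv dc rI rx); split; last exact: ri.
  by apply/fixE; rewrite -sE; apply: congr1 sh.
Qed.

(** Polynomials of degree <= N in z are the flip-invariant polynomials of degree <= 2N in x. By the
    trace and norm criterion L(nZ) on D is the invariant part of L(2nX), so the gap of D is a. *)
Lemma quotient_genus a : igap dc rho a -> has_genus D (a%:Z - 1).
Proof.
have [s [u [dcD uE sE]]] := quotient_cover.
have ri h : rho (iota h) = iota h by apply/iota_im; exists h.
have gE h : gen u h <-> gen x (iota h).
  by rewrite -iota_gen uE (gen_flip_inv dc rI rx); split=> [[]|].
have szl n (A : {poly k}) : (size A <= n.+1)%N <-> (size (A \Po ('X - 'X^2)) <= (n + n).+1)%N.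
  have := size_line A.
  by case: (size (A \Po _)%R) => [|l] /=; case: (size A) => [|l'] /=; split; lia.
have LE n h : Lsp dcD n h <-> Lsp dc (n + n) (iota h).
  have one N w v : iota w = v -> rho v = v -> gen x v ->
      (exists p : {poly k}, (size p <= N.+1)%N /\ w = ev u p) <->
      (exists p : {poly k}, (size p <= (N + N).+1)%N /\ v = ev x p).
    move=> wv rv gv; split=> [[p [sp wE]]|[p [sp vE]]].
      exists (p \Po ('X - 'X^2)); split; first exact: (proj1 (szl N p) sp).
      by rewrite -wv wE iota_ev uE ev_line.
    have [A AE] : exists A, p = A \Po ('X - 'X^2).
      by apply: (line_inv tx); rewrite -vE; apply/(gen_flip_inv dc rI rx); split.
    exists A; split; first by apply: (proj2 (szl N A)); rewrite -AE.
    by apply: inj; rewrite wv vE AE iota_ev uE ev_line.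
  have tE : iota (h + s h) = iota h + delta (iota h) by rewrite rmorphD sE.
  have nE : iota (h * s h) = iota h * delta (iota h) by rewrite rmorphM sE.
  have rt w v : iota w = v -> rho v = v by move=> <-; apply: ri.
  have o1 : _ <-> _ := one n _ _ tE (rt _ _ tE) (tr_gen dc _).
  have o2 : _ <-> _ := one (n + n)%N _ _ nE (rt _ _ nE) (nm_gen dc _).
  by split=> /Lsp_tr_nm[/o1 t1 /o2 n1]; apply/Lsp_tr_nm.
move=> [[f [fL rf nf]] low]; apply: (gap_genus (dc := dcD)); split.
  have /iota_im[h hE] := rf; exists h; rewrite LE gE -hE; by [].
move=> n h lt /LE hL; apply/gE; exact: low lt hL (ri h).
Qed.

End QuotientGenus.

(** * The fixed field of an involution as the function field of a curve *)

Section FixedField.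
Variables (K : fieldType) (t : {rmorphism K -> K}).

Definition fix_pred : {pred K} := fun f => t f == f.

Fact fix_divring : divring_closed fix_pred.
Proof.
split=> [|f h|f h]; rewrite !unfold_in ?rmorph1 // => /eqP tf /eqP th.
  by rewrite rmorphB tf th.
by rewrite fmorph_div tf th.
Qed.

HB.instance Definition _ := GRing.isDivringClosed.Build K fix_pred fix_divring.

Record fix_field := FixField { fix_val :> K; fix_valP : fix_val \in fix_pred }.

HB.instance Definition _ := [isSub for fix_val].
HB.instance Definition _ := [Choice of fix_field by <:].
HB.instance Definition _ := [SubChoice_isSubIntegralDomain of fix_field by <:].
HB.instance Definition _ := [SubIntegralDomain_isSubField of fix_field by <:].

Definition fix_incl : {rmorphism fix_field -> K} := \val.

Lemma fix_inclP f : t f = f <-> exists h, f = fix_incl h.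
Proof.
split=> [/eqP tf|[h ->]]; first by exists (FixField (tf : f \in fix_pred)).
exact/eqP/(fix_valP h).
Qed.

End FixedField.

Section QuotientCurve.
Variables (k : closedFieldType) (C : curve k).
Variables (delta rho : {rmorphism funfield C -> funfield C}) (x : funfield C).
Hypothesis dc : double_cover delta x.
Hypothesis rI : kinvolution rho.
Hypothesis rx : rho x = 1 - x.
Hypothesis rd : forall f, rho (delta f) = delta (rho f).

Let dI := double_cover_inv dc.
Let fixE f : delta f = f <-> gen x f. Proof. by case: dc. Qed.
Let z := x * (1 - x).
Let F : fieldType := fix_field rho.
Let incl : {rmorphism F -> funfield C} := fix_incl rho.

Lemma fix_cst_ex : exists c : {rmorphism k -> F}, forall a, incl (c a) = cst C a.
Proof.
have ex a : exists h : F, incl h = cst C a.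
  by have /fix_inclP[h ->] := proj2 rI a; exists h.
have [c cE] := choice ex.
have inj : injective incl by apply: fmorph_inj.
have cB : zmod_morphism c by move=> a b; apply: inj; rewrite !(cE, rmorphB).
have cM : monoid_morphism c.
  by split=> [|a b]; apply: inj; rewrite !(cE, rmorph1, rmorphM).
pose cR : {rmorphism k -> F} :=
  HB.pack c (GRing.isZmodMorphism.Build _ _ c cB) (GRing.isMonoidMorphism.Build _ _ c cM).
by exists cR.
Qed.

(** A curve needs a finite extension of k(X): the fixed field has basis 1, w over k(z), with w an
    invariant function outside k(x). *)
Lemma fix_curve_ex : exists (D : curve k) (i : {rmorphism funfield D -> funfield C}),
  (forall c, i (cst D c) = cst C c) /\ (forall f, rho f = f <-> exists h, f = i h).
Proof.
have [c cE] := fix_cst_ex; have inj : injective incl by apply: fmorph_inj.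
have [u uE] : exists u : F, incl u = z.
  by have /fix_inclP[u uE] := flip_z rx; exists u; rewrite -uE.
pose j : {rmorphism {poly k} -> F} := horner_eval u \o map_poly c.
have jX : j 'X = u by rewrite /j /= map_polyX horner_evalE hornerX.
have jC a : j a%:P = c a by rewrite /j /= map_polyC horner_evalE hornerC.
have jE p : incl (j p) = ev z p.
  elim/poly_ind: p => [|p a IHp]; first by rewrite !rmorph0.
  rewrite (rmorphD j) (rmorphM j) jX jC (rmorphD incl) (rmorphM incl) IHp uE cE.
  by rewrite rmorphD rmorphM /= evX evC.
have tz : transc z by apply: line_transc; case: dc.
have injj : injective j.
  by move=> p q e; apply: (transc_inj tz); rewrite -!jE e.
have [iota iE] := frac_lift injj.
have iotaP (g : funfield C) : gen z g <-> exists q, g = incl (iota q).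
  split=> [[p [q [q0 ->]]]|[q ->]].
    by exists (tofrac p / tofrac q); rewrite !fmorph_div !iE !jE.
  have [n [d [d0 ->]]] := frac_decomp q; exists n, d.
  by rewrite transc_eq0 // !fmorph_div !iE !jE.
have iotac a : iota (tofrac a%:P) = c a.
  by rewrite iE; apply: inj; rewrite jE evC cE.
have cP : exists2 i : {rmorphism {fraction {poly k}} -> F},
    (forall a, i (tofrac a%:P) = c a) & exists n, has_dim i (fun _ => True) n.
  exists iota => //; exists 2.
  have [M gM] := gap_exists dc.
  have [_ [[w0 [_ rw nw]] _]] := igap_exists gM rI rx rd.
  have /fix_inclP[w wE] := rw.
  have dw : w0 - delta w0 != 0.
    by rewrite subr_eq0 eq_sym; apply: contra_notN nw => /eqP dw; apply/fixE.
  exists (fun i : 'I_2 => if i == ord0 then 1 else w); split.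
    move=> a; rewrite !big_ord_recl big_ord0 addr0 /= mulr1 => /(congr1 incl).
    rewrite rmorphD rmorphM rmorph0 -wE.
    set A := incl (iota (a ord0)); set B := incl (iota (a _)) => e.
    have gA : gen x A by apply: (gen_z_x (x := x)); apply/iotaP; eexists.
    have gB : gen x B by apply: (gen_z_x (x := x)); apply/iotaP; eexists.
    have B0 : B = 0.
      apply/eqP/negPn/negP => B0; apply: (not_gen_lin nw gB gA B0).
      by rewrite addrC e; apply: gen0.
    have A0 : A = 0 by move: e; rewrite B0 mul0r addr0.
    have zero q : incl (iota q) = 0 -> q = 0.
      by move=> /eqP; rewrite !fmorph_eq0 => /eqP.
    move=> i; apply: zero; case: (unliftP ord0 i) => [l ->|-> //].
    by rewrite ord1.
  move=> f; split=> // _.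
  have [g gf] : exists g, incl f = g by exists (incl f).
  have rf : rho g = g by apply/fix_inclP; exists f.
  (* Solves g = a + b w0 together with its delta-conjugate. Both b and a are fixed by delta and rho,
     hence lie in k(z). *)
  pose b := (g - delta g) / (w0 - delta w0).
  have gb : gen z b.
    apply/(gen_flip_inv dc rI rx); split.
      apply/fixE; rewrite fmorph_div !rmorphB /= !(proj1 dI).
      by rewrite -(opprB g) -(opprB w0) invrN mulrNN.
    by rewrite fmorph_div !rmorphB /= !rd rf rw.
  have ga : gen z (g - b * w0).
    have [gbx rb] := proj1 (gen_flip_inv dc rI rx b) gb.
    apply/(gen_flip_inv dc rI rx); split; last by rewrite rmorphB rmorphM /= rf rw rb.
    apply/fixE; rewrite rmorphB rmorphM /= (proj2 (fixE _) gbx) /b.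
    by field.
  have [a' aE] := proj1 (iotaP _) ga; have [b' bE] := proj1 (iotaP _) gb.
  exists (fun i : 'I_2 => if i == ord0 then a' else b').
  rewrite !big_ord_recl big_ord0 addr0 /= mulr1; apply: inj.
  by rewrite (rmorphD incl) (rmorphM incl) -aE -bE -wE subrK gf.
exists (@Curve k F c cP), incl; split; first exact: cE.
exact: fix_inclP.
Qed.

End QuotientCurve.

Section QuotientMorphism.
Variables (k : closedFieldType) (C D : curve k).
Variables (rho : {rmorphism funfield C -> funfield C}).
Variable iota : {rmorphism funfield D -> funfield C}.
Hypothesis rI : kinvolution rho.
Hypothesis rnt : exists f, rho f != f.
Hypothesis iota_cst : forall c, iota (cst D c) = cst C c.
Hypothesis iota_im : forall f, rho f = f <-> exists h, f = iota h.
Hypothesis resD : forall R : point D, has_residues R.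

Lemma restrict_point (P : point C) : exists (R : point D) (e : int),
  0 < e /\ forall h, ord P (iota h) = e * ord R h.
Proof.
apply: (@point_of_valuation _ D (fun h => ord P (iota h))).
- by rewrite rmorph0 Defs.ord0.
- by move=> f h f0 h0; rewrite rmorphM ordM ?fmorph_eq0.
- by move=> f h f0 h0 fh0; rewrite rmorphD ordD -?rmorphD ?fmorph_eq0.
- by move=> c; rewrite iota_cst ord_cst.
by have [f [/iota_im[h ->] hP]] := fixed_nontrivial rI P; exists h.
Qed.

(** q restricts valuations to the fixed field; it is onto by [extend_point], and [fibre] shows that
    its fibres are orbits. *)
Lemma quotient_exists : exists q : morphism C D,
  [/\ forall R : point D, exists P, q P = R,
      forall P Q, q P = q Q <-> Q = P \/ Q = conj_pt rI P
    & forall f, rho f = f <-> exists h, f = pullback q h].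
Proof.
have [q qP] := choice restrict_point.
have qE P h : vge (q P) 0 h <-> vge P 0 (iota h).
  have [e [e0 eE]] := qP P; rewrite /vge fmorph_eq0 eE.
  by rewrite pmulr_rge0.
have reg P h : regular_at h (q P) -> regular_at (iota h) P.
  by move=> /regularE/qE/regularE.
exists (Morphism iota_cst reg); split=> //= [R|P Q].
  have [P [e [e0 eE]]] := extend_point iota_cst rI iota_im rnt (@resD R).
  exists P; apply: ring_eq => h /qE; rewrite /vge fmorph_eq0 eE.
  by rewrite pmulr_rge0.
have sub P' Q' : q P' = q Q' -> P' = Q' \/ P' = conj_pt rI Q'.
  move=> e; apply: fibre => f /iota_im[h ->] /qE; rewrite -e.
  by move/qE.
split=> [/esym/sub//|[->//|->]].
by apply: ring_eq => h /qE hP; apply/qE; rewrite vge_conj (proj2 (iota_im _)) //; exists h.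
Qed.

End QuotientMorphism.

Lemma double_cover_ext (k : closedFieldType) (C : curve k)
    (s s' : {rmorphism funfield C -> funfield C}) (x : funfield C) :
  (forall f, s' f = s f) -> double_cover s x -> double_cover s' x.
Proof.
move=> e [[sI sc] [y sy] tx fixE]; split=> //.
- by split=> [f|c]; rewrite !e.
- by exists y; rewrite e.
- by move=> f; rewrite e.
Qed.

Lemma hyperelliptic_cover (k : closedFieldType) (C : curve k) (pi : int)
    (delta : morphism C C) :
  hyperelliptic C -> has_genus C pi -> 2 <= pi -> canonical_involution delta ->
  exists x, double_cover (pullback delta) x.
Proof.
move=> [_ [phi phi2]] gC pi2 cd.
have [|s [x dc]] := degree_two_cover phi2.
  by move=> /(genus_unique gC) pi0; move: pi2; rewrite pi0.
have [M gM] := gap_exists dc.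
have M2 : (2 < M)%N by have := genus_unique gC (gap_genus gM); move: pi2; clear; lia.
by exists x; apply: double_cover_ext (dc); apply: canonical_pullback gM M2 cd.
Qed.

Definition identity_morphism (k : closedFieldType) (C : curve k) : morphism C C :=
  @Morphism k C C id idfun (fun=> erefl) (fun _ _ => id).

(* For sigma = delta the composite is the identity, which does not have order
   two; its quotient is C itself, of genus pi - 0. *)
Theorem theorem3p2 (k : closedFieldType) (C : curve k) (pi g : int)
    (delta sigma : morphism C C) :
  hyperelliptic C ->
  has_genus C pi ->
  2 <= pi ->
  canonical_involution delta ->
  involution_of_genus sigma g ->
  (~ (sigma =1 delta) ->
     involution_of_genus (comp_morphism delta sigma) (pi - g))
  /\ quotient_has_genus (comp_morphism delta sigma) (pi - g).
Proof.
move=> hC gC pi2 cd [sig2 [D [q [[_ _ qim] gD]]]].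
have [x dc] := hyperelliptic_cover hC gC pi2 cd.
have del2 := proj1 cd.
have [sI sP] := order_two_kinv dc sig2.
have [dI dP] := order_two_kinv dc del2.
have [M gM] := gap_exists dc.
have piM := genus_unique gC (gap_genus gM).
have M2 : (2 < M)%N by move: pi2; rewrite piM; clear; lia.
have snt := order_two_nontrivial dc sig2.
have [eq_sd|ne_sd] := pselect (forall f, pullback sigma f = pullback delta f).
  have sdP P : sigma P = delta P.
    by rewrite sP dP; apply: point_eq => f; rewrite !ord_conj eq_sd.
  split; first by case.
  have [u uE] : exists u, x = pullback q u.
    by apply/qim; rewrite eq_sd; case: (dc) => _ _ _ ->; apply: gen_x.
  (* sigma and delta have the common fixed field k(x), so D has function field k(u). *)
  have g0 : g = 0.
    apply: (genus_unique gD); apply: (@rational_genus _ _ u).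
      move=> p up; case: (dc) => _ _ tx _; apply: tx.
      by rewrite uE -(ev_morph _ _ (pullback_cst q)) up rmorph0.
    move=> h; case: (dc) => _ _ _ fixE.
    have /fixE : pullback delta (pullback q h) = pullback q h.
      by rewrite -eq_sd; apply/qim; exists h.
    by rewrite uE => /(iota_gen (pullback_cst q)).
  have idP P : comp_morphism delta sigma P = P by rewrite /= sdP (proj1 del2).
  exists C, (identity_morphism C); rewrite g0 subr0; split=> //; split=> /=.
  - by move=> R; exists R.
  - move=> P Q; split=> [->|[n ->]]; first by exists 0.
    by elim: n => //= n IHn; rewrite sdP (proj1 del2).
  - by move=> f; rewrite eq_sd (proj1 dI); split=> // _; exists f.
have snd : exists f, pullback sigma f != pullback delta f.
  apply: contrapT => nex; apply: ne_sd => f.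
  by apply/eqP/negPn/negP => ne; apply: nex; exists f.
have [t [gxt gtx st]] := normal_form gM M2 sI snt snd.
have sd f := sigma_delta gM M2 sI f.
have dct := double_cover_gen dc gxt gtx.
have [N gN] := gap_exists dct.
(* The gap with respect to t equals the gap with respect to x, as both are one more than the
   genus. *)
have NM := genus_unique (gap_genus gN) (gap_genus gM).
have [a ga] := igap_exists gN sI st sd.
have gE := genus_unique gD (quotient_genus sI st sd (pullback_cst q) qim ga).
(* Pullback reverses the order: this is the pullback of P -> delta (sigma P). *)
pose rho := other (pullback delta) (pullback sigma).
have rI : kinvolution rho := other_inv dct sI sd.
have rt : rho t = 1 - t := other_x dct st.
have rd : forall f, rho (pullback delta f) = pullback delta (rho f).
  exact: other_delta sd.
have [b gb] := igap_exists gN rI rt rd.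
have ab := igap_sum gN sI st sd ga gb.
have rnt : exists f, rho f != f.
  by have [f ne] := snd; exists (pullback delta f); rewrite /= (proj1 dI).
have [D' [i [ic iim]]] := fix_curve_ex dct rI rt rd.
have [s' [u [dc' _ _]]] := quotient_cover dct rI rt rd ic iim.
have [q' [q'surj q'fib q'im]] := quotient_exists rI rnt ic iim (residues dc').
have compP P : comp_morphism delta sigma P = conj_pt rI P.
  by apply: point_eq => f; rewrite /= dP ord_conj sP !ord_conj.
have comp2 P : comp_morphism delta sigma (comp_morphism delta sigma P) = P.
  by rewrite !compP conj_ptK.
have qg : quotient_has_genus (comp_morphism delta sigma) (pi - g).
  exists D', q'; split; last first.
    (* pi = N - 1, g = a - 1 and a + b = N + 1. *)
    have -> : pi - g = b%:Z - 1 by move: gE NM piM ab; clear; lia.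
    exact (quotient_genus rI rt rd (pullback_cst q') q'im gb).
  split=> // P Q; rewrite q'fib -compP; split=> [[->|->]|[n ->]].
  - by exists 0.
  - by exists 1.
  - elim: n => [|n [IHn|IHn]]; first by left.
      by right; rewrite iterS IHn.
    by left; rewrite iterS IHn comp2.
split=> // ne; split=> //; split=> // comp1; apply: ne => P.
by rewrite -[RHS]/(delta P) -[in RHS](comp1 P) /= (proj1 del2).
Qed.
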